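(* Let $U=\{z\in\mathbb{C}:|z|<1\}$, let $f:U\to\overline{\mathbb{C}}_w$ be a meromorphic function, and let $z_1,z_2$ be points in $U$ distinct from the poles of $f$ and such that $f(z_1)\neq f(z_2)$. Suppose that every circular arc joining the points $f(z_1)$ and $f(z_2)$ and belonging to the image $f(U)$ is univalently covered by $f$. Then, with $w_k=f(z_k)$, $k=1,2$, $$ \left|(1-|z_1|^2)f'(z_1)\,(1-|z_2|^2)f'(z_2)\right|\tanh^2(d(z_1,z_2))\le |w_1-w_2|^2, $$ where $d(z_1,z_2)$ is the hyperbolic distance in $U$. This inequality is sharp, i.e. equality is attained for some $f,z_1,z_2$ satisfying the hypotheses.
   Context: $\overline{\mathbb{C}}_w$ denotes the extended complex $w$-plane. A circular arc joining $f(z_1)$ and $f(z_2)$ is an arc, with these endpoints, of a circle passing through both points. An arc contained entirely in $f(U)$ is univalently covered by $f$ if every point of the arc has a single pre-image under $f$ in $U$. The hyperbolic distance is normalized so that $\tanh d(z_1,z_2)=\left|\dfrac{z_1-z_2}{1-\overline{z}_1z_2}\right|$. *)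

(* Defs.v *)
(* Stdlib reals and Coquelicot's complex numbers. *)
From Stdlib Require Import Reals Lra.
From Coquelicot Require Import Coquelicot.

Local Open Scope R_scope.

Definition unit_disk (z : C) : Prop := Cmod z < 1.

(** The extended complex plane. *)
Inductive Cbar : Set :=
  | Cfinite : C -> Cbar
  | Cinfty : Cbar.

(* The value 0 at infinity is a dummy. *)
Definition Cbar_fin (w : Cbar) : C :=
  match w with
  | Cfinite c => c
  | Cinfty => RtoC 0
  end.

Definition fin_part (f : C -> Cbar) : C -> C := fun z => Cbar_fin (f z).

(** [f] is holomorphic on [D] except for isolated poles, and [Cinfty] is the
    value of [f] exactly at the poles. Only the values of [f] near points of [D]
    matter. [ex_derive] is complex differentiability here: the scalar field
    inferred for a map [C -> C] is [C_AbsRing]. *)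
Definition meromorphic_on (D : C -> Prop) (f : C -> Cbar) : Prop :=
  forall z : C, D z ->
    match f z with
    | Cfinite _ =>
        locally z (fun x => f x <> Cinfty) /\ ex_derive (fin_part f) z
    | Cinfty =>
        locally' z (fun x => f x <> Cinfty) /\
        filterlim (fun x => Cmod (fin_part f x)) (locally' z)
          (Rbar_locally p_infty)
    end.

(* [C_derive] is the complex derivative wherever the function is complex
   differentiable ([C_derive_correct]), hence at every point of the domain of
   a meromorphic function that is not a pole. *)
Definition mderive (f : C -> Cbar) (z : C) : C := C_derive (fin_part f) z.

(** [arc_point c r alpha delta t], for [0 <= t <= 1], runs through the arc of
    the circle of centre [c] and radius [r] that starts at argument [alpha]
    and subtends the signed angle [delta]. *)
Definition arc_point (c : C) (r alpha delta t : R) : C :=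
  (c + (r * cos (alpha + t * delta), r * sin (alpha + t * delta))%R)%C.

(** [A] is an arc with endpoints [a] and [b] of a (Euclidean) circle through
    [a] and [b]. As [delta] may have either sign, both arcs of every such circle
    are obtained. *)
Definition circular_arc_joining (a b : C) (A : C -> Prop) : Prop :=
  exists (c : C) (r alpha delta : R),
    0 < r /\ 0 < Rabs delta < 2 * PI /\
    arc_point c r alpha delta 0 = a /\
    arc_point c r alpha delta 1 = b /\
    (forall w : C,
       A w <-> exists t : R, 0 <= t <= 1 /\ w = arc_point c r alpha delta t).

Definition arc_in_image (f : C -> Cbar) (A : C -> Prop) : Prop :=
  forall w : C, A w -> exists z : C, unit_disk z /\ f z = Cfinite w.

Definition univalently_covered (f : C -> Cbar) (A : C -> Prop) : Prop :=
  forall w : C, A w -> exists! z : C, unit_disk z /\ f z = Cfinite w.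

Definition arcs_univalently_covered (f : C -> Cbar) (w1 w2 : C) : Prop :=
  forall A : C -> Prop,
    circular_arc_joining w1 w2 A -> arc_in_image f A ->
    univalently_covered f A.

Definition pseudo_hyp_dist (z1 z2 : C) : R :=
  Cmod ((z1 - z2) / (1 - Cconj z1 * z2))%C.

(** Hyperbolic distance of the unit disk for the metric [|dz| / (1 - |z|^2)]:
    the inverse hyperbolic tangent of the pseudo-hyperbolic distance. *)
Definition hyp_dist (z1 z2 : C) : R :=
  / 2 * ln ((1 + pseudo_hyp_dist z1 z2) / (1 - pseudo_hyp_dist z1 z2)).

(* [z1], [z2] lie in the disk and are not poles, [w1], [w2] are their images. *)
Definition admissible (f : C -> Cbar) (z1 z2 w1 w2 : C) : Prop :=
  meromorphic_on unit_disk f /\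
  unit_disk z1 /\ unit_disk z2 /\
  f z1 = Cfinite w1 /\ f z2 = Cfinite w2 /\ w1 <> w2 /\
  arcs_univalently_covered f w1 w2.

Lemma pseudo_hyp_dist_lt1 (z1 z2 : C) :
  unit_disk z1 -> unit_disk z2 -> pseudo_hyp_dist z1 z2 < 1.
Proof.
unfold unit_disk; destruct z1 as [a b], z2 as [c d]; intros H1 H2.
assert (N : forall x y, Cmod (x, y) < 1 -> x ^ 2 + y ^ 2 < 1).
{ intros x y H; unfold Cmod in H; simpl fst in H; simpl snd in H.
  rewrite <- sqrt_1 in H; apply sqrt_lt_0_alt in H; exact H. }
apply N in H1; apply N in H2.
set (P := (a - c) ^ 2 + (b - d) ^ 2).
set (Q := (1 - (a * c + b * d)) ^ 2 + (b * c - a * d) ^ 2).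
assert (PQ : P < Q).
{ replace Q with (P + (1 - (a ^ 2 + b ^ 2)) * (1 - (c ^ 2 + d ^ 2)))
    by (unfold P, Q; ring).
  assert (0 < (1 - (a ^ 2 + b ^ 2)) * (1 - (c ^ 2 + d ^ 2)))
    by (apply Rmult_lt_0_compat; lra).
  lra. }
assert (P0 : 0 <= P)
  by (unfold P; apply Rplus_le_le_0_compat; apply pow2_ge_0).
assert (EP : Cmod ((a, b) - (c, d))%C = sqrt P)
  by (unfold Cmod, P; simpl fst; simpl snd; f_equal; ring).
assert (EQ : Cmod (1 - Cconj (a, b) * (c, d))%C = sqrt Q)
  by (unfold Cmod, Q; simpl fst; simpl snd; f_equal; ring).
assert (Q0 : 0 < sqrt Q) by (apply sqrt_lt_R0; lra).
unfold pseudo_hyp_dist; rewrite Cmod_div, EP, EQ.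
- apply Rmult_lt_reg_r with (sqrt Q); [exact Q0|].
  unfold Rdiv; rewrite Rmult_assoc, Rinv_l by lra.
  rewrite Rmult_1_r, Rmult_1_l; apply sqrt_lt_1_alt; lra.
- intros E; apply (f_equal Cmod) in E; rewrite EQ, Cmod_0 in E; lra.
Qed.

Lemma tanh_hyp_dist (z1 z2 : C) :
  unit_disk z1 -> unit_disk z2 ->
  tanh (hyp_dist z1 z2) = Cmod ((z1 - z2) / (1 - Cconj z1 * z2))%C.
Proof.
intros H1 H2; generalize (pseudo_hyp_dist_lt1 z1 z2 H1 H2).
assert (P0 : 0 <= pseudo_hyp_dist z1 z2) by apply Cmod_ge_0.
change (Cmod ((z1 - z2) / (1 - Cconj z1 * z2))%C) with (pseudo_hyp_dist z1 z2).
unfold hyp_dist; revert P0; generalize (pseudo_hyp_dist z1 z2); intros p P0 P1.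
set (q := (1 + p) / (1 - p)); set (u := exp (/ 2 * ln q)).
assert (q0 : 0 < q) by (apply Rdiv_lt_0_compat; lra).
assert (u0 : 0 < u) by apply exp_pos.
assert (uu : u * u = q).
{ unfold u; rewrite <- exp_plus.
  replace (/ 2 * ln q + / 2 * ln q) with (ln q) by field.
  now apply exp_ln. }
unfold tanh, sinh, cosh; rewrite exp_Ropp; fold u.
replace ((u - / u) / 2 / ((u + / u) / 2)) with ((u * u - 1) / (u * u + 1))
  by (field; repeat split; nra).
rewrite uu; unfold q; field; lra.
Qed.

(* Main.v *)
(* Put g = (f - w1) / (f - w2). The map w |-> (w - w1) / (w - w2) carries the arcs from w1 to w2 to the rays
   from 0 to infinity, those of angles 0 and pi excepted. Let Z1 and Z2 map the unit disk
   conformally onto the two halves of U cut by the hyperbolic bisector of z1 and z2, as inverses of the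
   quotient of the Blaschke factors and of its reciprocal, and put F1 = g o Z1 and F2 = (1 / g) o Z2,
   which vanish at 0. The inequality says |F1'(0) F2'(0)| <= 1.
   For all but countably many angles theta, lift the ray of angle theta by F1, and the reciprocal ray by F2,
   from 0 until |zeta| is close to 1, at the values T1 and T2 of the ray parameter. If T1 T2 > 1, the whole arc
   lies in f(U), hence is univalently covered, and a common value of the two lifts gives a point of
   both halves: impossible. Now compare areas in the coordinate log zeta (length-area method): the tubes around
   the lifts are disjoint, so ln T1 + ln T2 <= 0 for almost all theta forces ln |F1'(0) F2'(0)| <= 0.
   Area is measured by lattice points, which makes it superadditive without any measurability. *)

(* Let [a = zeta F'(zeta) / F(zeta)] and [u = Re a > 0]. A tube of opening [eta] in the image has
   width about [eta / u] on a circle around [0], while a radial step [D] along the lift costs at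
   least about [u D] in [ln |F|]. Since [u + 1 / u >= 2], width and cost together have a linear
   lower bound, and steps simply add up: over the ring from [c0] to [c1] the tube has area at least
   about [eta (2 (c1 - c0) - ln (T / t0))], with [t0] at least about [|F'(0)| exp c0]. Each map has
   a ring of its own, of area [2 pi (c1 - c0)]; for [c1] near [0] the sum of the two balances is the
   claim. How far a tube estimate reaches depends on [theta] without any uniformity. So nothing is
   integrated in [theta]: a one-sided derivative bound for a superadditive function of the angle,
   valid off a countable set, takes the place of the integral. The second map is taken with argument
   and value conjugated, so that both lifts have the same angle. The hypothesis gives only pointwise
   complex differentiability; continuity of the derivative and isolation of critical points are
   therefore derived from Goursat's theorem and Cauchy's formula. *)
Require Import Defs.
From Stdlib Require Import Reals Lra Lia Psatz Classical ClassicalEpsilon IndefiniteDescription Wf_nat Cantor.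
From Coquelicot Require Import Coquelicot.

Local Open Scope R_scope.

(** * Complex derivatives *)

(* Coquelicot's structures hide [C] from [ring] and [field]. *)
Ltac Ceq := match goal with |- ?x = ?y => change (@eq C x y) end.

(** The inequality is multiplied out, so that [y = z] needs no exclusion; [cderiv_is_derive] ties
    this form to Coquelicot's derivative. *)
Definition cderiv (f : C -> C) (z l : C) : Prop :=
  forall eps, 0 < eps -> exists d, 0 < d /\ forall y, Cmod (y - z) < d ->
    Cmod (f y - f z - l * (y - z)) <= eps * Cmod (y - z).

Definition ccont (f : C -> C) (z : C) : Prop :=
  forall eps, 0 < eps -> exists d, 0 < d /\ forall y, Cmod (y - z) < d ->
    Cmod (f y - f z) < eps.

Definition copen (V : C -> Prop) : Prop :=
  forall z, V z -> exists d, 0 < d /\ forall y, Cmod (y - z) < d -> V y.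

Definition disk (a : C) (r : R) (z : C) : Prop := Cmod (z - a) < r.

Lemma Cmod_sub_sym (x y : C) : Cmod (x - y) = Cmod (y - x).
Proof. rewrite <- Cmod_opp. f_equal. ring. Qed.

Lemma Cmod_sub_diag (x : C) : Cmod (x - x) = 0.
Proof. unfold Cminus. now rewrite Cplus_opp_r, Cmod_0. Qed.

Lemma lt_min_l (x a b : R) : x < Rmin a b -> x < a.
Proof. intros H. exact (Rlt_le_trans _ _ _ H (Rmin_l _ _)). Qed.

Lemma lt_min_r (x a b : R) : x < Rmin a b -> x < b.
Proof. intros H. exact (Rlt_le_trans _ _ _ H (Rmin_r _ _)). Qed.

Lemma Cmod_tri3 (x y z : C) : Cmod (x - z) <= Cmod (x - y) + Cmod (y - z).
Proof. replace (x - z)%C with ((x - y) + (y - z))%C by ring. apply Cmod_triangle. Qed.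

Lemma Cmod_sub_le (x y : C) : Cmod x - Cmod y <= Cmod (x - y).
Proof.
assert (H := Cmod_triangle (x - y) y).
replace (x - y + y)%C with x in H by ring. lra.
Qed.

Lemma Cmod_le_sub (x y : C) : Cmod (x - y) <= Cmod x + Cmod y.
Proof. rewrite <- (Cmod_opp y). apply Cmod_triangle. Qed.

Lemma Cmod_sub_eq_0 (x y : C) : Cmod (x - y) <= 0 -> x = y.
Proof.
intros H. assert (Cmod (x - y) = 0) as E by (generalize (Cmod_ge_0 (x - y)); lra).
apply Cmod_eq_0 in E. replace x with (x - y + y)%C by ring. rewrite E. ring.
Qed.

Lemma cderiv_bound (f : C -> C) (z l : C) :
  cderiv f z l -> exists d, 0 < d /\ forall y, Cmod (y - z) < d ->
    Cmod (f y - f z) <= (Cmod l + 1) * Cmod (y - z).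
Proof.
intros H. destruct (H 1) as [d [d0 Hd]]; [lra|].
exists d; split; [exact d0|]. intros y Hy. specialize (Hd y Hy).
assert (T := Cmod_triangle (f y - f z - l * (y - z)) (l * (y - z))).
replace (f y - f z - l * (y - z) + l * (y - z))%C with (f y - f z)%C in T by ring.
rewrite Cmod_mult in T. lra.
Qed.

Lemma cderiv_ccont (f : C -> C) (z l : C) : cderiv f z l -> ccont f z.
Proof.
intros H eps e0. destruct (cderiv_bound f z l H) as [d [d0 Hd]].
assert (P := Cmod_ge_0 l).
assert (Q : 0 < eps / (Cmod l + 1)) by (apply Rdiv_lt_0_compat; lra).
exists (Rmin d (eps / (Cmod l + 1))). split; [now apply Rmin_pos|].
intros y Hy. apply Rle_lt_trans with (1 := Hd y (lt_min_l _ _ _ Hy)).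
apply Rlt_le_trans with ((Cmod l + 1) * (eps / (Cmod l + 1))).
- apply Rmult_lt_compat_l; [lra|]. exact (lt_min_r _ _ _ Hy).
- right; field; lra.
Qed.

Lemma cderiv_ext_loc (f g : C -> C) (z l : C) (d : R) :
  0 < d -> (forall y, Cmod (y - z) < d -> f y = g y) -> cderiv f z l -> cderiv g z l.
Proof.
intros d0 E H eps e0. destruct (H eps e0) as [d' [d'0 Hd]].
exists (Rmin d d'); split; [now apply Rmin_pos|]. intros y Hy.
rewrite <- !E.
- apply Hd. exact (lt_min_r _ _ _ Hy).
- rewrite Cmod_sub_diag. exact d0.
- exact (lt_min_l _ _ _ Hy).
Qed.

Lemma cderiv_is_derive (f : C -> C) (z l : C) :
  cderiv f z l <-> is_derive (K := C_AbsRing) (V := C_NormedModule) f z l.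
Proof.
split.
- intros H. split; [apply is_linear_scal_l|].
  intros x Hx. assert (Ex := is_filter_lim_locally_unique (V := AbsRing_NormedModule C_AbsRing) z x Hx); subst x.
  intros eps. destruct (H eps (cond_pos eps)) as [d [d0 Hd]].
  exists (mkposreal d d0). intros y Hy.
  change (Cmod (f y - f z - (y - z) * l)%C <= eps * Cmod (y - z)%C).
  rewrite (Cmult_comm (y - z)). apply Hd. exact Hy.
- intros [_ H] eps e0.
  destruct (H z (fun P HP => HP) (mkposreal eps e0)) as [d Hd].
  exists d; split; [apply cond_pos|]. intros y Hy. specialize (Hd y Hy).
  change (Cmod (f y - f z - (y - z) * l)%C <= eps * Cmod (y - z)%C) in Hd.
  rewrite (Cmult_comm (y - z)) in Hd. exact Hd.
Qed.

(* Coquelicot has two incompatible normed module structures on [C] over itself. *)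
Lemma is_derive_AbsRing (f : C -> C) (z l : C) :
  is_derive (K := C_AbsRing) (V := C_NormedModule) f z l <->
  is_derive (K := C_AbsRing) (V := AbsRing_NormedModule C_AbsRing) f z l.
Proof. split; intros [_ H]; (split; [apply is_linear_scal_l|exact H]). Qed.

Lemma cderiv_const (c z : C) : cderiv (fun _ => c) z 0.
Proof. apply cderiv_is_derive, (is_derive_const (K := C_AbsRing) (V := C_NormedModule) c z). Qed.

Lemma cderiv_id (z : C) : cderiv (fun x => x) z 1.
Proof. apply cderiv_is_derive, is_derive_AbsRing, (is_derive_id (K := C_AbsRing) z). Qed.

Lemma cderiv_comp (f g : C -> C) (z l m : C) :
  cderiv g z m -> cderiv f (g z) l -> cderiv (fun x => f (g x)) z (l * m).
Proof.
rewrite !cderiv_is_derive, (is_derive_AbsRing g), Cmult_comm. intros Hg Hf.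
exact (is_derive_comp (K := C_AbsRing) (V := C_NormedModule) f g z l m Hf Hg).
Qed.

Lemma cderiv_plus (f g : C -> C) (z l m : C) :
  cderiv f z l -> cderiv g z m -> cderiv (fun x => f x + g x)%C z (l + m).
Proof.
rewrite !cderiv_is_derive. exact (is_derive_plus (K := C_AbsRing) (V := C_NormedModule) f g z l m).
Qed.

Lemma cderiv_mult (f g : C -> C) (z l m : C) :
  cderiv f z l -> cderiv g z m -> cderiv (fun x => f x * g x)%C z (l * g z + f z * m).
Proof.
rewrite !cderiv_is_derive, !is_derive_AbsRing. intros Hf Hg.
exact (is_derive_mult (K := C_AbsRing) f g z l m Hf Hg Cmult_comm).
Qed.

Lemma cderiv_scal (f : C -> C) (c z l : C) :
  cderiv f z l -> cderiv (fun x => c * f x)%C z (c * l).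
Proof.
intros H. generalize (cderiv_mult _ _ z _ _ (cderiv_const c z) H). now rewrite Cmult_0_l, Cplus_0_l.
Qed.

Lemma cderiv_sqr (z : C) : cderiv (fun x => x * x)%C z (2 * z).
Proof.
replace (2 * z)%C with (1 * z + z * 1)%C by ring. apply cderiv_mult; apply cderiv_id.
Qed.

(** The remainder is exactly [(y - z)^2 / (z^2 y)]. The radius keeps [|y| > |z| / 2], which makes
    the remainder at most [eps |y - z|]. *)
Lemma cderiv_Cinv (z : C) : z <> 0%C -> cderiv Cinv z (- / (z * z)).
Proof.
intros nz eps e0. assert (P : 0 < Cmod z) by now apply Cmod_gt_0.
exists (Rmin (Cmod z / 2) (eps * (Cmod z * Cmod z * Cmod z / 2))). split.
{ apply Rmin_pos; [lra|]. repeat (apply Rmult_lt_0_compat; try lra). }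
intros y Hy.
assert (y1 : Cmod (y - z) < Cmod z / 2) by exact (lt_min_l _ _ _ Hy).
assert (y2 : Cmod (y - z) < eps * (Cmod z * Cmod z * Cmod z / 2))
  by exact (lt_min_r _ _ _ Hy).
assert (Y : Cmod z / 2 < Cmod y).
{ assert (H := Cmod_sub_le z y). rewrite Cmod_sub_sym in H. lra. }
assert (ny : y <> 0%C) by (apply Cmod_gt_0; lra).
replace (/ y - / z - - / (z * z) * (y - z))%C
  with ((y - z) * (y - z) / (z * z * y))%C by (field; auto).
rewrite Cmod_div, !Cmod_mult by (repeat apply Cmult_neq_0; assumption).
apply Rle_trans with (Cmod (y - z) * (Cmod (y - z) / (Cmod z * Cmod z * Cmod y))).
{ right; field; lra. }
rewrite Rmult_comm. apply Rmult_le_compat_r; [apply Cmod_ge_0|].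
apply Rmult_le_reg_r with (Cmod z * Cmod z * Cmod y).
{ repeat apply Rmult_lt_0_compat; lra. }
unfold Rdiv. rewrite Rmult_assoc, Rinv_l, Rmult_1_r by (repeat apply Rmult_integral_contrapositive_currified; lra).
apply Rle_trans with (1 := Rlt_le _ _ y2). apply Rmult_le_compat_l; [lra|].
assert (0 < Cmod z * Cmod z) by (apply Rmult_lt_0_compat; lra). nra.
Qed.

Lemma cderiv_inv (f : C -> C) (z l : C) :
  f z <> 0%C -> cderiv f z l -> cderiv (fun x => / f x)%C z (- l / (f z * f z)).
Proof.
intros nz Hf. replace (- l / (f z * f z))%C with (- / (f z * f z) * l)%C by (field; auto).
exact (cderiv_comp Cinv f z _ l Hf (cderiv_Cinv _ nz)).
Qed.

Lemma cderiv_div (f g : C -> C) (z l m : C) :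
  g z <> 0%C -> cderiv f z l -> cderiv g z m ->
  cderiv (fun x => f x / g x)%C z ((l * g z - f z * m) / (g z * g z)).
Proof.
intros nz Hf Hg. assert (H := cderiv_mult _ _ z _ _ Hf (cderiv_inv g z m nz Hg)).
replace ((l * g z - f z * m) / (g z * g z))%C
  with (l * / g z + f z * (- m / (g z * g z)))%C by (field; auto).
exact H.
Qed.

(** * Paths in the plane and their real derivatives *)

Lemma norm_C_R (x : C) : norm (V := C_R_NormedModule) x = Cmod x.
Proof.
unfold norm; simpl. unfold prod_norm, Cmod. f_equal.
change (Rabs (fst x) ^ 2 + Rabs (snd x) ^ 2 = fst x ^ 2 + snd x ^ 2).
rewrite <- !Rsqr_pow2, <- !Rsqr_abs. reflexivity.
Qed.

Lemma is_derive_C_R (u : R -> C) (t : R) (l : C) :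
  (forall eps, 0 < eps -> exists d, 0 < d /\ forall s, Rabs (s - t) < d ->
     Cmod (u s - u t - RtoC (s - t) * l) <= eps * Rabs (s - t)) <->
  is_derive (V := C_R_NormedModule) u t l.
Proof.
assert (E : forall s, minus (minus (u s) (u t)) (scal (V := C_R_NormedModule) (minus s t) l)
  = (u s - u t - RtoC (s - t) * l)%C).
{ intros s. unfold minus, plus, opp, scal; simpl. unfold prod_plus, prod_opp, prod_scal, Cminus, Cplus, Copp, Cmult, RtoC; simpl.
  unfold plus, opp, scal; simpl. unfold mult; simpl.
  f_equal; ring. }
split.
- intros H. split; [apply is_linear_scal_l|].
  intros x Hx. assert (Ex := is_filter_lim_locally_unique (V := AbsRing_NormedModule R_AbsRing) t x Hx); subst x.
  intros eps. destruct (H eps (cond_pos eps)) as [d [d0 Hd]].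
  exists (mkposreal d d0). intros s Hs. rewrite norm_C_R.
  eapply Rle_trans; [right; apply f_equal; exact (E s)|]. apply Hd. exact Hs.
- intros [_ H] eps e0.
  destruct (H t (fun P HP => HP) (mkposreal eps e0)) as [d Hd].
  exists d; split; [apply cond_pos|]. intros s Hs. specialize (Hd s Hs).
  rewrite norm_C_R in Hd. rewrite <- E. exact Hd.
Qed.

Definition pcont (u : R -> C) (t : R) : Prop :=
  forall eps, 0 < eps -> exists d, 0 < d /\ forall s, Rabs (s - t) < d -> Cmod (u s - u t) < eps.

Lemma pcont_continuous (u : R -> C) (t : R) :
  pcont u t -> continuous (U := C_R_CompleteNormedModule) u t.
Proof.
intros H. apply (filterlim_locally_ball_norm (U := C_R_NormedModule)).
intros eps. destruct (H eps (cond_pos eps)) as [d [d0 Hd]].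
exists (mkposreal d d0). intros s Hs. unfold ball_norm. rewrite norm_C_R. apply Hd. exact Hs.
Qed.

Lemma is_derive_pcont (u : R -> C) (t : R) (l : C) :
  is_derive (V := C_R_NormedModule) u t l -> pcont u t.
Proof.
intros H. rewrite <- is_derive_C_R in H. intros eps e0.
destruct (H 1) as [d [d0 Hd]]; [lra|].
assert (P := Cmod_ge_0 l).
exists (Rmin d (eps / (Cmod l + 2))). split.
{ apply Rmin_pos; [lra|]. apply Rdiv_lt_0_compat; lra. }
intros s Hs. assert (s1 := lt_min_l _ _ _ Hs).
assert (s2 := lt_min_r _ _ _ Hs). specialize (Hd s s1).
replace (u s - u t)%C with ((u s - u t - RtoC (s - t) * l) + RtoC (s - t) * l)%C by ring.
eapply Rle_lt_trans; [apply Cmod_triangle|]. rewrite Cmod_mult, Cmod_R.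
apply Rlt_le_trans with ((Cmod l + 2) * (eps / (Cmod l + 2))); [|right; field; lra].
assert (0 < eps / (Cmod l + 2)) by (apply Rdiv_lt_0_compat; lra).
assert (0 <= Rabs (s - t)) by apply Rabs_pos. nra.
Qed.

Lemma ccont_pcont (f : C -> C) (u : R -> C) (t : R) :
  pcont u t -> ccont f (u t) -> pcont (fun s => f (u s)) t.
Proof.
intros Hu Hf eps e0. destruct (Hf eps e0) as [d [d0 Hd]].
destruct (Hu d d0) as [d' [d'0 Hd']]. exists d'; split; [exact d'0|].
intros s Hs. apply Hd, Hd', Hs.
Qed.

Lemma is_derive_comp_C_R (f : C -> C) (u : R -> C) (t : R) (l m : C) :
  is_derive (V := C_R_NormedModule) u t m -> cderiv f (u t) l ->
  is_derive (V := C_R_NormedModule) (fun s => f (u s)) t (l * m)%C.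
Proof.
intros Hu Hf. assert (Cu := is_derive_pcont u t m Hu).
rewrite <- is_derive_C_R in Hu |- *. intros eps e0.
assert (Pm := Cmod_ge_0 m). assert (Pl := Cmod_ge_0 l).
destruct (Hf (eps / 2 / (Cmod m + 1))) as [d1 [d10 H1]].
{ apply Rdiv_lt_0_compat; lra. }
destruct (Hu (eps / 2 / (Cmod l + 1))) as [d2 [d20 H2]].
{ apply Rdiv_lt_0_compat; lra. }
destruct (Hu 1) as [d3 [d30 H3]]; [lra|].
destruct (Cu d1 d10) as [d4 [d40 H4]].
exists (Rmin (Rmin d2 d3) d4).
split; [repeat apply Rmin_pos; assumption|]. intros s Hs.
assert (y2 : Rabs (s - t) < d2).
{ eapply Rlt_le_trans; [exact Hs|]. eapply Rle_trans; [apply Rmin_l|apply Rmin_l]. }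
assert (y3 : Rabs (s - t) < d3).
{ eapply Rlt_le_trans; [exact Hs|]. eapply Rle_trans; [apply Rmin_l|apply Rmin_r]. }
assert (y4 : Rabs (s - t) < d4).
{ eapply Rlt_le_trans; [exact Hs|]. apply Rmin_r. }
specialize (H1 (u s) (H4 s y4)). specialize (H2 s y2). specialize (H3 s y3).
replace (f (u s) - f (u t) - RtoC (s - t) * (l * m))%C
  with ((f (u s) - f (u t) - l * (u s - u t)) + l * (u s - u t - RtoC (s - t) * m))%C by ring.
eapply Rle_trans; [apply Cmod_triangle|]. rewrite Cmod_mult.
assert (H3' : Cmod (u s - u t) <= (Cmod m + 1) * Rabs (s - t)).
{ replace (u s - u t)%C with ((u s - u t - RtoC (s - t) * m) + RtoC (s - t) * m)%C by ring.
  eapply Rle_trans; [apply Cmod_triangle|]. rewrite Cmod_mult, Cmod_R. lra. }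
set (N := Rabs (s - t)) in *. assert (N0 : 0 <= N) by apply Rabs_pos.
assert (A1 : eps / 2 / (Cmod m + 1) * Cmod (u s - u t) <= eps / 2 * N).
{ apply Rle_trans with (eps / 2 / (Cmod m + 1) * ((Cmod m + 1) * N)).
  - apply Rmult_le_compat_l; [|exact H3']. apply Rlt_le, Rdiv_lt_0_compat; lra.
  - right; field; lra. }
assert (A2 : Cmod l * Cmod (u s - u t - RtoC (s - t) * m) <= eps / 2 * N).
{ apply Rle_trans with ((Cmod l + 1) * (eps / 2 / (Cmod l + 1) * N)).
  - apply Rmult_le_compat; [lra|apply Cmod_ge_0|lra|exact H2].
  - right; field; lra. }
lra.
Qed.

Lemma is_derive_affine_path (a b : C) (t : R) :
  is_derive (V := C_R_NormedModule) (fun s => a + RtoC s * b)%C t b.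
Proof.
apply is_derive_C_R. intros eps e0. exists 1; split; [lra|]. intros s _.
replace (a + RtoC s * b - (a + RtoC t * b) - RtoC (s - t) * b)%C with (RtoC 0).
- rewrite Cmod_0. apply Rmult_le_pos; [lra|apply Rabs_pos].
- rewrite RtoC_minus. ring.
Qed.

(** * Integrals along segments *)

Lemma half_pow_pos (n : nat) : 0 < (/ 2) ^ n.
Proof. apply pow_lt; lra. Qed.

Lemma half_pow_small (K eps : R) : 0 < eps -> exists n, K * (/ 2) ^ n < eps.
Proof.
intros e0. assert (0 <= Rabs K) by apply Rabs_pos.
destruct (pow_lt_1_zero (/ 2)) with (y := eps / (Rabs K + 1)) as [N HN].
- rewrite Rabs_pos_eq; lra.
- apply Rdiv_lt_0_compat; lra.
- exists N. specialize (HN N (le_n N)). assert (P := half_pow_pos N).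
  rewrite Rabs_pos_eq in HN by lra.
  apply Rle_lt_trans with (Rabs K * (/ 2) ^ N).
  + apply Rmult_le_compat_r; [lra|apply Rle_abs].
  + apply Rlt_le_trans with ((Rabs K + 1) * (eps / (Rabs K + 1))); [|right; field; lra].
    assert (0 < eps / (Rabs K + 1)) by (apply Rdiv_lt_0_compat; lra). nra.
Qed.

Lemma geometric_tail (u : nat -> R) (K : R) :
  (forall n, Rabs (u (S n) - u n) <= K * (/ 2) ^ n) ->
  forall n k, Rabs (u (n + k)%nat - u n) <= 2 * K * (/ 2) ^ n * (1 - (/ 2) ^ k).
Proof.
intros H n k. induction k as [|k IH].
- rewrite Nat.add_0_r, Rminus_diag, Rabs_R0. simpl. lra.
- rewrite Nat.add_succ_r.
  replace (u (S (n + k)) - u n) with ((u (S (n + k)) - u (n + k)%nat) + (u (n + k)%nat - u n)) by ring.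
  eapply Rle_trans; [apply Rabs_triang|]. specialize (H (n + k)%nat).
  rewrite pow_add in H. simpl. lra.
Qed.

Lemma geometric_limit_R (u : nat -> R) (K : R) :
  (forall n, Rabs (u (S n) - u n) <= K * (/ 2) ^ n) ->
  exists l, forall n, Rabs (u n - l) <= 2 * K * (/ 2) ^ n.
Proof.
intros H. assert (T := geometric_tail u K H).
assert (K0 : 0 <= K).
{ specialize (H 0%nat). simpl in H. assert (A := Rabs_pos (u 1%nat - u 0%nat)). lra. }
assert (T' : forall n k, Rabs (u (n + k)%nat - u n) <= 2 * K * (/ 2) ^ n).
{ intros n k. eapply Rle_trans; [apply T|]. assert (P := half_pow_pos n). assert (Q := half_pow_pos k).
  assert (0 <= 2 * K * (/ 2) ^ n) by (apply Rmult_le_pos; lra). nra. }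
destruct (Rcomplete.R_complete u) as [l Hl].
- intros eps e0. destruct (half_pow_small (4 * K) eps e0) as [N HN].
  exists N. intros n m Hn Hm.
  replace n with (N + (n - N))%nat by lia. replace m with (N + (m - N))%nat by lia.
  unfold Rdist. replace (u (N + (n - N))%nat - u (N + (m - N))%nat)
    with ((u (N + (n - N))%nat - u N) - (u (N + (m - N))%nat - u N)) by ring.
  eapply Rle_lt_trans; [apply Rabs_triang|]. rewrite Rabs_Ropp.
  generalize (T' N (n - N)%nat) (T' N (m - N)%nat). lra.
- exists l. intros n. apply le_epsilon. intros eps e0.
  destruct (Hl eps e0) as [N HN]. specialize (HN (n + N)%nat ltac:(lia)). unfold Rdist in HN.
  replace (u n - l) with ((u (n + N)%nat - l) - (u (n + N)%nat - u n)) by ring.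
  eapply Rle_trans; [apply Rabs_triang|]. rewrite Rabs_Ropp.
  generalize (T' n N). lra.
Qed.

Lemma Cmod_le_re_im (z : C) : Cmod z <= Rabs (fst z) + Rabs (snd z).
Proof.
replace z with (RtoC (fst z) + Ci * RtoC (snd z))%C at 1
  by (destruct z; unfold RtoC, Ci, Cmult, Cplus; simpl; f_equal; ring).
eapply Rle_trans; [apply Cmod_triangle|].
rewrite Cmod_mult, Cmod_Ci, !Cmod_R. lra.
Qed.

(** Needed for the vertices of the nested triangles in [goursat] and for the iteration in
    [local_inverse]. The constant grows from [2 K] to [4 K] because real and imaginary parts
    converge separately. *)
Lemma geometric_limit (u : nat -> C) (K : R) :
  (forall n, Cmod (u (S n) - u n) <= K * (/ 2) ^ n) ->
  exists l, forall n, Cmod (u n - l) <= 4 * K * (/ 2) ^ n.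
Proof.
intros H.
destruct (geometric_limit_R (fun n => fst (u n)) K) as [x Hx].
{ intros n. eapply Rle_trans; [|apply H].
  apply (Rle_trans _ _ _ (re_le_Cmod (u (S n) - u n))). lra. }
destruct (geometric_limit_R (fun n => snd (u n)) K) as [y Hy].
{ intros n. eapply Rle_trans; [|apply H].
  eapply Rle_trans; [|apply Rmax_Cmod]. apply Rmax_r. }
exists (x, y). intros n. eapply Rle_trans; [apply Cmod_le_re_im|].
specialize (Hx n). specialize (Hy n). simpl. unfold Rminus in Hx, Hy. lra.
Qed.

Notation RIntC := (RInt (V := C_R_CompleteNormedModule)).
Notation is_RIntC := (is_RInt (V := C_R_NormedModule)).
Notation ex_RIntC := (ex_RInt (V := C_R_CompleteNormedModule)).

Lemma RIntC_bound (u : R -> C) (a b M : R) :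
  a <= b -> (forall t, a <= t <= b -> Cmod (u t) <= M) -> ex_RIntC u a b ->
  Cmod (RIntC u a b) <= (b - a) * M.
Proof.
intros ab H Hex. rewrite <- norm_C_R.
apply (norm_RInt_le_const (V := C_R_NormedModule) u a b); [exact ab| |].
- intros t Ht. rewrite norm_C_R. now apply H.
- apply (RInt_correct (V := C_R_CompleteNormedModule)). exact Hex.
Qed.

Lemma ex_RIntC_pcont (u : R -> C) (a b : R) :
  a <= b -> (forall t, a <= t <= b -> pcont u t) -> ex_RIntC u a b.
Proof.
intros ab H. apply ex_RInt_continuous. rewrite Rmin_left, Rmax_right by exact ab.
intros t Ht. apply pcont_continuous. now apply H.
Qed.

Lemma is_RIntC_scal (u : R -> C) (a b : R) (c l : C) :
  is_RIntC u a b l -> is_RIntC (fun t => c * u t)%C a b (c * l)%C.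
Proof.
intros H. assert (H1 := is_RInt_fct_extend_fst _ _ _ _ H).
assert (H2 := is_RInt_fct_extend_snd _ _ _ _ H).
apply is_RInt_fct_extend_pair.
- eapply is_RInt_ext; [|apply (is_RInt_minus _ _ a b _ _ (is_RInt_scal _ _ _ (fst c) _ H1) (is_RInt_scal _ _ _ (snd c) _ H2))].
  intros t _. reflexivity.
- eapply is_RInt_ext; [|apply (is_RInt_plus _ _ a b _ _ (is_RInt_scal _ _ _ (fst c) _ H2) (is_RInt_scal _ _ _ (snd c) _ H1))].
  intros t _. reflexivity.
Qed.

Lemma RIntC_scal (u : R -> C) (a b : R) (c : C) :
  ex_RIntC u a b -> RIntC (fun t => c * u t)%C a b = (c * RIntC u a b)%C.
Proof.
intros H. apply (is_RInt_unique (V := C_R_CompleteNormedModule)).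
apply is_RIntC_scal. apply (RInt_correct (V := C_R_CompleteNormedModule)). exact H.
Qed.

Definition seg (a b : C) (t : R) : C := (a + RtoC t * (b - a))%C.

Definition seg_int (f : C -> C) (a b : C) : C :=
  RIntC (fun t => f (seg a b t) * (b - a))%C 0 1.

Lemma seg_convex (o a b : C) (r t : R) :
  Cmod (a - o) <= r -> Cmod (b - o) <= r -> 0 <= t <= 1 -> Cmod (seg a b t - o) <= r.
Proof.
intros Ha Hb Ht. unfold seg.
replace (a + RtoC t * (b - a) - o)%C with (RtoC (1 - t) * (a - o) + RtoC t * (b - o))%C
  by (rewrite RtoC_minus; ring).
eapply Rle_trans; [apply Cmod_triangle|]. rewrite !Cmod_mult, !Cmod_R, !Rabs_pos_eq by lra. nra.
Qed.

Lemma seg_pcont (a b : C) (t : R) : pcont (seg a b) t.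
Proof. apply is_derive_pcont with (b - a)%C. apply is_derive_affine_path. Qed.

Definition seg_cont (f : C -> C) (a b : C) : Prop :=
  forall t, 0 <= t <= 1 -> ccont f (seg a b t).

Lemma ccont_scal_r (f : C -> C) (c z : C) : ccont f z -> ccont (fun x => f x * c)%C z.
Proof.
intros H eps e0. assert (P := Cmod_ge_0 c).
destruct (H (eps / (Cmod c + 1))) as [d [d0 Hd]]; [apply Rdiv_lt_0_compat; lra|].
exists d; split; [exact d0|]. intros y Hy. specialize (Hd y Hy).
replace (f y * c - f z * c)%C with ((f y - f z) * c)%C by ring. rewrite Cmod_mult.
apply Rle_lt_trans with (Cmod (f y - f z) * (Cmod c + 1)).
- apply Rmult_le_compat_l; [apply Cmod_ge_0|lra].
- apply Rlt_le_trans with (eps / (Cmod c + 1) * (Cmod c + 1)); [|right; field; lra].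
  apply Rmult_lt_compat_r; lra.
Qed.

Lemma seg_integrable (f : C -> C) (a b : C) :
  seg_cont f a b -> ex_RIntC (fun t => f (seg a b t) * (b - a))%C 0 1.
Proof.
intros H. apply ex_RIntC_pcont; [lra|]. intros t Ht.
apply (ccont_pcont (fun z => f z * (b - a))%C (seg a b)); [apply seg_pcont|].
apply ccont_scal_r. now apply H.
Qed.

Lemma seg_int_bound (f : C -> C) (a b : C) (M : R) :
  seg_cont f a b -> (forall t, 0 <= t <= 1 -> Cmod (f (seg a b t)) <= M) ->
  Cmod (seg_int f a b) <= M * Cmod (b - a).
Proof.
intros Hc H. eapply Rle_trans.
- apply RIntC_bound; [lra| |now apply seg_integrable].
  intros t Ht. rewrite Cmod_mult. apply Rmult_le_compat_r; [apply Cmod_ge_0|]. now apply H.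
- lra.
Qed.

Lemma seg_int_rev (f : C -> C) (a b : C) :
  seg_cont f a b -> seg_int f b a = (- seg_int f a b)%C.
Proof.
intros H. unfold seg_int.
assert (E := seg_integrable f a b H).
assert (L := RInt_comp_lin (V := C_R_CompleteNormedModule)
  (fun t => f (seg a b t) * (b - a))%C (-1) 1 0 1).
replace (-1 * 0 + 1) with 1 in L by ring. replace (-1 * 1 + 1) with 0 in L by ring.
specialize (L (ex_RInt_swap _ _ _ E)).
apply (fun H => eq_trans H (eq_sym (opp_RInt_swap (V := C_R_CompleteNormedModule) _ 0 1 E))) in L.
transitivity (opp (RIntC (fun t => f (seg a b t) * (b - a))%C 0 1)); [|reflexivity].
rewrite <- L. apply (RInt_ext (V := C_R_CompleteNormedModule)). intros t _.
change (scal (-1) (f (seg a b (-1 * t + 1)) * (b - a))%C)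
  with (scal (V := C_R_NormedModule) (-1) (f (seg a b (-1 * t + 1)) * (b - a))%C).
replace (seg a b (-1 * t + 1)) with (seg b a t)
  by (unfold seg; rewrite RtoC_plus, RtoC_mult; ring).
generalize (f (seg b a t)). intros w. unfold scal; simpl. unfold prod_scal, scal; simpl.
unfold mult, Cmult, Cminus, Cplus, Copp; simpl. f_equal; ring.
Qed.

Lemma seg_int_mid (f : C -> C) (a b : C) :
  seg_cont f a b ->
  seg_int f a b = (seg_int f a ((a + b) / 2) + seg_int f ((a + b) / 2) b)%C.
Proof.
intros H. unfold seg_int. set (F := (fun t => f (seg a b t) * (b - a))%C).
assert (E := seg_integrable f a b H). fold F in E.
assert (E1 : ex_RIntC F 0 (1/2)).
{ apply (ex_RInt_Chasles_1 (V := C_R_CompleteNormedModule) F 0 (1/2) 1); [lra|exact E]. }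
assert (E2 : ex_RIntC F (1/2) 1).
{ apply (ex_RInt_Chasles_2 (V := C_R_CompleteNormedModule) F 0 (1/2) 1); [lra|exact E]. }
rewrite <- (RInt_Chasles (V := C_R_CompleteNormedModule) F 0 (1/2) 1 E1 E2).
change (plus (RIntC F 0 (1 / 2)) (RIntC F (1 / 2) 1)) with (RIntC F 0 (1 / 2) + RIntC F (1 / 2) 1)%C.
assert (L1 := RInt_comp_lin (V := C_R_CompleteNormedModule) F (/ 2) 0 0 1).
replace (/ 2 * 0 + 0) with 0 in L1 by ring. replace (/ 2 * 1 + 0) with (1 / 2) in L1 by field.
assert (L2 := RInt_comp_lin (V := C_R_CompleteNormedModule) F (/ 2) (1 / 2) 0 1).
replace (/ 2 * 0 + 1 / 2) with (1 / 2) in L2 by ring. replace (/ 2 * 1 + 1 / 2) with 1 in L2 by field.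
rewrite <- (L1 E1), <- (L2 E2).
assert (R2 : forall w : C, scal (V := C_R_NormedModule) (/ 2) w = (w / 2)%C).
{ intros w. unfold scal; simpl. unfold prod_scal, scal; simpl. unfold mult, Cdiv, Cinv, Cmult, RtoC; simpl.
  apply injective_projections; simpl; field. }
f_equal; apply (RInt_ext (V := C_R_CompleteNormedModule)); intros t _.
- change (scal (V := C_R_NormedModule) (/ 2) (F (/ 2 * t + 0)) = (f (seg a ((a + b) / 2) t) * ((a + b) / 2 - a))%C).
  rewrite R2. unfold F. Ceq.
  replace (seg a b (/ 2 * t + 0)) with (seg a ((a + b) / 2) t); [field|].
  unfold seg. rewrite Rplus_0_r, RtoC_mult, RtoC_inv by lra. field.
- change (scal (V := C_R_NormedModule) (/ 2) (F (/ 2 * t + 1 / 2)) = (f (seg ((a + b) / 2) b t) * (b - (a + b) / 2))%C).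
  rewrite R2. unfold F. Ceq.
  replace (seg a b (/ 2 * t + 1 / 2)) with (seg ((a + b) / 2) b t); [field|].
  unfold seg. rewrite RtoC_plus, RtoC_mult, RtoC_div, RtoC_inv by lra. field.
Qed.

(** * Goursat's theorem and primitives *)

Lemma RIntC_derive (G g : R -> C) (a b : R) :
  a <= b ->
  (forall t, a <= t <= b -> is_derive (V := C_R_NormedModule) G t (g t)) ->
  (forall t, a <= t <= b -> pcont g t) ->
  RIntC g a b = (G b - G a)%C.
Proof.
intros ab HG Hg. apply (is_RInt_unique (V := C_R_CompleteNormedModule)).
apply (is_RInt_derive (V := C_R_CompleteNormedModule) G g a b);
  rewrite Rmin_left, Rmax_right by exact ab; intros t Ht.
- now apply HG.
- apply pcont_continuous. now apply Hg.
Qed.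

Lemma seg_int_derive (G g : C -> C) (a b : C) :
  (forall t, 0 <= t <= 1 -> cderiv G (seg a b t) (g (seg a b t))) ->
  seg_cont g a b -> seg_int g a b = (G b - G a)%C.
Proof.
intros HG Hg. unfold seg_int.
rewrite (RIntC_derive (fun t => G (seg a b t))); [ |lra| |].
- f_equal; [|f_equal]; f_equal; unfold seg; ring.
- intros t Ht. apply is_derive_comp_C_R; [apply is_derive_affine_path|now apply HG].
- intros t Ht. apply (ccont_pcont (fun z => g z * (b - a))%C (seg a b)); [apply seg_pcont|].
  apply ccont_scal_r. now apply Hg.
Qed.

Lemma seg_int_minus (f g : C -> C) (a b : C) :
  seg_cont f a b -> seg_cont g a b ->
  seg_int (fun z => f z - g z)%C a b = (seg_int f a b - seg_int g a b)%C.
Proof.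
intros Hf Hg. unfold seg_int.
assert (E := RInt_minus (V := C_R_CompleteNormedModule) _ _ 0 1
  (seg_integrable f a b Hf) (seg_integrable g a b Hg)).
etransitivity; [|exact E]. apply (RInt_ext (V := C_R_CompleteNormedModule)).
intros t _. match goal with |- _ = minus ?x ?y => change (minus x y) with (x - y)%C end.
Ceq. ring.
Qed.

Definition tri_int (f : C -> C) (a b c : C) : C :=
  (seg_int f a b + seg_int f b c + seg_int f c a)%C.

Definition perim (a b c : C) : R := Cmod (b - a) + Cmod (c - b) + Cmod (a - c).

(** Each side is cut at its midpoint; the three inner sides are run through once in each direction
    and cancel. *)
Lemma tri_int_split (f : C -> C) (a b c : C) :
  (forall x y, (x = a \/ x = b \/ x = c \/ x = (a + b) / 2 \/ x = (b + c) / 2 \/ x = (c + a) / 2)%C ->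
   (y = a \/ y = b \/ y = c \/ y = (a + b) / 2 \/ y = (b + c) / 2 \/ y = (c + a) / 2)%C -> seg_cont f x y) ->
  tri_int f a b c =
  (tri_int f a ((a + b) / 2) ((c + a) / 2) + tri_int f ((a + b) / 2) b ((b + c) / 2)
   + tri_int f ((c + a) / 2) ((b + c) / 2) c
   + tri_int f ((a + b) / 2) ((b + c) / 2) ((c + a) / 2))%C.
Proof.
intros H. unfold tri_int.
rewrite (seg_int_mid f a b), (seg_int_mid f b c), (seg_int_mid f c a) by (apply H; tauto).
rewrite (seg_int_rev f ((a + b) / 2) ((c + a) / 2)) by (apply H; tauto).
rewrite (seg_int_rev f ((a + b) / 2) ((b + c) / 2)) by (apply H; tauto).
rewrite (seg_int_rev f ((b + c) / 2) ((c + a) / 2)) by (apply H; tauto).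
ring.
Qed.

Definition tri := (C * C * C)%type.

(** The aim is a quarter triangle that carries at least a quarter of the integral in modulus. The
    last branch meets it too, because the four integrals add up to the whole one. *)
Definition tri_step (f : C -> C) (t : tri) : tri :=
  let '(a, b, c) := t in
  let p := ((a + b) / 2)%C in let q := ((b + c) / 2)%C in let r := ((c + a) / 2)%C in
  let M := Cmod (tri_int f a b c) / 4 in
  if Rle_dec M (Cmod (tri_int f a p r)) then (a, p, r)
  else if Rle_dec M (Cmod (tri_int f p b q)) then (p, b, q)
  else if Rle_dec M (Cmod (tri_int f r q c)) then (r, q, c)
  else (p, q, r).

Definition tri_in (o : C) (r : R) (t : tri) : Prop :=
  let '(a, b, c) := t in Cmod (a - o) <= r /\ Cmod (b - o) <= r /\ Cmod (c - o) <= r.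

Lemma mid_in (o a b : C) (r : R) :
  Cmod (a - o) <= r -> Cmod (b - o) <= r -> Cmod ((a + b) / 2 - o) <= r.
Proof.
intros Ha Hb. replace ((a + b) / 2)%C with (seg a b (/ 2)).
- apply seg_convex; [assumption..|lra].
- unfold seg. rewrite RtoC_inv by lra. field.
Qed.

Definition tri_perim (t : tri) : R := let '(a, b, c) := t in perim a b c.
Definition tri_fst (t : tri) : C := fst (fst t).
Definition tri_val (f : C -> C) (t : tri) : C := let '(a, b, c) := t in tri_int f a b c.

Lemma Cmod_half (x : C) : Cmod (x / 2) = / 2 * Cmod x.
Proof.
rewrite Cmod_div, Cmod_R, Rabs_pos_eq; try lra.
intros E; apply RtoC_inj in E; lra.
Qed.

Lemma perim_half (a b c : C) :
  perim a ((a + b) / 2) ((c + a) / 2) = / 2 * perim a b c /\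
  perim ((a + b) / 2) b ((b + c) / 2) = / 2 * perim a b c /\
  perim ((c + a) / 2) ((b + c) / 2) c = / 2 * perim a b c /\
  perim ((a + b) / 2) ((b + c) / 2) ((c + a) / 2) = / 2 * perim a b c.
Proof.
unfold perim.
assert (E : forall x y z w, (x - y = (z - w) / 2)%C -> Cmod (x - y) = / 2 * Cmod (z - w)).
{ intros x y z w H. rewrite H. apply Cmod_half. }
repeat split;
 rewrite ?(E a ((c + a) / 2)%C a c), ?(E ((a + b) / 2)%C a b a),
  ?(E ((c + a) / 2)%C ((a + b) / 2)%C c b), ?(E b ((a + b) / 2)%C b a),
  ?(E ((b + c) / 2)%C b c b), ?(E ((a + b) / 2)%C ((b + c) / 2)%C a c),
  ?(E ((b + c) / 2)%C ((c + a) / 2)%C b a), ?(E c ((b + c) / 2)%C c b),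
  ?(E ((c + a) / 2)%C c a c), ?(E ((b + c) / 2)%C ((a + b) / 2)%C c a),
  ?(E ((c + a) / 2)%C ((b + c) / 2)%C a b), ?(E ((a + b) / 2)%C ((c + a) / 2)%C b c) by field;
 rewrite ?(Cmod_sub_sym b c), ?(Cmod_sub_sym a b), ?(Cmod_sub_sym c a); lra.
Qed.

(** The last clause limits the drift of the first vertex; with the halved perimeter it makes the
    first vertices converge geometrically. *)
Lemma tri_step_spec (f : C -> C) (o : C) (r : R) (t : tri) :
  (forall z, Cmod (z - o) <= r -> ccont f z) -> tri_in o r t ->
  tri_in o r (tri_step f t) /\ tri_perim (tri_step f t) = / 2 * tri_perim t /\
  Cmod (tri_val f t) <= 4 * Cmod (tri_val f (tri_step f t)) /\
  Cmod (tri_fst (tri_step f t) - tri_fst t) <= tri_perim t.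
Proof.
intros Hc. destruct t as [[a b] c]. intros [Ha [Hb Hcc]].
assert (Hp := mid_in o a b r Ha Hb). assert (Hq := mid_in o b c r Hb Hcc).
assert (Hr := mid_in o c a r Hcc Ha).
assert (Pa := Cmod_ge_0 (b - a)). assert (Pb := Cmod_ge_0 (c - b)). assert (Pc := Cmod_ge_0 (a - c)).
assert (S := tri_int_split f a b c). destruct (perim_half a b c) as [E1 [E2 [E3 E4]]].
assert (D1 : Cmod ((a + b) / 2 - a) <= perim a b c).
{ replace ((a + b) / 2 - a)%C with ((b - a) / 2)%C by field. rewrite Cmod_half. unfold perim; lra. }
assert (D2 : Cmod ((c + a) / 2 - a) <= perim a b c).
{ replace ((c + a) / 2 - a)%C with ((c - a) / 2)%C by field. rewrite Cmod_half, Cmod_sub_sym. unfold perim; lra. }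
assert (D0 : Cmod (a - a) <= perim a b c).
{ rewrite Cmod_sub_diag. unfold perim; lra. }
assert (S' : Cmod (tri_int f a b c) <= Cmod (tri_int f a ((a + b) / 2) ((c + a) / 2))
  + Cmod (tri_int f ((a + b) / 2) b ((b + c) / 2)) + Cmod (tri_int f ((c + a) / 2) ((b + c) / 2) c)
  + Cmod (tri_int f ((a + b) / 2) ((b + c) / 2) ((c + a) / 2))).
{ rewrite S.
  - eapply Rle_trans; [apply Cmod_triangle|]. apply Rplus_le_compat_r.
    eapply Rle_trans; [apply Cmod_triangle|]. apply Rplus_le_compat_r. apply Cmod_triangle.
  - intros x y Hx Hy u Hu. apply Hc. apply seg_convex; [| |exact Hu].
    + decompose [or] Hx; subst x; assumption.
    + decompose [or] Hy; subst y; assumption. }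
unfold tri_step, tri_perim, tri_val, tri_fst, tri_in.
repeat match goal with |- context [Rle_dec ?x ?y] => destruct (Rle_dec x y) end; simpl fst;
repeat split; first [assumption | lra].
Qed.

Lemma affine_seg_int (al be a b : C) :
  seg_int (fun z => al + be * z)%C a b = (al * (b - a) + be / 2 * (b * b - a * a))%C.
Proof.
rewrite (seg_int_derive (fun z => al * z + be / 2 * (z * z))%C).
- ring.
- intros t _. set (z := seg a b t).
  replace (al + be * z)%C with (al * 1 + be / 2 * (2 * z))%C by field.
  apply cderiv_plus; apply cderiv_scal; [apply cderiv_id|apply cderiv_sqr].
- intros t _. apply cderiv_ccont with (0 + be * 1)%C.
  apply cderiv_plus; [apply cderiv_const|]. apply cderiv_scal, cderiv_id.
Qed.

Lemma tri_in_seg (o a b c : C) (r : R) :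
  tri_in o r (a, b, c) ->
  forall f, (forall z, Cmod (z - o) <= r -> ccont f z) ->
  seg_cont f a b /\ seg_cont f b c /\ seg_cont f c a.
Proof.
intros [Ha [Hb Hc]] f H. repeat split; intros t Ht; apply H; apply seg_convex; assumption.
Qed.

(** The nested triangles shrink to a point [p], near which [f] is affine up to a small multiple of
    the distance. Affine functions integrate to zero around a triangle, so the integral at depth [n]
    is at most a small multiple of the squared perimeter, hence of [4^(-n)]; but it is at least
    [4^(-n)] times the original one. *)
Theorem goursat (f df : C -> C) (o a b c : C) (r : R) :
  (forall z, Cmod (z - o) <= r -> cderiv f z (df z)) -> tri_in o r (a, b, c) ->
  tri_int f a b c = 0%C.
Proof.
intros Hd Hin. pose (K := perim a b c).
assert (Hc : forall z, Cmod (z - o) <= r -> ccont f z).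
{ intros z Hz. eapply cderiv_ccont. now apply Hd. }
pose (T := fix T n := match n with O => (a, b, c) | S n => tri_step f (T n) end).
assert (I : forall n, tri_in o r (T n)).
{ induction n as [|n IH]; [exact Hin|]. apply (tri_step_spec f o r (T n) Hc IH). }
assert (P : forall n, tri_perim (T n) = K * (/ 2) ^ n).
{ induction n as [|n IH]; [unfold K; simpl; ring|].
  simpl T. rewrite (proj1 (proj2 (tri_step_spec f o r (T n) Hc (I n)))), IH. simpl. ring. }
assert (V : forall n, Cmod (tri_int f a b c) * ((/ 2) ^ n * (/ 2) ^ n) <= Cmod (tri_val f (T n))).
{ induction n as [|n IH]; [simpl; lra|].
  assert (Q := proj1 (proj2 (proj2 (tri_step_spec f o r (T n) Hc (I n))))). simpl T. simpl pow. lra. }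
destruct (geometric_limit (fun n => tri_fst (T n)) K) as [p Hp].
{ intros n. rewrite <- P. apply (tri_step_spec f o r (T n) Hc (I n)). }
assert (K0 : 0 <= K).
{ unfold K, perim. generalize (Cmod_ge_0 (b - a)) (Cmod_ge_0 (c - b)) (Cmod_ge_0 (a - c)). lra. }
assert (Hpr : Cmod (p - o) <= r).
{ apply le_epsilon. intros eps e0. destruct (half_pow_small (4 * K) eps e0) as [n Hn].
  specialize (Hp n). assert (In := I n). unfold tri_fst in Hp. destruct (T n) as [[x y] z].
  destruct In as [In _]. simpl in Hp. assert (Q := Cmod_tri3 p x o). rewrite Cmod_sub_sym in Hp. lra. }
assert (Z : Cmod (tri_int f a b c) <= 0).
{ apply le_epsilon. intros eps e0.
  (* With [h = (/ 2) ^ n], the first vertex is within [4 K h] of [p] and the perimeter is [K h], so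
     the triangle lies within [5 K h] of [p]. Deviation times length then gives at most
     [5 K h * (K h)] times this constant. *)
  destruct (Hd p Hpr (eps / (5 * K * K + 1))) as [d [d0 Hdd]].
  { apply Rdiv_lt_0_compat; nra. }
  destruct (half_pow_small (5 * K) d d0) as [n Hn].
  specialize (Hp n). specialize (P n). specialize (I n). specialize (V n).
  set (h := (/ 2) ^ n) in *. assert (h0 : 0 < h) by apply half_pow_pos.
  destruct (T n) as [[x y] z]. unfold tri_fst in Hp; simpl in Hp, P, V.
  set (e := eps / (5 * K * K + 1)) in *.
  assert (e'0 : 0 < e) by (apply Rdiv_lt_0_compat; nra).
  set (l := df p) in *.
  set (g := fun w => (f p - l * p + l * w)%C).
  assert (N1 := Cmod_ge_0 (y - x)). assert (N2 := Cmod_ge_0 (z - y)). assert (N3 := Cmod_ge_0 (x - z)).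
  assert (Bd : forall w, Cmod (w - p) <= 5 * K * h -> Cmod (f w - g w) <= e * (5 * K * h)).
  { intros w Hw. replace (f w - g w)%C with (f w - f p - l * (w - p))%C by (unfold g; ring).
    eapply Rle_trans; [apply Hdd; lra|]. apply Rmult_le_compat_l; lra. }
  unfold perim in P.
  assert (Hx : Cmod (x - p) <= 5 * K * h) by nra.
  assert (Hy : Cmod (y - p) <= 5 * K * h).
  { eapply Rle_trans; [apply (Cmod_tri3 y x p)|]. nra. }
  assert (Hz : Cmod (z - p) <= 5 * K * h).
  { eapply Rle_trans; [apply (Cmod_tri3 z x p)|]. rewrite (Cmod_sub_sym z x). nra. }
  assert (Cg : forall w, ccont g w).
  { intros w. apply cderiv_ccont with (0 + l * 1)%C.
    apply cderiv_plus; [apply cderiv_const|]. apply cderiv_scal, cderiv_id. }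
  destruct (tri_in_seg o x y z r I f Hc) as [S1 [S2 S3]].
  assert (Cfg : forall u v, seg_cont f u v -> seg_cont (fun w => f w - g w)%C u v).
  { intros u v Huv t Ht eps' e'. destruct (Huv t Ht (eps' / 2)) as [d1 [d10 D1]]; [lra|].
    destruct (Cg (seg u v t) (eps' / 2)) as [d2 [d20 D2]]; [lra|].
    exists (Rmin d1 d2); split; [now apply Rmin_pos|]. intros w Hw.
    specialize (D1 w (lt_min_l _ _ _ Hw)).
    specialize (D2 w (lt_min_r _ _ _ Hw)).
    replace (f w - g w - (f (seg u v t) - g (seg u v t)))%C
      with ((f w - f (seg u v t)) - (g w - g (seg u v t)))%C by ring.
    eapply Rle_lt_trans; [apply Cmod_le_sub|]. lra. }
  assert (E : tri_int f x y z = tri_int (fun w => f w - g w)%C x y z).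
  { unfold tri_int. rewrite !seg_int_minus by (try assumption; intros t _; apply Cg).
    unfold g. rewrite !affine_seg_int. field. }
  assert (B1 : forall u v, Cmod (u - p) <= 5 * K * h -> Cmod (v - p) <= 5 * K * h -> seg_cont f u v ->
    Cmod (seg_int (fun w => f w - g w)%C u v) <= e * (5 * K * h) * Cmod (v - u)).
  { intros u v Hu Hv Huv. apply seg_int_bound; [now apply Cfg|].
    intros t Ht. apply Bd. apply seg_convex; assumption. }
  assert (Q : Cmod (tri_int f x y z) <= e * (5 * K * h) * (K * h)).
  { rewrite E, <- P. unfold tri_int.
    eapply Rle_trans; [apply Cmod_triangle|].
    eapply Rle_trans; [apply Rplus_le_compat_r, Cmod_triangle|].
    rewrite !Rmult_plus_distr_l. repeat apply Rplus_le_compat; apply B1; assumption. }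
  apply Rmult_le_reg_r with (h * h); [nra|].
  apply Rle_trans with (1 := V). apply Rle_trans with (1 := Q).
  apply Rle_trans with (e * (5 * K * K + 1) * (h * h)).
  - assert (0 <= e * (h * h)) by (apply Rmult_le_pos; nra). nra.
  - right. unfold e. field. nra. }
apply Cmod_eq_0. generalize (Cmod_ge_0 (tri_int f a b c)). lra.
Qed.

(** Goursat on the triangle [o], [z], [y] turns the increment of the primitive into the integral
    over the segment from [z] to [y]; after subtraction of the constant [f z] only continuity of [f]
    is left to use. *)
Lemma holo_primitive (f df : C -> C) (o : C) (R0 : R) :
  (forall z, disk o R0 z -> cderiv f z (df z)) ->
  forall z, disk o R0 z -> cderiv (seg_int f o) z (f z).
Proof.
intros Hd z Hz eps e0.
assert (P := Cmod_ge_0 (z - o)). unfold disk in Hz.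
destruct (cderiv_ccont f z _ (Hd z Hz) eps e0) as [d [d0 Hc]].
exists (Rmin d ((R0 - Cmod (z - o)) / 2)). split; [apply Rmin_pos; lra|].
intros y Hy.
assert (y1 := lt_min_l _ _ _ Hy). assert (y2 := lt_min_r _ _ _ Hy).
set (r := (R0 + Cmod (z - o)) / 2).
assert (yr : Cmod (y - o) <= r).
{ eapply Rle_trans; [apply (Cmod_tri3 y z o)|]. unfold r; lra. }
assert (zr : Cmod (z - o) <= r) by (unfold r; lra).
assert (or : Cmod (o - o) <= r).
{ rewrite Cmod_sub_diag. unfold r; lra. }
assert (Hcr : forall w, Cmod (w - o) <= r -> ccont f w).
{ intros w Hw. eapply cderiv_ccont. apply Hd. unfold disk; unfold r in Hw; lra. }
assert (G := goursat f df o o z y r).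
assert (G' := G (fun w Hw => Hd w ltac:(unfold disk; unfold r in Hw; lra)) (conj or (conj zr yr))).
destruct (tri_in_seg o o z y r (conj or (conj zr yr)) f Hcr) as [S1 [S2 S3]].
unfold tri_int in G'. rewrite (seg_int_rev f o y) in G'.
2:{ intros t Ht. apply Hcr. apply seg_convex; assumption. }
replace (seg_int f o y - seg_int f o z)%C with (seg_int f z y).
2:{ transitivity (seg_int f o z + seg_int f z y + - seg_int f o y + seg_int f o y - seg_int f o z)%C; [ring|].
    rewrite G'. ring. }
assert (Cst : seg_int (fun _ => f z) z y = (f z * (y - z))%C).
{ rewrite (seg_int_derive (fun w => f z * w)%C); [ring| |].
  - intros t _. generalize (cderiv_scal (fun w => w) (f z) _ 1%C (cderiv_id (seg z y t))).
    rewrite Cmult_1_r. exact (fun H => H).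
  - intros t _. apply cderiv_ccont with (RtoC 0). apply cderiv_const. }
rewrite <- Cst, <- seg_int_minus; [|exact S2|intros t _; apply cderiv_ccont with (RtoC 0); apply cderiv_const].
apply seg_int_bound.
- intros t Ht eps' e'. destruct (S2 t Ht eps' e') as [d' [d'0 D']]. exists d'; split; [exact d'0|].
  intros w Hw. replace (f w - f z - (f (seg z y t) - f z))%C with (f w - f (seg z y t))%C by ring. now apply D'.
- intros t Ht. apply Rlt_le, Hc. apply Rle_lt_trans with (Cmod (y - z)); [|exact y1].
  apply seg_convex; [|lra|exact Ht]. rewrite Cmod_sub_diag. apply Cmod_ge_0.
Qed.

(** * Compactness, the mean value inequality and homotopy invariance *)

(** The supremum of the initial segments on which [P] holds satisfies [P] by the third premise, and
    by the second it cannot stop short of [x]. *)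
Lemma real_induction (P : R -> Prop) (a b : R) :
  P a ->
  (forall x, a <= x < b -> P x -> exists d, 0 < d /\ forall y, x < y < x + d -> y <= b -> P y) ->
  (forall x, a < x <= b -> (forall y, a <= y < x -> P y) -> P x) ->
  forall x, a <= x <= b -> P x.
Proof.
intros Ha Hr Hl x Hx. apply NNPP; intros nP.
set (S := fun y => a <= y <= x /\ forall z, a <= z <= y -> P z).
destruct (completeness S) as [m [mub mlub]].
- exists x. intros y [Hy _]. lra.
- exists a. split; [lra|]. intros z Hz. replace z with a by lra. exact Ha.
- assert (ma : a <= m).
  { apply mub. split; [lra|]. intros z Hz. replace z with a by lra. exact Ha. }
  assert (mx : m <= x) by (apply mlub; intros y [Hy _]; lra).
  assert (lt : forall z, a <= z < m -> P z).
  { intros z Hz. apply NNPP; intros nz.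
    assert (m <= z); [|lra]. apply mlub. intros y [Hy Hy2].
    destruct (Rle_lt_dec y z) as [L|L]; [exact L|]. exfalso. apply nz, Hy2. lra. }
  assert (Pm : P m).
  { destruct (Req_dec m a) as [->|ne]; [exact Ha|]. apply Hl; [lra|exact lt]. }
  destruct (Req_dec m x) as [->|ne]; [now apply nP|].
  destruct (Hr m) as [d [d0 Hd]]; [lra|exact Pm|].
  set (y := m + Rmin (d / 2) (x - m)).
  assert (0 < Rmin (d / 2) (x - m)) by (apply Rmin_pos; lra).
  assert (A1 := Rmin_l (d / 2) (x - m)). assert (A2 := Rmin_r (d / 2) (x - m)).
  assert (y <= m); [|unfold y in *; lra]. apply mub. split; [unfold y; lra|].
  intros z Hz. destruct (Rtotal_order z m) as [L|[L|L]].
  + apply lt; lra.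
  + subst z; exact Pm.
  + apply Hd; unfold y in Hz; lra.
Qed.

(** A Lebesgue number for an abstract local property. It is the device that makes pointwise
    estimates uniform along a path, without any continuity of the radius. *)
Lemma lebesgue_1d (Q : R -> R -> Prop) (a b : R) :
  (forall u, a <= u <= b -> exists d, 0 < d /\ Q u d) ->
  exists d, 0 < d /\ forall x, a <= x <= b ->
    exists u e, a <= u <= b /\ d <= e /\ Q u e /\ Rabs (x - u) < e.
Proof.
intros H.
assert (H' : forall u, exists d : posreal, a <= u <= b -> Q u d).
{ intros u. destruct (classic (a <= u <= b)) as [Hu|Hu].
  - destruct (H u Hu) as [d [d0 Hd]]. exists (mkposreal d d0). intros _; exact Hd.
  - exists (mkposreal 1 Rlt_0_1). tauto. }
destruct (functional_choice _ H') as [D HD].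
destruct (compactness_value_1d a b D) as [d Hd].
exists d; split; [apply cond_pos|]. intros x Hx.
apply NNPP; intros nE. apply (Hd x Hx). intros [u [Hu [H1 H2]]]. apply nE.
exists u, (D u). repeat split; [apply Hu|apply Hu|exact H2|now apply HD|exact H1].
Qed.

Lemma lebesgue_disk (Q : C -> R -> Prop) (r : R) :
  (forall u, Cmod u <= r -> exists d, 0 < d /\ Q u d) ->
  exists d, 0 < d /\ forall z, Cmod z <= r ->
    exists u e, Cmod u <= r /\ d <= e /\ Q u e /\ Cmod (z - u) < e.
Proof.
intros H.
(* The cover is one of the enclosing square. Centres outside the disk get neighbourhoods that miss
   the disk; the factor 2 passes from coordinatewise distance to [Cmod]. *)
assert (H' : forall u : C, exists d : posreal, (Cmod u <= r -> Q u (2 * d)) /\ (r < Cmod u -> 2 * d <= Cmod u - r)).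
{ intros u. destruct (Rle_lt_dec (Cmod u) r) as [Hu|Hu].
  - destruct (H u Hu) as [d [d0 Hd]]. assert (d2 : 0 < d / 2) by lra.
    exists (mkposreal _ d2). simpl. split; [|lra]. intros _. now replace (2 * (d / 2)) with d by field.
  - assert (d2 : 0 < (Cmod u - r) / 2) by lra. exists (mkposreal _ d2). simpl. split; lra. }
destruct (functional_choice _ H') as [D HD].
destruct (compactness_value_2d (-r) r (-r) r (fun x y => D (x, y))) as [d Hd].
exists d; split; [apply cond_pos|]. intros z Hz.
assert (Hx := Rle_trans _ _ _ (re_le_Cmod z) Hz). apply Rabs_le_between in Hx.
assert (Hy := Rle_trans _ _ _ (Rle_trans _ _ _ (Rmax_r _ _) (Rmax_Cmod z)) Hz). apply Rabs_le_between in Hy.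
apply NNPP; intros nE. apply (Hd (fst z) (snd z) Hx Hy). intros [x [y [_ [_ [H1 [H2 H3]]]]]]. apply nE.
assert (L : Cmod (z - (x, y)) < 2 * D (x, y)).
{ eapply Rle_lt_trans; [apply Cmod_le_re_im|]. simpl. unfold Rminus in H1, H2. lra. }
destruct (HD (x, y)) as [HQ HO].
assert (Hin : Cmod (x, y) <= r).
{ apply Rnot_lt_le. intros C0. specialize (HO C0).
  assert (T := Cmod_sub_le (x, y) z). rewrite Cmod_sub_sym in T. lra. }
exists (x, y), (2 * D (x, y)).
assert (0 < d) by apply cond_pos. repeat split; [exact Hin|lra|now apply HQ|exact L].
Qed.

Lemma null_derivative (u : R -> C) (a b : R) :
  (forall x, a <= x <= b -> forall eps, 0 < eps -> exists d, 0 < d /\ forall y, a <= y <= b ->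
     Rabs (y - x) < d -> Cmod (u y - u x) <= eps * Rabs (y - x)) ->
  a <= b -> u b = u a.
Proof.
intros H ab. apply Cmod_sub_eq_0. apply le_epsilon. intros eps e0.
assert (e1 : 0 < eps / (b - a + 1)) by (apply Rdiv_lt_0_compat; lra).
set (e := eps / (b - a + 1)) in *.
assert (E : forall x, a <= x <= b -> Cmod (u x - u a) <= e * (x - a)).
{ apply real_induction.
  - rewrite Cmod_sub_diag. lra.
  - intros x Hx Px. destruct (H x ltac:(lra) e e1) as [d [d0 Hd]].
    exists d; split; [exact d0|]. intros y Hy Hyb.
    eapply Rle_trans; [apply (Cmod_tri3 (u y) (u x) (u a))|].
    assert (Q := Hd y ltac:(lra)). rewrite Rabs_pos_eq in Q by lra. specialize (Q ltac:(lra)). lra.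
  - intros x Hx Px. destruct (H x ltac:(lra) e e1) as [d [d0 Hd]].
    set (y := Rmax a (x - d / 2)).
    assert (Y1 := Rmax_l a (x - d / 2)). assert (Y2 := Rmax_r a (x - d / 2)).
    assert (yx : y < x) by (apply Rmax_lub_lt; lra). fold y in Y1, Y2.
    eapply Rle_trans; [apply (Cmod_tri3 (u x) (u y) (u a))|].
    assert (Q := Hd y ltac:(lra)). rewrite Rabs_left in Q by lra. specialize (Q ltac:(lra)).
    rewrite Cmod_sub_sym in Q. specialize (Px y ltac:(lra)). lra. }
specialize (E b ltac:(lra)). eapply Rle_trans; [exact E|].
apply Rle_trans with (e * (b - a + 1)); [nra|]. right. unfold e. field. lra.
Qed.

(** Multiplication by [Cconj D] reduces the claim to the real mean value theorem: along the segment
    the real part of [Cconj D * (f z - l * z)] increases by exactly [|D|^2]. *)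
Lemma holo_mean_value (f df : C -> C) (o l : C) (r eps : R) :
  (forall z, disk o r z -> cderiv f z (df z)) ->
  (forall z, disk o r z -> Cmod (df z - l) <= eps) ->
  forall x y, disk o r x -> disk o r y -> Cmod (f y - f x - l * (y - x)) <= eps * Cmod (y - x).
Proof.
intros Hd Hl x y Hx Hy.
set (D := (f y - f x - l * (y - x))%C).
destruct (Req_dec (Cmod D) 0) as [E|nE].
{ rewrite E. apply Rmult_le_pos; [|apply Cmod_ge_0]. eapply Rle_trans; [apply Cmod_ge_0|apply (Hl x Hx)]. }
assert (P : 0 < Cmod D) by (generalize (Cmod_ge_0 D); lra).
set (g := fun z => (Cconj D * (f z - l * z))%C).
assert (Hseg : forall t, 0 <= t <= 1 -> disk o r (seg x y t)).
{ intros t Ht. unfold disk in *. set (m := Rmax (Cmod (x - o)) (Cmod (y - o))).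
  apply Rle_lt_trans with m; [|now apply Rmax_lub_lt].
  apply seg_convex; [apply Rmax_l|apply Rmax_r|exact Ht]. }
assert (Hg : forall t, 0 <= t <= 1 ->
  is_derive (fun s => fst (g (seg x y s))) t (fst (Cconj D * (df (seg x y t) - l) * (y - x))%C)).
{ intros t Ht.
  assert (Q : cderiv g (seg x y t) (Cconj D * (df (seg x y t) + - l * 1))%C).
  { apply cderiv_ext_loc with (f := fun z => (Cconj D * (f z + - l * z))%C) (d := 1); [lra| |].
    - intros z _. unfold g. ring.
    - apply cderiv_scal. apply cderiv_plus; [now apply Hd, Hseg|]. apply cderiv_scal, cderiv_id. }
  assert (Q2 := is_derive_comp_C_R g (seg x y) t _ _ (is_derive_affine_path x (y - x) t) Q).
  replace (df (seg x y t) + - l * 1)%C with (df (seg x y t) - l)%C in Q2 by ring.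
  destruct Q2 as [_ Q2].
  split; [apply is_linear_scal_l|]. intros z Hz eps'. specialize (Q2 z Hz eps').
  apply filter_imp with (2 := Q2). intros s Hs.
  eapply Rle_trans; [|exact Hs]. rewrite norm_C_R.
  eapply Rle_trans; [|apply re_le_Cmod]. right. reflexivity. }
destruct (MVT_gen (fun s => fst (g (seg x y s))) 0 1
  (fun t => fst (Cconj D * (df (seg x y t) - l) * (y - x))%C)) as [c [Hc Ec]].
- intros t Ht. rewrite Rmin_left, Rmax_right in Ht by lra. apply Hg; lra.
- intros t Ht. rewrite Rmin_left, Rmax_right in Ht by lra.
  apply continuity_pt_filterlim. apply (ex_derive_continuous (K := R_AbsRing) (V := R_NormedModule)).
  eexists; apply Hg; lra.
- rewrite Rmin_left, Rmax_right in Hc by lra.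
  replace (seg x y 1) with y in Ec by (unfold seg; ring).
  replace (seg x y 0) with x in Ec by (unfold seg; ring).
  assert (E2 : Cmod D * Cmod D = fst (g y) - fst (g x)).
  { assert (E3 := Cmod2_conj D). simpl in E3. rewrite Rmult_1_r in E3.
    transitivity (fst (Cconj D * D)%C).
    - rewrite Cmult_comm, <- E3. reflexivity.
    - unfold g. unfold D at 2. change (fst (g y) - fst (g x)) with (fst (g y - g x)%C).
      transitivity (fst (Cconj D * (f y - l * y) - Cconj D * (f x - l * x))%C); [|reflexivity].
      f_equal. ring. }
  rewrite Ec, Rminus_0_r, Rmult_1_r in E2.
  assert (B := re_le_Cmod (Cconj D * (df (seg x y c) - l) * (y - x))%C).
  unfold Re in B. rewrite !Cmod_mult, Cmod_conj in B.
  assert (B2 := Hl _ (Hseg c Hc)).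
  apply Rmult_le_reg_l with (Cmod D); [exact P|]. rewrite E2.
  eapply Rle_trans; [apply Rle_abs|]. eapply Rle_trans; [exact B|].
  rewrite Rmult_assoc. apply Rmult_le_compat_l; [lra|].
  apply Rmult_le_compat_r; [apply Cmod_ge_0|exact B2].
Qed.

(** * Algebra and boundedness of continuous paths; deformation of path integrals *)

Lemma pcont_const (c : C) (t : R) : pcont (fun _ => c) t.
Proof.
intros eps e0. exists 1; split; [lra|]. intros s _. now rewrite Cmod_sub_diag.
Qed.

Lemma pcont_plus (u v : R -> C) (t : R) : pcont u t -> pcont v t -> pcont (fun s => u s + v s)%C t.
Proof.
intros Hu Hv eps e0. destruct (Hu (eps / 2)) as [d1 [d10 H1]]; [lra|].
destruct (Hv (eps / 2)) as [d2 [d20 H2]]; [lra|].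
exists (Rmin d1 d2); split; [now apply Rmin_pos|]. intros s Hs.
specialize (H1 s (lt_min_l _ _ _ Hs)). specialize (H2 s (lt_min_r _ _ _ Hs)).
replace (u s + v s - (u t + v t))%C with ((u s - u t) + (v s - v t))%C by ring.
eapply Rle_lt_trans; [apply Cmod_triangle|]. lra.
Qed.

Lemma pcont_scal (c : C) (u : R -> C) (t : R) : pcont u t -> pcont (fun s => c * u s)%C t.
Proof.
intros Hu. apply (ccont_pcont (fun z => c * z)%C u t Hu).
apply cderiv_ccont with (c * 1)%C. apply cderiv_scal, cderiv_id.
Qed.

(** Polarization, [u v = ((u + v)^2 - (u - v)^2) / 4], leaves only squares, which are compositions
    with a holomorphic map. *)
Lemma pcont_mult (u v : R -> C) (t : R) : pcont u t -> pcont v t -> pcont (fun s => u s * v s)%C t.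
Proof.
intros Hu Hv.
assert (Q : forall w, pcont w t -> pcont (fun s => w s * w s)%C t).
{ intros w Hw. apply (ccont_pcont (fun z => z * z)%C w t Hw). eapply cderiv_ccont, cderiv_sqr. }
assert (H := pcont_scal (/ 4) _ t (pcont_plus _ _ t (Q _ (pcont_plus u v t Hu Hv))
  (pcont_scal (- (1)) _ t (Q _ (pcont_plus u _ t Hu (pcont_scal (- (1)) v t Hv)))))).
intros eps e0. destruct (H eps e0) as [d [d0 Hd]]. exists d; split; [exact d0|].
intros s Hs. specialize (Hd s Hs).
match type of Hd with Cmod ?x < _ => replace x with (u s * v s - u t * v t)%C in Hd by field end.
exact Hd.
Qed.

Lemma pcont_inv (u : R -> C) (t : R) : u t <> 0%C -> pcont u t -> pcont (fun s => / u s)%C t.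
Proof.
intros nz Hu. apply (ccont_pcont Cinv u t Hu). eapply cderiv_ccont, cderiv_Cinv, nz.
Qed.

Lemma pcont_ext (u v : R -> C) (t : R) : (forall s, u s = v s) -> pcont u t -> pcont v t.
Proof. intros E H eps e0. destruct (H eps e0) as [d Hd]. exists d. now setoid_rewrite <- E. Qed.

Lemma pcont_bounded (u : R -> C) (a b : R) :
  (forall t, a <= t <= b -> pcont u t) -> exists M, 0 < M /\ forall t, a <= t <= b -> Cmod (u t) <= M.
Proof.
intros H.
(* The demand [e <= / (1 + |u t|)] hides a bound on [u] in the radius: a uniform lower bound on
   radii becomes an upper bound on [|u|]. *)
destruct (lebesgue_1d (fun t e => e <= / (1 + Cmod (u t)) /\ forall s, Rabs (s - t) < e -> Cmod (u s - u t) < 1) a b) as [d [d0 Hd]].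
- intros t Ht. destruct (H t Ht 1) as [d [d0 Hd]]; [lra|].
  assert (P : 0 < / (1 + Cmod (u t))) by (apply Rinv_0_lt_compat; generalize (Cmod_ge_0 (u t)); lra).
  exists (Rmin d (/ (1 + Cmod (u t)))). split; [now apply Rmin_pos|]. split; [apply Rmin_r|].
  intros s Hs. apply Hd. exact (lt_min_l _ _ _ Hs).
- exists (1 + / d). assert (0 < / d) by now apply Rinv_0_lt_compat. split; [lra|].
  intros t Ht. destruct (Hd t Ht) as [s [e [_ [de [[He1 He2] Hs]]]]]. specialize (He2 t Hs).
  assert (P : 0 < 1 + Cmod (u s)) by (generalize (Cmod_ge_0 (u s)); lra).
  assert (Q : 1 + Cmod (u s) <= / d).
  { rewrite <- (Rinv_inv (1 + Cmod (u s))). apply Rinv_le_contravar; lra. }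
  generalize (Cmod_sub_le (u t) (u s)). lra.
Qed.

Lemma RIntC_minus (u v : R -> C) (a b : R) :
  ex_RIntC u a b -> ex_RIntC v a b -> RIntC (fun t => u t - v t)%C a b = (RIntC u a b - RIntC v a b)%C.
Proof. intros Hu Hv. exact (RInt_minus (V := C_R_CompleteNormedModule) u v a b Hu Hv). Qed.

Lemma RIntC_ext (u v : R -> C) (a b : R) :
  a <= b -> (forall t, a <= t <= b -> u t = v t) -> RIntC u a b = RIntC v a b.
Proof.
intros ab H. apply (RInt_ext (V := C_R_CompleteNormedModule)).
intros t Ht. rewrite Rmin_left, Rmax_right in Ht by exact ab. apply H. lra.
Qed.

(** As a function of [s], the integral of [k * F (p + s q)] has derivative zero by the last premise,
    so its values at [s = 1] and [s = 0] agree. The differentiation under the integral is made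
    uniform in [t] by a Lebesgue number. *)
Lemma homotopy_invariance (F f : C -> C) (V : C -> Prop) (k p q : R -> C) (a b : R) :
  a <= b -> copen V ->
  (forall z, V z -> cderiv F z (f z)) -> (forall z, V z -> ccont f z) ->
  (forall t, pcont k t) -> (forall t, pcont p t) -> (forall t, pcont q t) ->
  (forall s t, 0 <= s <= 1 -> a <= t <= b -> V (p t + RtoC s * q t)%C) ->
  (forall s, 0 <= s <= 1 -> RIntC (fun t => k t * q t * f (p t + RtoC s * q t))%C a b = RtoC 0) ->
  RIntC (fun t => k t * F (p t + q t))%C a b = RIntC (fun t => k t * F (p t))%C a b.
Proof.
intros ab HV HF Hf Hk Hp Hq Hin Hz.
set (P := fun s t => (p t + RtoC s * q t)%C).
assert (HP : forall s t, pcont (P s) t).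
{ intros s t. apply pcont_plus; [apply Hp|]. now apply pcont_scal. }
assert (I1 : forall s, 0 <= s <= 1 -> ex_RIntC (fun t => k t * F (P s t))%C a b).
{ intros s Hs. apply ex_RIntC_pcont; [exact ab|]. intros t Ht. apply pcont_mult; [apply Hk|].
  apply (ccont_pcont F (P s) t (HP s t)). eapply cderiv_ccont. now apply HF, Hin. }
assert (I2 : forall s, 0 <= s <= 1 -> ex_RIntC (fun t => k t * q t * f (P s t))%C a b).
{ intros s Hs. apply ex_RIntC_pcont; [exact ab|]. intros t Ht. apply pcont_mult; [now apply pcont_mult|].
  apply (ccont_pcont f (P s) t (HP s t)). now apply Hf, Hin. }
destruct (pcont_bounded (fun t => k t) a b) as [Mk [Mk0 HMk]]; [intros t _; apply Hk|].
destruct (pcont_bounded q a b) as [Mq [Mq0 HMq]]; [intros t _; apply Hq|].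
assert (E := null_derivative (fun s => RIntC (fun t => k t * F (P s t))%C a b) 0 1).
simpl in E. rewrite (RIntC_ext (fun t => k t * F (p t + q t))%C (fun t => k t * F (P 1 t))%C) by
  (try exact ab; intros t _; unfold P; f_equal; f_equal; ring).
rewrite (RIntC_ext (fun t => k t * F (p t))%C (fun t => k t * F (P 0 t))%C) by
  (try exact ab; intros t _; unfold P; f_equal; f_equal; ring).
apply E; [|lra]. clear E.
intros s Hs eps e0.
set (e1 := eps / (2 * Mk * Mq * (b - a + 1))).
assert (e10 : 0 < e1).
{ apply Rdiv_lt_0_compat; [exact e0|]. repeat apply Rmult_lt_0_compat; lra. }
destruct (lebesgue_1d (fun t d => forall t' s', a <= t' <= b -> 0 <= s' <= 1 -> Rabs (t' - t) < d -> Rabs (s' - s) < d ->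
   Cmod (F (P s' t') - F (P s t') - f (P s t') * (P s' t' - P s t')) <= 2 * e1 * Cmod (P s' t' - P s t')) a b)
  as [d [d0 Hd]].
{ intros t Ht. destruct (HV _ (Hin s t Hs Ht)) as [r1 [r10 Hr1]].
  destruct (Hf _ (Hin s t Hs Ht) e1 e10) as [r2 [r20 Hr2]]. fold (P s t) in Hr1, Hr2.
  set (r := Rmin r1 r2). assert (r0 : 0 < r) by now apply Rmin_pos.
  destruct (HP s t (r / 2)) as [d1 [d10 Hd1]]; [lra|].
  exists (Rmin d1 (r / 2 / Mq)). split; [apply Rmin_pos; [exact d10|apply Rdiv_lt_0_compat; lra]|].
  intros t' s' Ht' Hs' Dt Ds.
  assert (D1 := Hd1 t' (lt_min_l _ _ _ Dt)).
  assert (D2 : Cmod (P s' t' - P s t') < r / 2).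
  { replace (P s' t' - P s t')%C with (RtoC (s' - s) * q t')%C by (unfold P; rewrite RtoC_minus; ring).
    rewrite Cmod_mult, Cmod_R. assert (Q := lt_min_r _ _ _ Ds).
    apply Rle_lt_trans with (Rabs (s' - s) * Mq).
    - apply Rmult_le_compat_l; [apply Rabs_pos|now apply HMq].
    - apply Rlt_le_trans with (r / 2 / Mq * Mq); [now apply Rmult_lt_compat_r|]. right; field; lra. }
  assert (Z1 : disk (P s t) r (P s t')) by (unfold disk; lra).
  assert (Z2 : disk (P s t) r (P s' t')).
  { unfold disk. eapply Rle_lt_trans; [apply (Cmod_tri3 _ (P s t'))|]. lra. }
  apply (holo_mean_value F f (P s t) (f (P s t')) r (2 * e1)); [| |exact Z1|exact Z2].
  - intros z Hzd. apply HF, Hr1. exact (lt_min_l _ _ _ Hzd).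
  - intros z Hzd. eapply Rle_trans; [apply (Cmod_tri3 _ (f (P s t)))|].
    assert (A1 := Hr2 z (lt_min_r _ _ _ Hzd)).
    assert (A2 := Hr2 (P s t') (lt_min_r _ _ _ Z1)).
    rewrite (Cmod_sub_sym (f (P s t))). lra. }
exists d; split; [exact d0|]. intros s' Hs' Ds.
(* The vanishing integral, times [s' - s], is subtracted for free; the increment becomes an integral
   of first-order remainders. *)
assert (E1 : (RIntC (fun t => k t * F (P s' t))%C a b - RIntC (fun t => k t * F (P s t))%C a b)%C =
  RIntC (fun t => k t * (F (P s' t) - F (P s t) - f (P s t) * (P s' t - P s t)))%C a b).
{ transitivity (RIntC (fun t => k t * F (P s' t))%C a b - RIntC (fun t => k t * F (P s t))%C a b
    - RtoC (s' - s) * RIntC (fun t => k t * q t * f (P s t))%C a b)%C.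
  - assert (Z : RIntC (fun t => k t * q t * f (P s t))%C a b = RtoC 0) by exact (Hz s Hs).
    rewrite Z. ring.
  - rewrite <- RIntC_scal by now apply I2. rewrite <- RIntC_minus by (now apply I1).
    assert (I3 : ex_RIntC (fun t => RtoC (s' - s) * (k t * q t * f (P s t)))%C a b).
    { destruct (I2 s Hs) as [l Hl]. eexists. apply is_RIntC_scal. exact Hl. }
    rewrite <- RIntC_minus; [|exact (ex_RInt_minus (V := C_R_NormedModule) _ _ a b (I1 s' Hs') (I1 s Hs))|exact I3].
    apply RIntC_ext; [exact ab|]. intros t _. unfold P. rewrite RtoC_minus. ring. }
rewrite E1. eapply Rle_trans.
{ apply (RIntC_bound _ a b (Mk * (2 * e1 * (Rabs (s' - s) * Mq)))); [exact ab| |].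
  - intros t Ht. rewrite Cmod_mult. apply Rmult_le_compat; [apply Cmod_ge_0|apply Cmod_ge_0|now apply HMk|].
    destruct (Hd t Ht) as [u [e [Hu [He [Q1 Q2]]]]].
    eapply Rle_trans; [apply Q1; try assumption; lra|].
    apply Rmult_le_compat_l; [lra|].
    replace (P s' t - P s t)%C with (RtoC (s' - s) * q t)%C by (unfold P; rewrite RtoC_minus; ring).
    rewrite Cmod_mult, Cmod_R. apply Rmult_le_compat_l; [apply Rabs_pos|now apply HMq].
  - apply ex_RIntC_pcont; [exact ab|]. intros t Ht. apply pcont_mult; [apply Hk|].
    assert (CF : forall s, 0 <= s <= 1 -> pcont (fun t => F (P s t)) t).
    { intros u Hu. apply (ccont_pcont F (P u) t (HP u t)). eapply cderiv_ccont. now apply HF, Hin. }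
    assert (Cf : pcont (fun t => f (P s t)) t).
    { apply (ccont_pcont f (P s) t (HP s t)). now apply Hf, Hin. }
    assert (M : forall u v, pcont u t -> pcont v t -> pcont (fun s => u s - v s)%C t).
    { intros u v Hu Hv. apply pcont_ext with (fun s => u s + - (1) * v s)%C; [intros; ring|].
      apply pcont_plus; [exact Hu|now apply pcont_scal]. }
    apply M; [apply M; now apply CF|]. apply pcont_mult; [exact Cf|]. apply M; apply HP. }
apply Rle_trans with (e1 * (2 * Mk * Mq * (b - a + 1)) * Rabs (s' - s)).
- clearbody e1. assert (0 <= Rabs (s' - s)) by apply Rabs_pos.
  assert (0 <= Mk * e1 * Mq * Rabs (s' - s)) by (repeat apply Rmult_le_pos; lra). nra.
- right. unfold e1. field. repeat split; lra.
Qed.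

(** * Cauchy's formula on a circle *)

Lemma is_derive_pair (u : R -> C) (t : R) (l : C) :
  is_derive (fun s => fst (u s)) t (fst l) -> is_derive (fun s => snd (u s)) t (snd l) ->
  is_derive (V := C_R_NormedModule) u t l.
Proof.
intros [_ H1] [_ H2]. split; [apply is_linear_scal_l|]. intros x Hx eps.
assert (e2 : 0 < eps / 2) by (generalize (cond_pos eps); lra).
generalize (filter_and _ _ (H1 x Hx (mkposreal _ e2)) (H2 x Hx (mkposreal _ e2))).
apply filter_imp. intros s [A1 A2]. rewrite norm_C_R.
eapply Rle_trans; [apply Cmod_le_re_im|]. simpl in A1, A2.
eapply Rle_trans; [apply Rplus_le_compat; [exact A1|exact A2]|]. right. simpl. field.
Qed.

Definition expi (t : R) : C := (cos t, sin t).

Lemma Cmod_expi (t : R) : Cmod (expi t) = 1.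
Proof.
unfold Cmod, expi; simpl. etransitivity; [|exact sqrt_1]. f_equal.
generalize (sin2_cos2 t). unfold Rsqr. lra.
Qed.

Lemma expi_plus (s t : R) : expi (s + t) = (expi s * expi t)%C.
Proof. unfold expi, Cmult; simpl. rewrite cos_plus, sin_plus. f_equal; ring. Qed.

Lemma expi_0 : expi 0 = RtoC 1.
Proof. unfold expi. now rewrite cos_0, sin_0. Qed.

Lemma expi_2PI : expi (2 * PI) = RtoC 1.
Proof. unfold expi. now rewrite cos_2PI, sin_2PI. Qed.

Lemma expi_neq_0 (t : R) : expi t <> 0%C.
Proof. apply Cmod_gt_0. rewrite Cmod_expi. lra. Qed.

Lemma is_derive_expi (t : R) : is_derive (V := C_R_NormedModule) expi t (Ci * expi t)%C.
Proof.
apply is_derive_pair.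
- replace (fst (Ci * expi t)%C) with (- sin t) by (unfold Ci, expi; simpl; ring).
  apply is_derive_Reals, derivable_pt_lim_cos.
- replace (snd (Ci * expi t)%C) with (cos t) by (unfold Ci, expi; simpl; ring).
  apply is_derive_Reals, derivable_pt_lim_sin.
Qed.

Lemma pcont_expi (t : R) : pcont expi t.
Proof. eapply is_derive_pcont, is_derive_expi. Qed.

Lemma cderiv_affine (a b z : C) : cderiv (fun x => a + b * x)%C z b.
Proof.
generalize (cderiv_plus _ _ z _ _ (cderiv_const a z) (cderiv_scal _ b z _ (cderiv_id z))).
now rewrite Cplus_0_l, Cmult_1_r.
Qed.

Lemma ccont_neg_inv_sqr (z : C) : z <> 0%C -> ccont (fun z => - / (z * z))%C z.
Proof.
intros nz. eapply cderiv_ccont.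
apply cderiv_ext_loc with (f := fun z => (- (1) * / (z * z))%C) (d := 1); [lra|intros; ring|].
apply cderiv_scal. apply cderiv_inv; [apply Cmult_neq_0; exact nz|apply cderiv_sqr].
Qed.

Section Cauchy.

Variables (r : R) (o : C).
Hypothesis r0 : 0 < r.

Let circ (t : R) : C := (RtoC r * expi t)%C.

Lemma Cmod_circ (t : R) : Cmod (circ t) = r.
Proof. unfold circ. rewrite Cmod_mult, Cmod_R, Cmod_expi, Rabs_pos_eq; lra. Qed.

Lemma pcont_circ (t : R) : pcont circ t.
Proof. apply pcont_scal, pcont_expi. Qed.

Lemma Ci_neq_0 : Ci <> 0%C.
Proof. apply Cmod_gt_0. rewrite Cmod_Ci. lra. Qed.

(* The integrand is the derivative of a periodic function of [t]. *)
Lemma int_circ_deriv (F f : C -> C) (V : C -> Prop) (a b : C) :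
  (forall z, V z -> cderiv F z (f z)) -> (forall z, V z -> ccont f z) ->
  (forall t, V (a + b * circ t)%C) ->
  (b * RIntC (fun t => circ t * f (a + b * circ t))%C 0 (2 * PI))%C = RtoC 0.
Proof.
intros HF Hf Hin. assert (P := PI_RGT_0).
assert (Hc : forall t, pcont (fun t => a + b * circ t)%C t).
{ intros t. apply pcont_plus; [apply pcont_const|]. apply pcont_scal, pcont_circ. }
assert (Hfc : forall t, pcont (fun t => f (a + b * circ t))%C t).
{ intros t. apply (ccont_pcont f (fun t => a + b * circ t)%C t (Hc t)). apply Hf, Hin. }
assert (E : RIntC (fun t => f (a + b * circ t) * (b * RtoC r * (Ci * expi t)))%C 0 (2 * PI) = RtoC 0).
{ rewrite (RIntC_derive (fun t => F (a + b * circ t)%C)).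
  - unfold circ. rewrite expi_2PI, expi_0. Ceq; ring.
  - lra.
  - intros t _. apply (is_derive_comp_C_R F (fun t => a + b * circ t)%C); [|now apply HF].
    assert (D := is_derive_comp_C_R (fun x => a + (b * RtoC r) * x)%C expi t _ _ (is_derive_expi t) (cderiv_affine a (b * RtoC r) _)).
    eapply is_derive_ext; [|exact D]. intros s. unfold circ.
    Ceq. ring.
  - intros t _. apply pcont_mult; [apply Hfc|]. apply pcont_scal, pcont_scal, pcont_expi. }
apply (f_equal (fun z => / Ci * z)%C) in E.
rewrite <- RIntC_scal in E.
2:{ apply ex_RIntC_pcont; [lra|]. intros t _. apply pcont_mult; [apply Hfc|]. apply pcont_scal, pcont_scal, pcont_expi. }
rewrite <- RIntC_scal.
2:{ apply ex_RIntC_pcont; [lra|]. intros t _. apply pcont_mult; [apply pcont_circ|apply Hfc]. }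
rewrite Cmult_0_r in E. rewrite <- E. apply RIntC_ext; [lra|]. intros t _.
unfold circ. field. apply Ci_neq_0.
Qed.

Lemma RIntC_one : RIntC (fun _ => RtoC 1) 0 (2 * PI) = RtoC (2 * PI).
Proof.
assert (P := PI_RGT_0). rewrite (RIntC_derive (fun t => RtoC t)).
- now rewrite <- RtoC_minus, Rminus_0_r.
- lra.
- intros t _. eapply is_derive_ext; [|exact (is_derive_affine_path 0 1 t)].
  intros s. Ceq. cbv beta. ring.
- intros t _. apply pcont_const.
Qed.

Lemma circ_minus_neq (w : C) (t : R) : Cmod w < r -> (circ t - w)%C <> 0%C.
Proof.
intros Hw. apply Cmod_gt_0. assert (H := Cmod_sub_le (circ t) w). rewrite Cmod_circ in H. lra.
Qed.

Lemma circ_neq (t : R) : circ t <> 0%C.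
Proof. apply Cmod_gt_0. now rewrite Cmod_circ. Qed.

Lemma pcont_circ_minus_inv (w : C) (t : R) : Cmod w < r -> pcont (fun t => / (circ t - w))%C t.
Proof.
intros Hw. apply pcont_inv; [now apply circ_minus_neq|].
apply pcont_ext with (fun t => - w + circ t)%C; [intros; ring|].
apply pcont_plus; [apply pcont_const|apply pcont_circ].
Qed.

(** The point [w] is moved to [0] along a segment. The [s]-derivative of the integrand is
    [w circ / (circ - s w)^2], up to a constant the derivative of a periodic function of [t]; at
    [w = 0] the integrand is [1]. *)
Lemma int_cauchy_kernel (w : C) : Cmod w < r ->
  RIntC (fun t => circ t * / (circ t - w))%C 0 (2 * PI) = RtoC (2 * PI).
Proof.
intros Hw. assert (P := PI_RGT_0). rewrite <- RIntC_one.
assert (Nz : forall s t, 0 <= s <= 1 -> (circ t + RtoC s * - w <> 0)%C).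
{ intros s t Hs. replace (circ t + RtoC s * - w)%C with (circ t - RtoC s * w)%C by ring.
  apply circ_minus_neq. rewrite Cmod_mult, Cmod_R, Rabs_pos_eq by lra.
  generalize (Cmod_ge_0 w). nra. }
rewrite (RIntC_ext (fun t => circ t * / (circ t - w))%C (fun t => circ t * / (circ t + - w))%C) by
  (try lra; intros; reflexivity).
rewrite (RIntC_ext (fun _ => RtoC 1) (fun t => circ t * / circ t)%C).
2: lra.
2:{ intros t _. field. apply circ_neq. }
apply (homotopy_invariance Cinv (fun z => - / (z * z))%C (fun z => z <> 0%C) circ circ (fun _ => - w)%C).
- lra.
- intros z nz. exists (Cmod z). split; [now apply Cmod_gt_0|]. intros y Hy E. subst y.
  replace (0 - z)%C with (- z)%C in Hy by ring. rewrite Cmod_opp in Hy. lra.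
- intros z nz. now apply cderiv_Cinv.
- exact ccont_neg_inv_sqr.
- apply pcont_circ.
- apply pcont_circ.
- intros t. apply pcont_const.
- intros s t Hs _. now apply Nz.
- intros s Hs.
  assert (H := int_circ_deriv Cinv (fun z => - / (z * z))%C (fun z => z <> 0%C) (RtoC s * - w) 1).
  specialize (H (fun z nz => cderiv_Cinv z nz) ccont_neg_inv_sqr).
  rewrite Cmult_1_l in H.
  rewrite (RIntC_ext _ (fun t => - w * (circ t * - / ((RtoC s * - w + 1 * circ t) * (RtoC s * - w + 1 * circ t))))%C).
  + rewrite RIntC_scal.
    * rewrite H; [Ceq; ring|]. intros t. replace (RtoC s * - w + 1 * circ t)%C with (circ t + RtoC s * - w)%C by ring. now apply Nz.
    * apply ex_RIntC_pcont; [lra|]. intros t _. apply pcont_mult; [apply pcont_circ|].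
      apply (ccont_pcont (fun z => - / (z * z))%C (fun t => RtoC s * - w + 1 * circ t)%C t).
      -- apply pcont_plus; [apply pcont_const|]. apply pcont_scal, pcont_circ.
      -- apply ccont_neg_inv_sqr. replace (RtoC s * - w + 1 * circ t)%C with (circ t + RtoC s * - w)%C by ring. now apply Nz.
  + lra.
  + intros t _. assert (N := Nz s t Hs).
    replace (RtoC s * - w + 1 * circ t)%C with (circ t + RtoC s * - w)%C by ring. field. exact N.
Qed.

(** The circle is contracted to [w]. The kernel is [circ t] divided by the displacement from [w], so
    it cancels in the [s]-derivative and leaves [circ t * f] along a smaller circle, with integral
    zero. Continuity of the derivative [f] is a premise here; [holo_C1] meets it by passing to a
    primitive. *)
Theorem cauchy_formula (F f : C -> C) (r' : R) (w : C) :
  r < r' -> (forall z, disk o r' z -> cderiv F z (f z)) -> (forall z, disk o r' z -> ccont f z) ->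
  Cmod (w - o) < r ->
  (RtoC (2 * PI) * F w)%C = RIntC (fun t => circ t * F (o + circ t) * / (circ t - (w - o)))%C 0 (2 * PI).
Proof.
intros rr HF Hf Hw. assert (P := PI_RGT_0).
assert (Hin : forall s t, 0 <= s <= 1 -> disk o r' (w + RtoC s * (o + circ t - w))%C).
{ intros s t Hs. unfold disk. apply Rle_lt_trans with r; [|exact rr].
  apply (seg_convex o w (o + circ t)%C r s); [lra| |exact Hs].
  replace (o + circ t - o)%C with (circ t) by ring. rewrite Cmod_circ. lra. }
rewrite (RIntC_ext _ (fun t => circ t * / (circ t - (w - o)) * F (w + (o + circ t - w)))%C).
2: lra.
2:{ intros t _. replace (w + (o + circ t - w))%C with (o + circ t)%C by ring. ring. }
rewrite (homotopy_invariance F f (disk o r') (fun t => circ t * / (circ t - (w - o)))%C (fun _ => w) (fun t => o + circ t - w)%C).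
- rewrite (RIntC_ext _ (fun t => F w * (circ t * / (circ t - (w - o))))%C); [|lra|intros; ring].
  rewrite RIntC_scal.
  + rewrite int_cauchy_kernel by exact Hw. Ceq; ring.
  + apply ex_RIntC_pcont; [lra|]. intros t _. apply pcont_mult; [apply pcont_circ|now apply pcont_circ_minus_inv].
- lra.
- intros z Hz. exists (r' - Cmod (z - o)). unfold disk in *. split; [lra|]. intros y Hy.
  eapply Rle_lt_trans; [apply (Cmod_tri3 y z o)|]. lra.
- exact HF.
- exact Hf.
- intros t. apply pcont_mult; [apply pcont_circ|now apply pcont_circ_minus_inv].
- intros t. apply pcont_const.
- intros t. apply pcont_ext with (fun t => (o - w) + circ t)%C; [intros; ring|].
  apply pcont_plus; [apply pcont_const|apply pcont_circ].
- intros s t Hs _. now apply Hin.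
- intros s Hs.
  rewrite (RIntC_ext _ (fun t => circ t * f ((w + RtoC s * (o - w)) + RtoC s * circ t))%C).
  (* At [s = 0] the contracted circle is the point [w] and [s] cannot be divided out; there the
     integral of [circ] itself vanishes. *)
  + destruct (Req_dec s 0) as [->|ns].
    * assert (H := int_circ_deriv (fun z => z * F w)%C (fun _ => F w) (fun _ => True) 0 1).
      rewrite Cmult_1_l in H.
      rewrite (RIntC_ext _ (fun t => f w * (circ t * (fun _ => RtoC 1) (0 + 1 * circ t)))%C).
      -- rewrite RIntC_scal.
         ++ assert (H1 := int_circ_deriv (fun z => z) (fun _ => RtoC 1) (fun _ => True) 0 1).
            rewrite Cmult_1_l in H1. rewrite H1; [Ceq; ring| | |easy].
            ** intros z _. apply cderiv_id.
            ** intros z _. apply cderiv_ccont with (RtoC 0). apply cderiv_const.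
         ++ apply ex_RIntC_pcont; [lra|]. intros t _. apply pcont_mult; [apply pcont_circ|apply pcont_const].
      -- lra.
      -- intros t _. replace (w + RtoC 0 * (o - w) + RtoC 0 * circ t)%C with w by ring. ring.
    * assert (H := int_circ_deriv F f (disk o r') (w + RtoC s * (o - w)) (RtoC s) HF Hf).
      assert (H' := H (fun t => ltac:(replace (w + RtoC s * (o - w) + RtoC s * circ t)%C
         with (w + RtoC s * (o + circ t - w))%C by ring; exact (Hin s t Hs)))).
      assert (ns' : RtoC s <> 0%C) by (intros E; apply ns; now apply RtoC_inj).
      apply (f_equal (fun z => / RtoC s * z)%C) in H'. rewrite Cmult_assoc, Cinv_l in H' by exact ns'.
      rewrite Cmult_1_l, Cmult_0_r in H'. exact H'.
  + lra.
  + intros t _. replace (w + RtoC s * (o - w) + RtoC s * circ t)%C with (w + RtoC s * (o + circ t - w))%C by ring.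
    field. now apply circ_minus_neq.
Qed.
End Cauchy.

(** * Continuity of the derivative *)

Lemma cderiv_unique (f : C -> C) (z l m : C) : cderiv f z l -> cderiv f z m -> l = m.
Proof.
intros Hl Hm. apply Cmod_sub_eq_0. apply le_epsilon. intros eps e0.
destruct (Hl (eps / 2)) as [d1 [d10 H1]]; [lra|]. destruct (Hm (eps / 2)) as [d2 [d20 H2]]; [lra|].
set (d := Rmin d1 d2 / 2). assert (D0 : 0 < Rmin d1 d2) by now apply Rmin_pos.
assert (M1 := Rmin_l d1 d2). assert (M2 := Rmin_r d1 d2).
assert (Ed : Cmod (z + RtoC d - z) = d).
{ replace (z + RtoC d - z)%C with (RtoC d) by ring. rewrite Cmod_R, Rabs_pos_eq; unfold d; lra. }
specialize (H1 (z + RtoC d)%C ltac:(rewrite Ed; unfold d; lra)).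
specialize (H2 (z + RtoC d)%C ltac:(rewrite Ed; unfold d; lra)). rewrite Ed in H1, H2.
replace (z + RtoC d - z)%C with (RtoC d) in H1, H2 by ring.
assert (T := Cmod_le_sub (f (z + RtoC d) - f z - m * RtoC d)%C (f (z + RtoC d) - f z - l * RtoC d)%C).
replace (f (z + RtoC d) - f z - m * RtoC d - (f (z + RtoC d) - f z - l * RtoC d))%C with ((l - m) * RtoC d)%C in T by ring.
rewrite Cmod_mult, Cmod_R, Rabs_pos_eq in T by (unfold d; lra).
apply Rmult_le_reg_r with d; [unfold d; lra|]. lra.
Qed.

(** The remainder is required to be quadratic, uniformly in [t]; this makes differentiation under
    the integral elementary. *)
Lemma cderiv_RIntC (u : C -> R -> C) (du : R -> C) (w : C) (a b M r : R) :
  a <= b -> 0 < r -> (forall y, Cmod (y - w) < r -> ex_RIntC (u y) a b) -> ex_RIntC du a b ->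
  (forall y t, Cmod (y - w) < r -> a <= t <= b ->
     Cmod (u y t - u w t - (y - w) * du t) <= M * (Cmod (y - w) * Cmod (y - w))) ->
  cderiv (fun y => RIntC (u y) a b) w (RIntC du a b).
Proof.
intros ab r0 Hu Hdu H eps e0.
assert (Hw : Cmod (w - w) < r) by (now rewrite Cmod_sub_diag).
set (K := (b - a) * Rabs M + 1).
assert (K0 : 0 < K) by (unfold K; generalize (Rabs_pos M); nra).
exists (Rmin r (eps / K)). split; [apply Rmin_pos; [exact r0|now apply Rdiv_lt_0_compat]|].
intros y Hy. assert (y1 := lt_min_l _ _ _ Hy). assert (y2 := lt_min_r _ _ _ Hy).
assert (I1 : ex_RIntC (fun t => u y t - u w t)%C a b).
{ exact (ex_RInt_minus (V := C_R_NormedModule) _ _ a b (Hu y y1) (Hu w Hw)). }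
assert (I2 : ex_RIntC (fun t => (y - w) * du t)%C a b).
{ destruct Hdu as [l Hl]. eexists. apply is_RIntC_scal. exact Hl. }
replace (RIntC (u y) a b - RIntC (u w) a b - RIntC du a b * (y - w))%C
  with (RIntC (fun t => u y t - u w t - (y - w) * du t)%C a b).
2:{ rewrite RIntC_minus by assumption. rewrite RIntC_scal by assumption.
    rewrite RIntC_minus by (now apply Hu). Ceq. ring. }
assert (N0 := Cmod_ge_0 (y - w)).
eapply Rle_trans.
{ apply (RIntC_bound _ a b (Rabs M * (Cmod (y - w) * Cmod (y - w)))); [exact ab| |].
  - intros t Ht. eapply Rle_trans; [now apply H|]. apply Rmult_le_compat_r; [nra|apply Rle_abs].
  - exact (ex_RInt_minus (V := C_R_NormedModule) _ _ a b I1 I2). }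
assert (Rabs M >= 0) by (generalize (Rabs_pos M); lra).
apply Rle_trans with (K * Cmod (y - w) * Cmod (y - w)); [unfold K; nra|].
apply Rmult_le_compat_r; [exact N0|].
apply Rle_trans with (K * (eps / K)); [|right; field; lra].
apply Rmult_le_compat_l; lra.
Qed.

Section Kernel.

Variables (r : R) (h : R -> C).
Hypothesis r0 : 0 < r.
Hypothesis hc : forall t, pcont h t.

Let ker (w : C) (t : R) : C := (/ (RtoC r * expi t - w))%C.

(** Cauchy integrals with first, second and third power of the kernel, without the factor
    [/ (2 * PI)]. The density [h] will contain the factor [r e^(i t)] left over from [dz]. *)
Definition cauchy1 (w : C) : C := RIntC (fun t => h t * (/ (RtoC r * expi t - w)))%C 0 (2 * PI).
Definition cauchy2 (w : C) : C :=
  RIntC (fun t => h t * (/ (RtoC r * expi t - w) * / (RtoC r * expi t - w)))%C 0 (2 * PI).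
Definition cauchy3 (w : C) : C :=
  RIntC (fun t => h t * (/ (RtoC r * expi t - w) * / (RtoC r * expi t - w) * / (RtoC r * expi t - w)))%C 0 (2 * PI).

Lemma ker_pcont (w : C) (t : R) : Cmod w < r -> pcont (ker w) t.
Proof. intros Hw. apply (pcont_circ_minus_inv r); assumption. Qed.

Lemma ker_bound (w : C) (t : R) : Cmod w < r -> Cmod (ker w t) <= / (r - Cmod w).
Proof.
intros Hw. assert (N := circ_minus_neq r r0 w t Hw). unfold ker. rewrite Cmod_inv by exact N.
apply Rinv_le_contravar; [lra|].
assert (H := Cmod_sub_le (RtoC r * expi t) w). rewrite (Cmod_circ r r0) in H. exact H.
Qed.

Lemma ker_diff (w y : C) (t : R) : Cmod w < r -> Cmod y < r -> (ker y t - ker w t)%C = ((y - w) * (ker w t * ker y t))%C.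
Proof.
intros Hw Hy. unfold ker. field. split; now apply (circ_minus_neq r r0).
Qed.

Lemma near_bound (w y : C) (t : R) :
  Cmod w < r -> Cmod (y - w) < (r - Cmod w) / 2 ->
  Cmod y < r /\ Cmod (ker y t) <= 2 / (r - Cmod w) /\ Cmod (ker w t) <= 2 / (r - Cmod w).
Proof.
intros Hw Hy. assert (T := Cmod_sub_le y w). assert (Hy' : Cmod y < r) by lra.
assert (Q : / (r - Cmod w) <= 2 / (r - Cmod w)).
{ unfold Rdiv. assert (0 < / (r - Cmod w)) by (apply Rinv_0_lt_compat; lra). lra. }
repeat split; [exact Hy'| |eapply Rle_trans; [now apply ker_bound|exact Q]].
eapply Rle_trans; [now apply ker_bound|].
replace (2 / (r - Cmod w)) with (/ ((r - Cmod w) / 2)) by (field; lra).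
apply Rinv_le_contravar; lra.
Qed.

Lemma ker_int (k : R -> C) : (forall t, pcont k t) -> ex_RIntC (fun t => h t * k t)%C 0 (2 * PI).
Proof.
intros H. assert (P := PI_RGT_0). apply ex_RIntC_pcont; [lra|]. intros t _. now apply pcont_mult.
Qed.

Lemma cauchy1_deriv (w : C) : Cmod w < r -> cderiv cauchy1 w (cauchy2 w).
Proof.
intros Hw. assert (P := PI_RGT_0).
destruct (pcont_bounded h 0 (2 * PI)) as [M [M0 HM]]; [intros t _; apply hc|].
set (B := 2 / (r - Cmod w)). assert (B0 : 0 < B) by (apply Rdiv_lt_0_compat; lra).
apply (cderiv_RIntC (fun w t => h t * ker w t)%C (fun t => h t * (ker w t * ker w t))%C w 0 (2 * PI)
  (M * (B * B * B)) ((r - Cmod w) / 2)); [lra|lra| | |].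
- intros y Hy. apply (ker_int). intros t. apply ker_pcont. now apply (near_bound w y t).
- apply (ker_int). intros t. apply pcont_mult; now apply ker_pcont.
- intros y t Hy Ht. destruct (near_bound w y t Hw Hy) as [Hy' [By Bw]].
  assert (E := ker_diff w y t Hw Hy').
  replace (h t * ker y t - h t * ker w t - (y - w) * (h t * (ker w t * ker w t)))%C
    with (h t * ((y - w) * ((y - w) * (ker w t * ker w t * ker y t))))%C.
  2:{ transitivity (h t * ((ker y t - ker w t) - (y - w) * (ker w t * ker w t)))%C; [|ring].
      rewrite E. transitivity (h t * ((y - w) * ker w t * (ker y t - ker w t)))%C; [|ring].
      rewrite E. ring. }
  rewrite !Cmod_mult. assert (N := Cmod_ge_0 (y - w)).
  assert (N1 := Cmod_ge_0 (ker y t)). assert (N2 := Cmod_ge_0 (ker w t)).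
  apply Rle_trans with (M * (Cmod (y - w) * (Cmod (y - w) * (B * B * B)))); [|right; ring].
  apply Rmult_le_compat; [apply Cmod_ge_0| |now apply HM|].
  + repeat apply Rmult_le_pos; assumption.
  + repeat (apply Rmult_le_compat_l; [exact N|]).
    apply Rmult_le_compat; [now apply Rmult_le_pos|exact N1| |exact By].
    apply Rmult_le_compat; assumption.
Qed.

Lemma cauchy2_deriv (w : C) : Cmod w < r -> cderiv cauchy2 w (2 * cauchy3 w).
Proof.
intros Hw. assert (P := PI_RGT_0).
destruct (pcont_bounded h 0 (2 * PI)) as [M [M0 HM]]; [intros t _; apply hc|].
set (B := 2 / (r - Cmod w)). assert (B0 : 0 < B) by (apply Rdiv_lt_0_compat; lra).
assert (I3 : ex_RIntC (fun t => h t * (ker w t * ker w t * ker w t))%C 0 (2 * PI)).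
{ apply (ker_int). intros t. repeat apply pcont_mult; now apply ker_pcont. }
unfold cauchy3. rewrite <- RIntC_scal by exact I3.
apply (cderiv_RIntC (fun w t => h t * (ker w t * ker w t))%C (fun t => 2 * (h t * (ker w t * ker w t * ker w t)))%C w 0 (2 * PI)
  (M * (3 * (B * B * B * B))) ((r - Cmod w) / 2)); [lra|lra| | |].
- intros y Hy. apply (ker_int). intros t. destruct (near_bound w y t Hw Hy) as [Hy' _].
  apply pcont_mult; now apply ker_pcont.
- destruct I3 as [l Hl]. eexists. apply is_RIntC_scal. exact Hl.
- intros y t Hy Ht. destruct (near_bound w y t Hw Hy) as [Hy' [By Bw]].
  assert (E := ker_diff w y t Hw Hy').
  replace (h t * (ker y t * ker y t) - h t * (ker w t * ker w t) - (y - w) * (2 * (h t * (ker w t * ker w t * ker w t))))%C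
    with (h t * ((y - w) * ((y - w) * (ker w t * ker w t * ker y t * (ker y t + 2 * ker w t)))))%C.
  2:{ transitivity (h t * ((ker y t - ker w t) * (ker y t + ker w t) - (y - w) * (2 * (ker w t * ker w t * ker w t))))%C; [|ring].
      rewrite E. transitivity (h t * ((y - w) * ker w t * ((ker y t - ker w t) * (ker y t + 2 * ker w t))))%C; [|ring].
      rewrite E. ring. }
  rewrite !Cmod_mult. assert (N := Cmod_ge_0 (y - w)).
  assert (N1 := Cmod_ge_0 (ker y t)). assert (N2 := Cmod_ge_0 (ker w t)).
  assert (S3 : Cmod (ker y t + 2 * ker w t) <= 3 * B).
  { eapply Rle_trans; [apply Cmod_triangle|]. rewrite Cmod_mult, Cmod_R, Rabs_pos_eq by lra. unfold B. lra. }
  apply Rle_trans with (M * (Cmod (y - w) * (Cmod (y - w) * (B * B * B * (3 * B))))); [|right; ring].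
  apply Rmult_le_compat; [apply Cmod_ge_0| |now apply HM|].
  + repeat apply Rmult_le_pos; try assumption. apply Cmod_ge_0.
  + repeat (apply Rmult_le_compat_l; [exact N|]).
    apply Rmult_le_compat; [repeat apply Rmult_le_pos; assumption|apply Cmod_ge_0| |exact S3].
    apply Rmult_le_compat; [now apply Rmult_le_pos|exact N1| |exact By].
    apply Rmult_le_compat; assumption.
Qed.

Lemma cauchy3_cont (w : C) : Cmod w < r -> ccont cauchy3 w.
Proof.
intros Hw eps e0. assert (P := PI_RGT_0).
destruct (pcont_bounded h 0 (2 * PI)) as [M [M0 HM]]; [intros t _; apply hc|].
set (B := 2 / (r - Cmod w)). assert (B0 : 0 < B) by (apply Rdiv_lt_0_compat; lra).
set (K := 2 * PI * (M * (B * B * (3 * (B * B)))) + 1).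
assert (K0 : 0 < K).
{ unfold K. assert (0 < 2 * PI * (M * (B * B * (3 * (B * B))))) 
    by (apply Rmult_lt_0_compat; [lra|clearbody B; repeat apply Rmult_lt_0_compat; lra]). lra. }
exists (Rmin ((r - Cmod w) / 2) (eps / K)).
split; [apply Rmin_pos; [lra|now apply Rdiv_lt_0_compat]|].
intros y Hy. assert (y1 := lt_min_l _ _ _ Hy). assert (y2 := lt_min_r _ _ _ Hy).
assert (Hy' : Cmod y < r) by now apply (near_bound w y 0).
assert (I : forall v, Cmod v < r -> ex_RIntC (fun t => h t * (ker v t * ker v t * ker v t))%C 0 (2 * PI)).
{ intros v Hv. apply (ker_int). intros t. repeat apply pcont_mult; now apply ker_pcont. }
unfold cauchy3. rewrite <- RIntC_minus by (now apply I).
eapply Rle_lt_trans.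
{ apply (RIntC_bound _ 0 (2 * PI) (M * (Cmod (y - w) * (B * B * (3 * (B * B)))))); [lra| |].
  - intros t Ht. destruct (near_bound w y t Hw y1) as [_ [By Bw]]. fold (ker y t) (ker w t).
    assert (E := ker_diff w y t Hw Hy').
    replace (h t * (ker y t * ker y t * ker y t) - h t * (ker w t * ker w t * ker w t))%C
      with (h t * ((y - w) * (ker w t * ker y t * (ker y t * ker y t + ker y t * ker w t + ker w t * ker w t))))%C.
    2:{ transitivity (h t * ((ker y t - ker w t) * (ker y t * ker y t + ker y t * ker w t + ker w t * ker w t)))%C; [|ring].
        rewrite E. ring. }
    assert (N := Cmod_ge_0 (y - w)). assert (N1 := Cmod_ge_0 (ker y t)). assert (N2 := Cmod_ge_0 (ker w t)).
    assert (S3 : Cmod (ker y t * ker y t + ker y t * ker w t + ker w t * ker w t) <= 3 * (B * B)).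
    { eapply Rle_trans; [apply Cmod_triangle|]. eapply Rle_trans; [apply Rplus_le_compat_r, Cmod_triangle|].
      rewrite !Cmod_mult.
      assert (Cmod (ker y t) * Cmod (ker y t) <= B * B) by (apply Rmult_le_compat; assumption).
      assert (Cmod (ker y t) * Cmod (ker w t) <= B * B) by (apply Rmult_le_compat; assumption).
      assert (Cmod (ker w t) * Cmod (ker w t) <= B * B) by (apply Rmult_le_compat; assumption). lra. }
    rewrite Cmod_mult. apply Rmult_le_compat; [apply Cmod_ge_0|apply Cmod_ge_0|now apply HM|].
    rewrite Cmod_mult. apply Rmult_le_compat_l; [exact N|].
    rewrite Cmod_mult. apply Rmult_le_compat; [apply Cmod_ge_0|apply Cmod_ge_0| |exact S3].
    rewrite Cmod_mult. apply Rmult_le_compat; assumption.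
  - exact (ex_RInt_minus (V := C_R_NormedModule) _ _ 0 (2 * PI) (I y Hy') (I w Hw)). }
assert (N := Cmod_ge_0 (y - w)).
apply Rle_lt_trans with (K * Cmod (y - w)); [unfold K; lra|].
apply Rlt_le_trans with (K * (eps / K)); [now apply Rmult_lt_compat_l|right; field; lra].
Qed.

Lemma cauchy1_bound (M : R) (w : C) :
  Cmod w < r -> (forall t, 0 <= t <= 2 * PI -> Cmod (h t) <= M) ->
  Cmod (cauchy1 w) <= 2 * PI * (M * / (r - Cmod w)).
Proof.
intros Hw HM. assert (P := PI_RGT_0).
replace (2 * PI) with (2 * PI - 0) by ring. apply RIntC_bound; [lra| |].
- intros t Ht. rewrite Cmod_mult. apply Rmult_le_compat; [apply Cmod_ge_0|apply Cmod_ge_0|apply HM; lra|].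
  now apply ker_bound.
- apply (ker_int). intros t. now apply ker_pcont.
Qed.

End Kernel.

(** One step of the Taylor expansion: [1 / (c - w) = 1 / c + w / (c (c - w))] with [c = r e^(i t)].
    Dividing the density by [c] moves on to the next coefficient. *)
Lemma cauchy1_step (r : R) (h : R -> C) (w : C) :
  0 < r -> (forall t, pcont h t) -> Cmod w < r ->
  cauchy1 r h w = (cauchy1 r h 0 + w * cauchy1 r (fun t => h t * / (RtoC r * expi t)) w)%C.
Proof.
intros r0 hc Hw. assert (P := PI_RGT_0).
assert (H0 : Cmod 0 < r) by now rewrite Cmod_0.
assert (Nc : forall t, (RtoC r * expi t <> 0)%C) by apply (circ_neq r r0).
assert (Pc : forall t, pcont (fun t => / (RtoC r * expi t))%C t).
{ intros t. apply pcont_inv; [apply Nc|apply pcont_circ]. }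
assert (I1 : ex_RIntC (fun t => h t * / (RtoC r * expi t - 0))%C 0 (2 * PI)).
{ apply (ker_int h hc). intros t. now apply (ker_pcont r r0). }
assert (I2 : ex_RIntC (fun t => h t * / (RtoC r * expi t) * / (RtoC r * expi t - w))%C 0 (2 * PI)).
{ apply (ker_int (fun t => h t * / (RtoC r * expi t))%C).
  - intros t. now apply pcont_mult.
  - intros t. now apply (ker_pcont r r0). }
unfold cauchy1. rewrite <- RIntC_scal by exact I2.
assert (I3 : ex_RIntC (fun t => w * (h t * / (RtoC r * expi t) * / (RtoC r * expi t - w)))%C 0 (2 * PI)).
{ destruct I2 as [l Hl]. eexists. apply is_RIntC_scal. exact Hl. }
symmetry. etransitivity; [exact (eq_sym (RInt_plus (V := C_R_CompleteNormedModule) _ _ 0 (2 * PI) I1 I3))|].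
apply RIntC_ext; [lra|]. intros t _.
change (h t * / (RtoC r * expi t - 0) + w * (h t * / (RtoC r * expi t) * / (RtoC r * expi t - w)) = h t * / (RtoC r * expi t - w))%C.
assert (N := circ_minus_neq r r0 w t Hw). specialize (Nc t).
replace (RtoC r * expi t - 0)%C with (RtoC r * expi t)%C by ring.
set (c := (RtoC r * expi t)%C) in *. clearbody c. field. split; assumption.
Qed.

Section Holomorphic.

Variables (f df : C -> C) (o : C) (R0 : R).
Hypothesis R0_pos : 0 < R0.
Hypothesis Hf : forall z, disk o R0 z -> cderiv f z (df z).

(** Cauchy's formula is applied to the primitive of [f], whose derivative [f] is known to be
    continuous. Differentiating it twice under the integral expresses [df] through [cauchy3], which
    is continuous. *)
Lemma holo_C1 : ccont df o.
Proof.
set (r := R0 / 2). assert (r0 : 0 < r) by (unfold r; lra). assert (P := PI_RGT_0).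
assert (rR : r < R0) by (unfold r; lra).
set (F := seg_int f o).
assert (HF : forall z, disk o R0 z -> cderiv F z (f z)) by (intros z Hz; now apply (holo_primitive f df o R0)).
assert (fc : forall z, disk o R0 z -> ccont f z) by (intros z Hz; eapply cderiv_ccont; now apply Hf).
set (h := fun t => (RtoC r * expi t * F (o + RtoC r * expi t))%C).
assert (hc : forall t, pcont h t).
{ intros t. apply pcont_mult; [apply pcont_circ|].
  apply (ccont_pcont F (fun t => o + RtoC r * expi t)%C t).
  - apply pcont_plus; [apply pcont_const|apply pcont_circ].
  - eapply cderiv_ccont. apply HF. unfold disk.
    replace (o + RtoC r * expi t - o)%C with (RtoC r * expi t)%C by ring. rewrite (Cmod_circ r r0). exact rR. }
assert (EF : forall w, disk o r w -> (RtoC (2 * PI) * F w)%C = cauchy1 r h (w - o)).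
{ intros w Hw. apply (cauchy_formula r o r0 F f R0 w rR HF fc Hw). }
assert (P2 : RtoC (2 * PI) <> 0%C) by (intros E; apply RtoC_inj in E; lra).
assert (shift : forall g dg w, cderiv g (w - o)%C dg -> cderiv (fun z => g (z - o)%C) w dg).
{ intros g dg w H. assert (Q := cderiv_comp g (fun z => - o + 1 * z)%C w dg 1).
  rewrite Cmult_1_r in Q. replace (- o + 1 * w)%C with (w - o)%C in Q by ring.
  apply cderiv_ext_loc with (f := fun z => g (- o + 1 * z)%C) (d := 1); [lra| |].
  - intros z _. f_equal. ring.
  - apply Q; [apply cderiv_affine|exact H]. }
assert (inner : forall w, disk o r w -> exists d, 0 < d /\ forall y, Cmod (y - w) < d -> disk o r y).
{ intros w Hw. exists (r - Cmod (w - o)). unfold disk in *. split; [lra|]. intros y Hy.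
  eapply Rle_lt_trans; [apply (Cmod_tri3 y w o)|]. lra. }
assert (Ef : forall w, disk o r w -> (RtoC (2 * PI) * f w)%C = cauchy2 r h (w - o)).
{ intros w Hw. destruct (inner w Hw) as [d [d0 Hd]].
  apply (cderiv_unique (fun z => RtoC (2 * PI) * F z)%C w).
  - apply cderiv_scal. apply HF. unfold disk in *; lra.
  - apply cderiv_ext_loc with (f := fun z => cauchy1 r h (z - o)) (d := d); [exact d0| |].
    + intros y Hy. symmetry. now apply EF, Hd.
    + apply shift. now apply cauchy1_deriv. }
assert (Edf : forall w, disk o r w -> (RtoC (2 * PI) * df w)%C = (2 * cauchy3 r h (w - o))%C).
{ intros w Hw. destruct (inner w Hw) as [d [d0 Hd]].
  apply (cderiv_unique (fun z => RtoC (2 * PI) * f z)%C w).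
  - apply cderiv_scal. apply Hf. unfold disk in *; lra.
  - apply cderiv_ext_loc with (f := fun z => cauchy2 r h (z - o)) (d := d); [exact d0| |].
    + intros y Hy. symmetry. now apply Ef, Hd.
    + apply shift. now apply cauchy2_deriv. }
intros eps e0. assert (Oo : (o - o)%C = 0%C) by ring.
destruct (cauchy3_cont r h r0 hc 0%C ltac:(now rewrite Cmod_0) eps e0) as [d [d0 Hd]].
exists (Rmin d r). split; [now apply Rmin_pos|]. intros y Hy.
assert (y1 := lt_min_l _ _ _ Hy). assert (y2 := lt_min_r _ _ _ Hy).
assert (E1 := Edf y y2). assert (E2 := Edf o ltac:(unfold disk; now rewrite Oo, Cmod_0)). rewrite Oo in E2.
specialize (Hd (y - o)%C). replace (y - o - 0)%C with (y - o)%C in Hd by ring. specialize (Hd y1).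
assert (E3 : (RtoC PI * (df y - df o))%C = (cauchy3 r h (y - o) - cauchy3 r h 0)%C).
{ transitivity ((RtoC (2 * PI) * df y - RtoC (2 * PI) * df o) / 2)%C.
  - rewrite RtoC_mult. field.
  - rewrite E1, E2. field. }
rewrite <- E3, Cmod_mult, Cmod_R, Rabs_pos_eq in Hd by lra.
assert (1 < PI) by (generalize PI2_1; lra). generalize (Cmod_ge_0 (df y - df o)). nra.
Qed.

End Holomorphic.

(** * Critical points are isolated *)

Lemma cderiv_pow (n : nat) (z : C) : cderiv (fun w => w ^ S n)%C z (INR (S n) * z ^ n)%C.
Proof.
induction n as [|n IH].
- simpl. replace (1 * 1)%C with (RtoC 1) by ring. apply cderiv_ext_loc with (f := fun w => w) (d := 1); [lra| |apply cderiv_id].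
  intros y _. ring.
- apply cderiv_ext_loc with (f := fun w => (w * w ^ S n)%C) (d := 1); [lra|intros; reflexivity|].
  generalize (cderiv_mult _ _ z _ _ (cderiv_id z) IH).
  replace (1 * z ^ S n + z * (INR (S n) * z ^ n))%C with (INR (S (S n)) * z ^ S n)%C; [exact (fun H => H)|].
  rewrite (S_INR (S n)), RtoC_plus, Cpow_S. ring.
Qed.

Lemma ccont_mult (f g : C -> C) (z : C) : ccont f z -> ccont g z -> ccont (fun w => f w * g w)%C z.
Proof.
intros Hf Hg eps e0.
set (M := Cmod (f z) + Cmod (g z) + 1).
assert (P1 := Cmod_ge_0 (f z)). assert (P2 := Cmod_ge_0 (g z)).
set (e := Rmin 1 (eps / (2 * M))).
assert (M0 : 0 < M) by (unfold M; lra).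
assert (ee : 0 < e) by (apply Rmin_pos; [lra|apply Rdiv_lt_0_compat; lra]).
destruct (Hf e ee) as [d1 [d10 H1]]. destruct (Hg e ee) as [d2 [d20 H2]].
exists (Rmin d1 d2). split; [now apply Rmin_pos|]. intros y Hy.
specialize (H1 y (lt_min_l _ _ _ Hy)). specialize (H2 y (lt_min_r _ _ _ Hy)).
replace (f y * g y - f z * g z)%C with ((f y - f z) * (g y - g z) + ((f y - f z) * g z + f z * (g y - g z)))%C by ring.
eapply Rle_lt_trans; [apply Cmod_triangle|]. eapply Rle_lt_trans; [apply Rplus_le_compat_l, Cmod_triangle|].
rewrite !Cmod_mult.
assert (E1 : e <= 1) by apply Rmin_l. assert (E2 : e <= eps / (2 * M)) by apply Rmin_r.
assert (E3 : e * M <= eps / 2).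
{ apply Rle_trans with (eps / (2 * M) * M); [apply Rmult_le_compat_r; lra|right; field; lra]. }
assert (Q1 := Cmod_ge_0 (f y - f z)). assert (Q2 := Cmod_ge_0 (g y - g z)). unfold M in E3.
assert (Cmod (f y - f z) * Cmod (g y - g z) <= e * 1) by (apply Rmult_le_compat; lra).
assert (Cmod (f y - f z) * Cmod (g z) <= e * Cmod (g z)) by (apply Rmult_le_compat_r; lra).
assert (Cmod (f z) * Cmod (g y - g z) <= Cmod (f z) * e) by (apply Rmult_le_compat_l; lra).
lra.
Qed.

Lemma ccont_plus (f g : C -> C) (z : C) : ccont f z -> ccont g z -> ccont (fun w => f w + g w)%C z.
Proof.
intros Hf Hg eps e0. destruct (Hf (eps / 2)) as [d1 [d10 H1]]; [lra|].
destruct (Hg (eps / 2)) as [d2 [d20 H2]]; [lra|].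
exists (Rmin d1 d2). split; [now apply Rmin_pos|]. intros y Hy.
specialize (H1 y (lt_min_l _ _ _ Hy)). specialize (H2 y (lt_min_r _ _ _ Hy)).
replace (f y + g y - (f z + g z))%C with ((f y - f z) + (g y - g z))%C by ring.
eapply Rle_lt_trans; [apply Cmod_triangle|]. lra.
Qed.

Lemma ccont_neq_0 (f : C -> C) (z : C) :
  ccont f z -> f z <> 0%C -> exists d, 0 < d /\ forall y, Cmod (y - z) < d -> f y <> 0%C.
Proof.
intros Hf nz. destruct (Hf (Cmod (f z))) as [d [d0 Hd]]; [now apply Cmod_gt_0|].
exists d; split; [exact d0|]. intros y Hy E. specialize (Hd y Hy). rewrite E in Hd.
replace (0 - f z)%C with (- f z)%C in Hd by ring. rewrite Cmod_opp in Hd. lra.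
Qed.

(* The Taylor coefficients at [o] either all vanish from degree 1 on, or the first nonzero one dominates near [o]. *)
Theorem critical_point_dichotomy (f df : C -> C) (o : C) (R0 : R) :
  0 < R0 -> (forall z, disk o R0 z -> cderiv f z (df z)) ->
  (exists d, 0 < d /\ forall y, Cmod (y - o) < d -> f y = f o) \/
  (exists d, 0 < d /\ forall y, Cmod (y - o) < d -> y <> o -> df y <> 0%C).
Proof.
intros R0_pos Hf.
set (r := R0 / 2). assert (r0 : 0 < r) by (unfold r; lra). assert (P := PI_RGT_0).
assert (rR : r < R0) by (unfold r; lra).
assert (dfc : forall z, disk o R0 z -> ccont df z).
{ intros z Hz. unfold disk in Hz. apply (holo_C1 f df z (R0 - Cmod (z - o))); [lra|].
  intros y Hy. apply Hf. unfold disk in *. eapply Rle_lt_trans; [apply (Cmod_tri3 y z o)|]. lra. }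
assert (P2 : RtoC (2 * PI) <> 0%C) by (intros E; apply RtoC_inj in E; lra).
(* The density is divided by [r e^(i t)] once per step, so [c n] below is [2 pi] times the Taylor
   coefficient of degree [n]. *)
set (h := fix h n t := match n with O => (RtoC r * expi t * f (o + RtoC r * expi t))%C
  | S n => (h n t * / (RtoC r * expi t))%C end).
assert (hc : forall n t, pcont (h n) t).
{ induction n as [|n IH]; intros t.
  - apply pcont_mult; [apply pcont_circ|].
    apply (ccont_pcont f (fun t => o + RtoC r * expi t)%C t).
    + apply pcont_plus; [apply pcont_const|apply pcont_circ].
    + eapply cderiv_ccont. apply Hf. unfold disk.
      replace (o + RtoC r * expi t - o)%C with (RtoC r * expi t)%C by ring. rewrite (Cmod_circ r r0). exact rR.
  - apply (pcont_mult (h n) (fun t => / (RtoC r * expi t))%C); [apply IH|].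
    apply pcont_inv; [apply (circ_neq r r0)|apply pcont_circ]. }
set (c := fun n => cauchy1 r (h n) 0).
assert (E0 : forall w, Cmod w < r -> (RtoC (2 * PI) * f (o + w))%C = cauchy1 r (h 0%nat) w).
{ intros w Hw. assert (E := cauchy_formula r o r0 f df R0 (o + w) rR Hf dfc).
  replace (o + w - o)%C with w in E by ring. exact (E Hw). }
assert (St : forall n w, Cmod w < r -> cauchy1 r (h n) w = (c n + w * cauchy1 r (h (S n)) w)%C).
{ intros n w Hw. apply (cauchy1_step r (h n) w r0 (hc n) Hw). }
assert (Tay : forall n, (forall k, (1 <= k <= n)%nat -> c k = 0%C) -> forall w, Cmod w < r ->
  (RtoC (2 * PI) * f (o + w))%C = (c 0%nat + w ^ S n * cauchy1 r (h (S n)) w)%C).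
{ induction n as [|n IH]; intros Hz w Hw.
  - rewrite E0, St by exact Hw. simpl. ring.
  - rewrite IH by (try exact Hw; intros k Hk; apply Hz; lia).
    rewrite (St (S n) w Hw), (Hz (S n)) by lia. rewrite (Cpow_S w (S n)). ring. }
destruct (classic (exists n, c (S n) <> 0%C)) as [Ex|nEx].
- right.
  destruct (dec_inh_nat_subset_has_unique_least_element (fun n => c (S n) <> 0%C)) as [n [[Hn Hmin] _]];
    [intros; apply classic|exact Ex|].
  assert (T := Tay n). specialize (T ltac:(intros k Hk; destruct k as [|k]; [lia|]; apply NNPP; intros nz; specialize (Hmin k nz); lia)).
  set (S1 := cauchy1 r (h (S n))) in *. set (S2 := cauchy2 r (h (S n))).
  assert (D1 : forall w, Cmod w < r -> cderiv S1 w (S2 w)) by (intros w Hw; now apply cauchy1_deriv).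
  (* Differentiating [c 0 + w ^ S n * S1 w] exhibits [df] as [w ^ n] times a function that is
     continuous at [0] and nonzero there, because [S1 0] is the first nonzero coefficient. *)
  assert (Ed : forall w, Cmod w < r -> (RtoC (2 * PI) * df (o + w))%C = (w ^ n * (INR (S n) * S1 w + w * S2 w))%C).
  { intros w Hw. apply (cderiv_unique (fun w => RtoC (2 * PI) * f (o + w))%C w).
    - apply cderiv_scal.
      assert (Q := cderiv_comp f (fun z => o + 1 * z)%C w (df (o + w)%C) 1 (cderiv_affine o 1 w)).
      replace (o + 1 * w)%C with (o + w)%C in Q by ring. rewrite Cmult_1_r in Q.
      apply cderiv_ext_loc with (f := fun z => f (o + 1 * z)%C) (d := 1); [lra| |].
      + intros y _. f_equal. ring.
      + apply Q. replace (o + 1 * w)%C with (o + w)%C by ring. apply Hf. unfold disk. replace (o + w - o)%C with w by ring. lra.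
    - apply cderiv_ext_loc with (f := fun w => (c 0%nat + w ^ S n * S1 w)%C) (d := r - Cmod w); [lra| |].
      + intros y Hy. symmetry. apply T. assert (Q := Cmod_sub_le y w). lra.
      + replace (w ^ n * (INR (S n) * S1 w + w * S2 w))%C
          with (0 + (INR (S n) * w ^ n * S1 w + w ^ S n * S2 w))%C by (rewrite Cpow_S; ring).
        apply cderiv_plus; [apply cderiv_const|]. apply cderiv_mult; [apply cderiv_pow|now apply D1]. }
  assert (H0 : Cmod 0 < r) by now rewrite Cmod_0.
  destruct (ccont_neq_0 (fun w => INR (S n) * S1 w + w * S2 w)%C 0) as [d [d0 Hd]].
  + apply ccont_plus.
    * apply ccont_mult; [apply cderiv_ccont with (RtoC 0), cderiv_const|]. eapply cderiv_ccont. now apply D1.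
    * apply ccont_mult; [eapply cderiv_ccont, cderiv_id|]. eapply cderiv_ccont. apply cauchy2_deriv; [exact r0|apply hc|exact H0].
  + rewrite Cmult_0_l, Cplus_0_r. apply Cmult_neq_0; [|exact Hn].
    intros E. apply RtoC_inj in E. revert E. apply not_0_INR. lia.
  + exists (Rmin d r). split; [now apply Rmin_pos|]. intros y Hy ne E.
    assert (y1 := lt_min_l _ _ _ Hy). assert (y2 := lt_min_r _ _ _ Hy).
    specialize (Ed (y - o)%C y2). replace (o + (y - o))%C with y in Ed by ring. rewrite E, Cmult_0_r in Ed.
    symmetry in Ed. revert Ed. apply Cmult_neq_0.
    * apply Cpow_nz. intros Z. apply ne. replace y with (y - o + o)%C by ring. rewrite Z. ring.
    * apply Hd. replace (y - o - 0)%C with (y - o)%C by ring. exact y1.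
- left. exists (r / 2). split; [lra|].
  assert (Tz : forall n w, Cmod w < r -> (RtoC (2 * PI) * f (o + w))%C = (c 0%nat + w ^ S n * cauchy1 r (h (S n)) w)%C).
  { intros n. apply Tay. intros k Hk. destruct k as [|k]; [lia|]. apply NNPP; intros nz. apply nEx. now exists k. }
  destruct (pcont_bounded (h 0%nat) 0 (2 * PI)) as [M [M0 HM]]; [intros t _; apply hc|].
  assert (Bd : forall n t, 0 <= t <= 2 * PI -> Cmod (h n t) <= M * (/ r) ^ n).
  { induction n as [|n IH]; intros t Ht.
    - rewrite Rmult_1_r. now apply HM.
    - change (h (S n) t) with (h n t * / (RtoC r * expi t))%C. rewrite Cmod_mult, Cmod_inv by apply (circ_neq r r0).
      rewrite (Cmod_circ r r0). simpl. specialize (IH t Ht).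
      assert (0 < / r) by now apply Rinv_0_lt_compat. nra. }
  (* When all coefficients vanish, the remainder after [n] steps is at most [K (|w| / r)^(n + 1)],
     which tends to zero for [|w| < r / 2]. *)
  assert (Fz : forall w, Cmod w < r / 2 -> (RtoC (2 * PI) * f (o + w))%C = c 0%nat).
  { intros w Hw. apply Cmod_sub_eq_0. apply le_epsilon. intros eps e0.
    set (K := 2 * PI * (M * / (r / 2))).
    destruct (half_pow_small K eps e0) as [n Hn].
    rewrite (Tz n w ltac:(lra)). replace (c 0%nat + w ^ S n * cauchy1 r (h (S n)) w - c 0%nat)%C
      with (w ^ S n * cauchy1 r (h (S n)) w)%C by ring.
    rewrite Cmod_mult, Cmod_pow.
    assert (B1 := cauchy1_bound r (h (S n)) r0 (hc (S n)) (M * (/ r) ^ S n) w ltac:(lra) (Bd (S n))).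
    assert (ir : 0 < / r) by now apply Rinv_0_lt_compat.
    assert (W0 := Cmod_ge_0 w).
    assert (B2 : 2 * PI * (M * (/ r) ^ S n * / (r - Cmod w)) <= K * (/ r) ^ S n).
    { unfold K. replace (2 * PI * (M * / (r / 2)) * (/ r) ^ S n) with (2 * PI * (M * (/ r) ^ S n * / (r / 2))) by ring.
      apply Rmult_le_compat_l; [lra|]. apply Rmult_le_compat_l.
      - apply Rmult_le_pos; [lra|]. apply pow_le; lra.
      - apply Rinv_le_contravar; lra. }
    assert (K0 : 0 < K).
    { unfold K. apply Rmult_lt_0_compat; [lra|]. apply Rmult_lt_0_compat; [lra|]. apply Rinv_0_lt_compat; lra. }
    apply Rle_trans with (Cmod w ^ S n * (K * (/ r) ^ S n)).
    { apply Rmult_le_compat_l; [now apply pow_le|lra]. }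
    apply Rle_trans with (K * (Cmod w * / r) ^ S n).
    { right. rewrite Rpow_mult_distr. ring. }
    assert (q : Cmod w * / r <= / 2).
    { apply Rle_trans with (r / 2 * / r); [apply Rmult_le_compat_r; lra|right; field; lra]. }
    assert (q0 : 0 <= Cmod w * / r) by (apply Rmult_le_pos; lra).
    assert ((Cmod w * / r) ^ S n <= (/ 2) ^ S n) by (apply pow_incr; lra).
    assert ((/ 2) ^ S n <= (/ 2) ^ n) by (simpl; generalize (half_pow_pos n); lra).
    apply Rle_trans with (K * (/ 2) ^ n); [apply Rmult_le_compat_l; lra|lra]. }
  intros y Hy. assert (E1 := Fz (y - o)%C Hy). replace (o + (y - o))%C with y in E1 by ring.
  assert (E2 := Fz 0%C ltac:(rewrite Cmod_0; lra)). rewrite Cplus_0_r in E2. rewrite <- E2 in E1.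
  apply (f_equal (fun z => / RtoC (2 * PI) * z)%C) in E1. rewrite !Cmult_assoc, Cinv_l, !Cmult_1_l in E1 by exact P2.
  exact E1.
Qed.

(** * Local inverses and local area estimates *)

(** Newton's iteration with the derivative frozen at [a]: where [df] stays within [|a| / 2] of [a],
    the map [T] contracts by [/ 2]. The same estimate bounds [|x - y|] by [2 / |a|] times
    [|f x - f y|]. *)
Lemma local_inverse (f df : C -> C) (z0 : C) (r : R) :
  0 < r -> (forall z, disk z0 r z -> cderiv f z (df z)) -> df z0 <> 0%C ->
  exists (rho sigma K : R) (inv : C -> C), 0 < rho <= r /\ 0 < sigma /\ 0 < K /\
    (forall w, Cmod (w - f z0) < sigma -> disk z0 rho (inv w) /\ f (inv w) = w) /\
    (forall x y, disk z0 rho x -> disk z0 rho y -> Cmod (x - y) <= K * Cmod (f x - f y)).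
Proof.
intros r0 Hf nz. set (a := df z0) in *. assert (a0 : 0 < Cmod a) by now apply Cmod_gt_0.
destruct (holo_C1 f df z0 r r0 Hf (Cmod a / 2)) as [d [d0 Hd]]; [lra|].
set (rho := Rmin r d). assert (rho0 : 0 < rho) by now apply Rmin_pos.
assert (MV : forall x y, disk z0 rho x -> disk z0 rho y -> Cmod (f y - f x - a * (y - x)) <= Cmod a / 2 * Cmod (y - x)).
{ apply (holo_mean_value f df).
  - intros z Hz. apply Hf. exact (lt_min_l _ _ _ Hz).
  - intros z Hz. apply Rlt_le, Hd. exact (lt_min_r _ _ _ Hz). }
(* The first Newton step is then below [rho / 8], and all iterates, within twice that of [z0], stay
   where the contraction estimate holds. *)
set (sigma := Cmod a * rho / 8).
assert (s0 : 0 < sigma) by (unfold sigma; nra).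
assert (Hz0 : disk z0 rho z0) by (unfold disk; now rewrite Cmod_sub_diag).
assert (Ex : forall w, exists l, Cmod (w - f z0) < sigma -> disk z0 rho l /\ f l = w).
{ intros w. destruct (Rlt_le_dec (Cmod (w - f z0)) sigma) as [Hw|Hw].
  2:{ exists 0%C. lra. }
  set (T := fun z => (z - (f z - w) / a)%C).
  set (u := fix u n := match n with O => z0 | S n => T (u n) end).
  set (K := Cmod (w - f z0) / Cmod a).
  assert (Kb : K < rho / 8).
  { unfold K. apply Rmult_lt_reg_r with (Cmod a); [exact a0|]. unfold Rdiv at 1. rewrite Rmult_assoc, Rinv_l by lra.
    unfold sigma in Hw. lra. }
  assert (K0 : 0 <= K) by (unfold K; apply Rdiv_le_0_compat; [apply Cmod_ge_0|exact a0]).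
  assert (Lip : forall x y, disk z0 rho x -> disk z0 rho y -> Cmod (T y - T x) <= / 2 * Cmod (y - x)).
  { intros x y Hx Hy. replace (T y - T x)%C with (- ((f y - f x - a * (y - x)) / a))%C by (unfold T; field; exact nz).
    rewrite Cmod_opp, Cmod_div by exact nz. specialize (MV x y Hx Hy).
    apply Rle_div_l; [exact a0|]. lra. }
  assert (I : forall n, Cmod (u n - z0) <= 2 * K * (1 - (/ 2) ^ n) /\ Cmod (u (S n) - u n) <= K * (/ 2) ^ n).
  { induction n as [|n [I1 I2]].
    - simpl. split; [rewrite Cmod_sub_diag; lra|].
      unfold T. replace (z0 - (f z0 - w) / a - z0)%C with ((w - f z0) / a)%C by (field; exact nz).
      rewrite Cmod_div by exact nz. unfold K. lra.
    - assert (P := half_pow_pos n).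
      assert (J : Cmod (u (S n) - z0) <= 2 * K * (1 - (/ 2) ^ S n)).
      { eapply Rle_trans; [apply (Cmod_tri3 _ (u n))|]. simpl pow. lra. }
      split; [exact J|].
      change (u (S (S n))) with (T (u (S n))). change (u (S n)) with (T (u n)) at 2.
      eapply Rle_trans; [apply Lip|].
      + unfold disk. nra.
      + unfold disk. assert (Q := half_pow_pos (S n)). nra.
      + simpl pow. lra. }
  destruct (geometric_limit u K) as [l Hl]; [intros n; apply I|].
  assert (Hlr : disk z0 rho l).
  { unfold disk. destruct (half_pow_small (4 * K) (rho / 2)) as [n Hn]; [lra|].
    specialize (Hl n). destruct (I n) as [I1 _]. assert (P := half_pow_pos n).
    eapply Rle_lt_trans; [apply (Cmod_tri3 l (u n) z0)|]. rewrite Cmod_sub_sym. nra. }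
  exists l. intros _. split; [exact Hlr|]. apply Cmod_sub_eq_0. apply le_epsilon. intros eps e0.
  (* [7 = 4 * 3 / 2 + 1]: the distance [4 K h] to the limit times the Lipschitz constant
     [3 / 2 |a|], plus [|a|] times one more Newton step, where [h = (/ 2) ^ n]. *)
  destruct (half_pow_small (7 * K * Cmod a) eps e0) as [n Hn]. assert (P := half_pow_pos n).
  specialize (Hl n). destruct (I n) as [I1 I2].
  assert (Hun : disk z0 rho (u n)) by (unfold disk; nra).
  assert (E1 : Cmod (f (u n) - w) = Cmod a * Cmod (u (S n) - u n)).
  { change (u (S n)) with (T (u n)). unfold T. rewrite <- Cmod_mult.
    replace (a * (u n - (f (u n) - w) / a - u n))%C with (- (f (u n) - w))%C by (field; exact nz).
    now rewrite Cmod_opp. }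
  assert (E2 : Cmod (f l - f (u n)) <= 3 / 2 * Cmod a * Cmod (u n - l)).
  { specialize (MV (u n) l Hun Hlr).
    assert (Q := Cmod_triangle (f l - f (u n) - a * (l - u n)) (a * (l - u n))).
    replace (f l - f (u n) - a * (l - u n) + a * (l - u n))%C with (f l - f (u n))%C in Q by ring.
    rewrite Cmod_mult in Q. rewrite (Cmod_sub_sym (u n)). lra. }
  eapply Rle_trans; [apply (Cmod_tri3 (f l) (f (u n)) w)|]. rewrite E1.
  assert (Cmod a * Cmod (u (S n) - u n) <= Cmod a * (K * (/ 2) ^ n)) by (apply Rmult_le_compat_l; lra).
  assert (Cmod a * Cmod (u n - l) <= Cmod a * (4 * K * (/ 2) ^ n)) by (apply Rmult_le_compat_l; lra).
  nra. }
destruct (functional_choice _ Ex) as [inv Hinv].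
exists rho, sigma, (2 / Cmod a), inv.
repeat split; [exact rho0|apply Rmin_l|exact s0|apply Rdiv_lt_0_compat; lra|now apply Hinv|now apply Hinv|].
intros x y Hx Hy. specialize (MV y x Hy Hx).
assert (Q := Cmod_sub_le (a * (x - y)) (a * (x - y) - (f x - f y))).
replace (a * (x - y) - (a * (x - y) - (f x - f y)))%C with (f x - f y)%C in Q by ring.
replace (a * (x - y) - (f x - f y))%C with (- (f x - f y - a * (x - y)))%C in Q by ring.
rewrite Cmod_opp, Cmod_mult in Q.
apply Rmult_le_reg_l with (Cmod a / 2); [lra|].
replace (Cmod a / 2 * (2 / Cmod a * Cmod (f x - f y))) with (Cmod (f x - f y)) by (field; lra). lra.
Qed.

(** This is [d log F = a d log z] with [a = p F'(p) / F(p)], written with quotients so that no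
    branch of the logarithm is chosen. The base point [x] ranges over a whole neighbourhood of [p],
    as the later compactness argument requires. *)
Lemma first_order_log (F dF : C -> C) (p : C) (r kap : R) :
  0 < r -> 0 < kap -> (forall z, disk p r z -> cderiv F z (dF z)) -> F p <> 0%C -> p <> 0%C ->
  exists d, 0 < d <= r /\ forall x y, disk p d x -> disk p d y -> F x <> 0%C /\ x <> 0%C /\
    Cmod (y / x - 1) <= kap /\
    Cmod (F y / F x - 1 - (p * dF p / F p) * (y / x - 1)) <= kap * Cmod (y / x - 1).
Proof.
intros r0 k0 HF nF np.
assert (cF : ccont F p).
{ eapply cderiv_ccont, HF. unfold disk. now rewrite Cmod_sub_diag. }
destruct (ccont_neq_0 F p cF nF) as [d1 [d10 H1]].
assert (cg : ccont (fun z => z / F z)%C p).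
{ eapply cderiv_ccont. apply cderiv_div; [exact nF|apply cderiv_id|].
  apply HF. unfold disk. now rewrite Cmod_sub_diag. }
set (A := Cmod (p / F p) + 1). assert (A0 : 0 < A) by (unfold A; generalize (Cmod_ge_0 (p / F p)); lra).
set (D := Cmod (dF p) + 1). assert (D0 : 0 < D) by (unfold D; generalize (Cmod_ge_0 (dF p)); lra).
destruct (cg (Rmin 1 (kap / 2 / D))) as [d2 [d20 H2]].
{ apply Rmin_pos; [lra|]. apply Rdiv_lt_0_compat; lra. }
destruct (holo_C1 F dF p r r0 HF (kap / 2 / A)) as [d3 [d30 H3]]; [apply Rdiv_lt_0_compat; lra|].
assert (p0 : 0 < Cmod p) by now apply Cmod_gt_0.
set (d4 := Rmin (Cmod p / 2) (kap * Cmod p / 4)).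
assert (d40 : 0 < d4) by (apply Rmin_pos; nra).
set (d := Rmin (Rmin r d1) (Rmin d2 (Rmin d3 d4))).
assert (M1 : d <= r) by (eapply Rle_trans; [apply Rmin_l|apply Rmin_l]).
assert (M2 : d <= d1) by (eapply Rle_trans; [apply Rmin_l|apply Rmin_r]).
assert (M3 : d <= d2) by (eapply Rle_trans; [apply Rmin_r|apply Rmin_l]).
assert (M4 : d <= d3) by (eapply Rle_trans; [apply Rmin_r|]; eapply Rle_trans; [apply Rmin_r|apply Rmin_l]).
assert (M5 : d <= d4) by (eapply Rle_trans; [apply Rmin_r|]; eapply Rle_trans; [apply Rmin_r|apply Rmin_r]).
assert (M6 : d4 <= Cmod p / 2) by apply Rmin_l. assert (M7 : d4 <= kap * Cmod p / 4) by apply Rmin_r.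
clearbody d4. exists d. split; [split; [repeat apply Rmin_pos; assumption|exact M1]|].
intros x y Hx Hy. unfold disk in Hx, Hy.
assert (nx : F x <> 0%C) by (apply H1; lra).
assert (x2 : Cmod p / 2 <= Cmod x).
{ assert (Q := Cmod_sub_le p x). rewrite Cmod_sub_sym in Q. lra. }
assert (nx0 : x <> 0%C) by (apply Cmod_gt_0; lra).
assert (E0 : (y / x - 1)%C = ((y - x) / x)%C) by (field; exact nx0).
assert (Nyx : Cmod (y - x) <= 2 * d).
{ eapply Rle_trans; [apply (Cmod_tri3 y p x)|]. rewrite (Cmod_sub_sym p x). lra. }
split; [exact nx|]. split; [exact nx0|]. split.
- rewrite E0, Cmod_div by exact nx0.
  apply Rle_div_l; [lra|]. nra.
- assert (MV : Cmod (F y - F x - dF p * (y - x)) <= kap / 2 / A * Cmod (y - x)).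
  { apply (holo_mean_value F dF p (dF p) d).
    - intros z Hz. apply HF. unfold disk in *; lra.
    - intros z Hz. apply Rlt_le, H3. unfold disk in Hz; lra.
    - exact Hx.
    - exact Hy. }
  replace (F y / F x - 1 - p * dF p / F p * (y / x - 1))%C
    with (x / F x * ((F y - F x - dF p * (y - x)) / x) + dF p * (x / F x - p / F p) * ((y - x) / x))%C
    by (field; auto).
  rewrite E0. set (q := Cmod ((y - x) / x)).
  assert (G := H2 x ltac:(lra)).
  assert (G1 : Cmod (x / F x) <= A).
  { unfold A. assert (Q := Cmod_sub_le (x / F x) (p / F p)). assert (Z := Rmin_l 1 (kap / 2 / D)). lra. }
  assert (G2 : Cmod (x / F x - p / F p) <= kap / 2 / D) by (assert (Z := Rmin_r 1 (kap / 2 / D)); lra).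
  assert (q0 : 0 <= q) by apply Cmod_ge_0.
  eapply Rle_trans; [apply Cmod_triangle|]. rewrite !Cmod_mult. fold q.
  assert (B1 : Cmod ((F y - F x - dF p * (y - x)) / x) <= kap / 2 / A * q).
  { unfold q. rewrite !Cmod_div by exact nx0. unfold Rdiv at 1 4. rewrite <- Rmult_assoc.
    apply Rmult_le_compat_r; [|exact MV]. apply Rlt_le, Rinv_0_lt_compat; lra. }
  assert (B2 : Cmod (x / F x) * Cmod ((F y - F x - dF p * (y - x)) / x) <= A * (kap / 2 / A * q)).
  { apply Rmult_le_compat; [apply Cmod_ge_0|apply Cmod_ge_0|exact G1|exact B1]. }
  assert (B3 : Cmod (dF p) * Cmod (x / F x - p / F p) <= D * (kap / 2 / D)).
  { apply Rmult_le_compat; [apply Cmod_ge_0|apply Cmod_ge_0|unfold D; lra|exact G2]. }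
  replace (A * (kap / 2 / A * q)) with (kap / 2 * q) in B2 by (field; lra).
  replace (D * (kap / 2 / D)) with (kap / 2) in B3 by (field; lra). nra.
Qed.

Lemma Cmod_one_plus (x : C) : Cmod (1 + x) <= 1 + fst x + Cmod x * Cmod x / 2.
Proof.
assert (E : Cmod (1 + x) * Cmod (1 + x) = 1 + 2 * fst x + Cmod x * Cmod x).
{ assert (H1 := Cmod2_alt (1 + x)%C). assert (H2 := Cmod2_alt x). unfold Re, Im in *. simpl in *.
  rewrite !Rmult_1_r in H1, H2. rewrite H1, H2. ring. }
generalize (Rle_0_sqr (Cmod (1 + x) - 1)). unfold Rsqr. intros. lra.
Qed.

Lemma exp_ge_1_plus (x : R) : 1 + x <= exp x.
Proof.
destruct (Req_dec x 0) as [->|n]; [rewrite exp_0; lra|]. apply Rlt_le, exp_ineq1, n.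
Qed.

Lemma exp_minus_1_le (h : R) : exp h - 1 <= exp h * h.
Proof.
assert (H := exp_ge_1_plus (- h)). assert (P := exp_pos h).
assert (E : exp h * exp (- h) = 1) by (rewrite <- exp_plus, Rplus_opp_r; apply exp_0). nra.
Qed.

Lemma atan_le_self (x : R) : 0 < x -> 0 < atan x <= x.
Proof.
intros x0. split; [rewrite <- atan_0; now apply atan_increasing|].
destruct (MVT_gen atan 0 x (fun c => / (1 + c ^ 2))) as [c [_ Hc]].
- intros c _. apply is_derive_Reals. apply derivable_pt_lim_atan.
- intros c _. apply derivable_continuous_pt. exists (/ (1 + c ^ 2)). apply derivable_pt_lim_atan.
- rewrite atan_0, !Rminus_0_r in Hc. rewrite Hc.
  assert (Q : 1 <= 1 + c ^ 2) by (generalize (pow2_ge_0 c); lra).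
  assert (/ (1 + c ^ 2) <= 1) by (rewrite <- Rinv_1; apply Rinv_le_contravar; lra). nra.
Qed.

Lemma polar_right_half (k : C) : 0 < fst k -> k = (RtoC (Cmod k) * expi (atan (snd k / fst k)))%C.
Proof.
intros x0. destruct k as [x y]; simpl in *.
assert (Ec : Cmod (x, y) = x * sqrt (1 + (y / x)²)).
{ unfold Cmod; simpl. rewrite <- (sqrt_square x) at 3 by lra. rewrite <- sqrt_mult_alt by nra.
  f_equal. unfold Rsqr. field. lra. }
assert (S0 : sqrt (1 + (y / x)²) <> 0).
{ apply Rgt_not_eq, sqrt_lt_R0. generalize (Rle_0_sqr (y / x)). lra. }
unfold expi. rewrite cos_atan, sin_atan, Ec.
unfold RtoC, Cmult; simpl. f_equal; field; split; try exact S0; lra.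
Qed.

(** [a] stands for the derivative of [log F] in [log z]; [q] and [exp h] are the ratios of two
    points on a lift and of their images, [mu] is an angle along a circle. With [u = Re a], to first
    order [D = h u / |a|^2 <= h / u], and turning by [mu] changes the argument of [F] by [u mu]. So
    [lam] just below [1 / u] keeps this change under [eta], and [2 - lam <= h / D] up to [eps] is
    the inequality [u + 1 / u >= 2]. *)
Lemma tube_numeric (a : C) (eps : R) : a <> 0%C -> 0 < eps ->
  exists kap lam, 0 < kap <= 1 /\ 0 <= lam /\
   (forall (q : C) (D h : R), 0 < D -> 0 < h -> Cmod q = exp D -> Cmod (q - 1) <= kap ->
      Cmod (RtoC (exp h) - 1 - a * (q - 1)) <= kap * Cmod (q - 1) -> (2 - lam - eps) * D <= h) /\
   (forall (k : C) (mu eta : R), 0 < mu < lam * eta -> mu <= kap ->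
      Cmod (k - 1 - a * (expi mu - 1)) <= kap * Cmod (expi mu - 1) ->
      exists rho theta, 0 < rho /\ 0 < theta < eta /\ k = (RtoC rho * expi theta)%C).
Proof.
intros na e0. set (m := Cmod a). assert (m0 : 0 < m) by now apply Cmod_gt_0.
set (u := fst a). assert (um : Rabs u <= m) by apply re_le_Cmod. apply Rabs_le_between in um.
(* For [N = |q - 1| <= kap], the error in [D] is at most [kap N (/ m + / 2)], the second term coming
   from [N^2 / 2]; moreover [N <= 2 (exp h - 1) / m]. The product of these is
   [kap c (exp h - 1)]. *)
set (c := (/ m + / 2) * 2 / m).
assert (im : 0 < / m) by now apply Rinv_0_lt_compat.
assert (c0 : 0 < c) by (unfold c, Rdiv; repeat apply Rmult_lt_0_compat; lra).
(* [h W] bounds [D], with [W = (1 + (m + 1) kap) (u / m^2 + kap c)]. *)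
assert (Main : forall kap (q : C) (D h : R), 0 < kap <= 1 -> kap <= m / 2 -> 0 < D -> 0 < h -> Cmod q = exp D ->
  Cmod (q - 1) <= kap -> Cmod (RtoC (exp h) - 1 - a * (q - 1)) <= kap * Cmod (q - 1) ->
  0 < u / (m * m) + kap * c /\ D <= (1 + (m + 1) * kap) * h * (u / (m * m) + kap * c)).
{ intros kap q D h kk km D0 h0 Hq Nk HE.
  set (N := Cmod (q - 1)) in *. set (E := (RtoC (exp h) - 1 - a * (q - 1))%C) in *.
  assert (N0 : 0 <= N) by apply Cmod_ge_0.
  set (K := exp h - 1). assert (K0 : 0 < K) by (unfold K; generalize (exp_ge_1_plus h); lra).
  assert (EK : (a * (q - 1))%C = (RtoC K - E)%C) by (unfold E, K; rewrite RtoC_minus; ring).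
  assert (NK : m * N <= K + kap * N).
  { unfold m, N. rewrite <- Cmod_mult, EK. eapply Rle_trans; [apply Cmod_le_sub|].
    rewrite Cmod_R, Rabs_pos_eq by lra. fold N. lra. }
  assert (KN : K <= (m + kap) * N).
  { assert (T := Cmod_le_sub (a * (q - 1)) (- E)).
    replace (a * (q - 1) - - E)%C with (RtoC K) in T by (rewrite EK; ring).
    rewrite Cmod_opp, Cmod_R, Cmod_mult, Rabs_pos_eq in T by lra. fold m N in T. lra. }
  assert (N2 : N <= 2 * K / m).
  { apply Rle_div_r; [exact m0|]. nra. }
  assert (Re1 : fst (q - 1)%C <= K * (u / (m * m)) + kap * N / m).
  { assert (Eq : (q - 1)%C = (RtoC K * / a - E / a)%C).
    { transitivity (a * (q - 1) / a)%C; [field; exact na|]. rewrite EK. field. exact na. }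
    rewrite Eq.
    assert (F1 : fst (RtoC K * / a)%C = K * (u / (m * m))).
    { assert (H2 := Cmod2_alt a). unfold Re, Im in H2. fold m u in H2. simpl in H2. rewrite !Rmult_1_r in H2.
      unfold Cinv, Cmult, RtoC; simpl. fold u. rewrite !Rmult_1_r, <- H2. ring. }
    change (fst (RtoC K * / a - E / a)%C) with (fst (RtoC K * / a)%C - fst (E / a)%C). rewrite F1.
    assert (F2 := re_le_Cmod (E / a)). apply Rabs_le_between in F2. unfold Re in F2.
    rewrite Cmod_div in F2 by exact na. fold m in F2.
    assert (Cmod E / m <= kap * N / m) by (unfold Rdiv; apply Rmult_le_compat_r; lra). lra. }
  assert (DK : D <= K * (u / (m * m) + kap * c)).
  { assert (H1 := exp_ge_1_plus D). rewrite <- Hq in H1.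
    assert (H2 := Cmod_one_plus (q - 1)). replace (1 + (q - 1))%C with q in H2 by ring. fold N in H2.
    assert (H3 : N * N <= kap * N) by (apply Rmult_le_compat_r; lra).
    assert (H4 : kap * N * (/ m + / 2) <= kap * (2 * K / m) * (/ m + / 2)).
    { apply Rmult_le_compat_r; [lra|]. apply Rmult_le_compat_l; lra. }
    replace (kap * (2 * K / m) * (/ m + / 2)) with (K * (kap * c)) in H4 by (unfold c; field; lra).
    unfold Rdiv in *. lra. }
  assert (f0 : 0 < u / (m * m) + kap * c) by nra.
  split; [exact f0|]. apply Rle_trans with (1 := DK). apply Rmult_le_compat_r; [lra|].
  assert (H1 := exp_minus_1_le h). fold K in H1. replace (exp h) with (1 + K) in H1 by (unfold K; ring).
  assert (K <= (m + 1) * kap) by nra. nra. }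
(* If [u < m^2 / 4], the lift gains little radius, [D <= h / 2], and [lam = 0] suffices. Otherwise
   [u > 0] and [lam] is [1 / u - eps / 2], cut off at [0]. *)
destruct (Rle_lt_dec (m * m / 4) u) as [Hu|Hu].
- assert (mm : 0 < m * m) by nra. assert (u0 : 0 < u) by lra.
  set (v := / u). assert (v0 : 0 < v) by now apply Rinv_0_lt_compat.
  assert (uv : u * v = 1) by (unfold v; field; lra).
  assert (Huv : u / (m * m) <= v).
  { apply Rle_div_l; [exact mm|]. nra. }
  set (e2 := eps * v / 4). assert (e20 : 0 < e2) by (unfold e2; nra).
  set (b1 := (m + 1) * v + c + (m + 1) * c). assert (b10 : 0 < b1) by (unfold b1; nra).
  set (b2 := (m + 2) * v + 2 * m + 2). assert (b20 : 0 < b2) by (unfold b2; nra).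
  set (kap0 := Rmin (Rmin 1 (m / 2)) (Rmin (e2 / b1) (Rmin (eps * u / 2 / b2) (Rmin (u / (2 * (m + 2))) (/ (4 * (m + 1))))))).
  assert (k1 : kap0 <= 1) by (eapply Rle_trans; [apply Rmin_l|apply Rmin_l]).
  assert (k2 : kap0 <= m / 2) by (eapply Rle_trans; [apply Rmin_l|apply Rmin_r]).
  assert (k3 : kap0 <= e2 / b1) by (eapply Rle_trans; [apply Rmin_r|apply Rmin_l]).
  assert (k4 : kap0 <= eps * u / 2 / b2) by (do 2 (eapply Rle_trans; [apply Rmin_r|]); apply Rmin_l).
  assert (k5 : kap0 <= u / (2 * (m + 2))) by (do 3 (eapply Rle_trans; [apply Rmin_r|]); apply Rmin_l).
  assert (k6 : kap0 <= / (4 * (m + 1))) by (do 3 (eapply Rle_trans; [apply Rmin_r|]); apply Rmin_r).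
  assert (k0 : 0 < kap0).
  { unfold kap0. repeat apply Rmin_pos; try lra; try (apply Rdiv_lt_0_compat; nra). apply Rinv_0_lt_compat; nra. }
  clearbody kap0.
  assert (De := proj2 (is_derive_C_R expi 0 _) (is_derive_expi 0)).
  destruct (De kap0 k0) as [d [d0 Hd]]. clear De.
  set (kap := Rmin kap0 (d / 2)). assert (kp : 0 < kap) by (apply Rmin_pos; lra).
  assert (kk : kap <= kap0) by apply Rmin_l. assert (kd : kap <= d / 2) by apply Rmin_r. clearbody kap.
  exists kap, (Rmax 0 (v - eps / 2)).
  assert (L0 := Rmax_l 0 (v - eps / 2)). assert (L1 := Rmax_r 0 (v - eps / 2)).
  repeat split; [exact kp|lra|exact L0| |].
  + intros q D h D0 h0 Hq Nk HE.
    destruct (Main kap q D h ltac:(lra) ltac:(lra) D0 h0 Hq Nk HE) as [f0 HD].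
    set (W := (1 + (m + 1) * kap) * (u / (m * m) + kap * c)).
    assert (HW : W <= v + e2).
    { apply Rle_trans with ((1 + (m + 1) * kap) * (v + kap * c)).
      - apply Rmult_le_compat_l; [nra|lra].
      - assert (kap * b1 <= e2).
        { apply Rle_trans with (e2 / b1 * b1); [apply Rmult_le_compat_r; lra|right; field; lra]. }
        unfold b1 in H. assert (0 <= (m + 1) * c) by nra. assert (kap * kap <= kap * 1) by (apply Rmult_le_compat_l; lra). nra. }
    assert (DW : D <= W * h) by (unfold W; lra).
    destruct (Rle_lt_dec (2 - v - eps / 2) 0) as [Hc|Hc]; [nra|].
    apply Rle_trans with ((2 - v - eps / 2) * D); [apply Rmult_le_compat_r; lra|].
    apply Rle_trans with ((2 - v - eps / 2) * ((v + e2) * h)); [apply Rmult_le_compat_l; [lra|nra]|].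
    assert ((2 - v - eps / 2) * (v + e2) <= 1).
    { assert ((2 - v - eps / 2) * e2 <= 2 * e2) by (apply Rmult_le_compat_r; lra).
      assert (0 <= (1 - v) * (1 - v)) by apply Rle_0_sqr. unfold e2 in *. nra. }
    nra.
  + intros k mu eta [mu0 Hmu] muk HE.
    assert (lamE : Rmax 0 (v - eps / 2) = v - eps / 2).
    { apply Rmax_right. destruct (Rle_lt_dec 0 (v - eps / 2)) as [P|P]; [exact P|].
      rewrite Rmax_left in Hmu by lra. lra. }
    rewrite lamE in *.
    specialize (Hd mu). rewrite Rminus_0_r, Rabs_pos_eq in Hd by lra. specialize (Hd ltac:(lra)).
    rewrite expi_0, Cmult_1_r in Hd.
    set (E := (expi mu - 1 - RtoC mu * Ci)%C) in *.
    assert (Nq : Cmod (expi mu - 1) <= 2 * mu).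
    { replace (expi mu - 1)%C with (E + RtoC mu * Ci)%C by (unfold E; ring).
      eapply Rle_trans; [apply Cmod_triangle|]. rewrite Cmod_mult, Cmod_Ci, Cmod_R, Rabs_pos_eq by lra. nra. }
    set (G := (k - 1 - RtoC mu * (Ci * a))%C).
    assert (HG : Cmod G <= (m + 2) * kap0 * mu).
    { replace G with ((k - 1 - a * (expi mu - 1)) + a * E)%C by (unfold G, E; ring).
      eapply Rle_trans; [apply Cmod_triangle|]. rewrite Cmod_mult. fold m.
      assert (m * Cmod E <= m * (kap0 * mu)) by (apply Rmult_le_compat_l; lra).
      assert (kap * Cmod (expi mu - 1) <= kap0 * (2 * mu)) by (apply Rmult_le_compat; [lra|apply Cmod_ge_0|lra|lra]). lra. }
    assert (Gr := re_le_Cmod G). assert (Gi := Rle_trans _ _ _ (Rmax_r _ _) (Rmax_Cmod G)).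
    apply Rabs_le_between in Gr. apply Rabs_le_between in Gi. unfold Re in Gr.
    assert (Rk : fst k = 1 - mu * snd a + fst G) by (unfold G, Ci; simpl; ring).
    assert (Ik : snd k = mu * u + snd G) by (unfold G, Ci, u; simpl; ring).
    assert (sa : snd a <= m).
    { eapply Rle_trans; [apply Rle_abs|]. eapply Rle_trans; [apply Rmax_r|apply Rmax_Cmod]. }
    set (g := (m + 2) * kap0) in *.
    assert (g1 : g <= u / 2).
    { unfold g. apply Rle_trans with ((m + 2) * (u / (2 * (m + 2)))); [apply Rmult_le_compat_l; lra|right; field; lra]. }
    assert (g0 : 0 < g) by (unfold g; nra).
    assert (gm : g <= m + 2) by (unfold g; nra).
    assert (kq : kap0 * (m + 1) <= / 4).
    { apply Rle_trans with (/ (4 * (m + 1)) * (m + 1)); [apply Rmult_le_compat_r; lra|right; field; lra]. }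
    assert (R1 : 1 - (2 * m + 2) * kap0 <= fst k).
    { rewrite Rk. assert (mu * snd a <= mu * m) by (apply Rmult_le_compat_l; lra).
      assert ((m + g) * mu <= (2 * m + 2) * kap0) by (apply Rmult_le_compat; lra). lra. }
    assert (R2 : / 2 <= fst k) by lra.
    assert (I1 : 0 < snd k) by (rewrite Ik; nra).
    assert (I2 : snd k <= (u + g) * mu) by (rewrite Ik; lra).
    destruct (atan_le_self (snd k / fst k)) as [T1 T2]; [apply Rdiv_lt_0_compat; lra|].
    exists (Cmod k), (atan (snd k / fst k)). split; [|split; [split; [exact T1|]|apply polar_right_half; lra]].
    * apply Cmod_gt_0. intros Z. rewrite Z in R2. simpl in R2. lra.
    * apply Rle_lt_trans with (1 := T2).
      apply Rmult_lt_reg_r with (fst k); [lra|]. unfold Rdiv. rewrite Rmult_assoc, Rinv_l, Rmult_1_r by lra.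
      assert (Kb : kap0 * b2 <= eps * u / 2).
      { apply Rle_trans with (eps * u / 2 / b2 * b2); [apply Rmult_le_compat_r; lra|right; field; lra]. }
      assert (eta0 : 0 < eta).
      { destruct (Rle_lt_dec eta 0); [|assumption].
        nra. }
      assert (Q : (u + g) * (v - eps / 2) <= fst k).
      { apply Rle_trans with (2 := R1). unfold b2 in Kb. unfold g in *.
        assert ((m + 2) * kap0 * (eps / 2) >= 0) by (apply Rle_ge; nra). nra. }
      apply Rle_lt_trans with (1 := I2).
      apply Rlt_le_trans with ((u + g) * ((v - eps / 2) * eta)); [apply Rmult_lt_compat_l; lra|].
      nra.
- set (b1 := (m + 1) / 4 + c + (m + 1) * c). assert (b10 : 0 < b1) by (unfold b1; nra).
  set (kap := Rmin (Rmin 1 (m / 2)) (/ 4 / b1)).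
  assert (k1 : kap <= 1) by (eapply Rle_trans; [apply Rmin_l|apply Rmin_l]).
  assert (k2 : kap <= m / 2) by (eapply Rle_trans; [apply Rmin_l|apply Rmin_r]).
  assert (k3 : kap <= / 4 / b1) by apply Rmin_r.
  assert (k0 : 0 < kap).
  { unfold kap. repeat apply Rmin_pos; try lra. apply Rdiv_lt_0_compat; lra. }
  clearbody kap. exists kap, 0. repeat split; [exact k0|exact k1|lra| |intros; lra].
  intros q D h D0 h0 Hq Nk HE.
  destruct (Main kap q D h ltac:(lra) ltac:(lra) D0 h0 Hq Nk HE) as [f0 HD].
  assert (Huv : u / (m * m) <= / 4).
  { apply Rmult_le_reg_r with (m * m); [nra|]. unfold Rdiv. rewrite Rmult_assoc, Rinv_l by nra. lra. }
  assert (HW : (1 + (m + 1) * kap) * (u / (m * m) + kap * c) <= / 2).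
  { apply Rle_trans with ((1 + (m + 1) * kap) * (/ 4 + kap * c)).
    - apply Rmult_le_compat_l; [nra|lra].
    - assert (kap * b1 <= / 4).
      { apply Rle_trans with (/ 4 / b1 * b1); [apply Rmult_le_compat_r; lra|right; field; lra]. }
      unfold b1 in H. assert (0 <= (m + 1) * c) by nra. assert (kap * kap <= kap * 1) by (apply Rmult_le_compat_l; lra). nra. }
  nra.
Qed.

(** [tube_numeric] near the point [p]. The clause [lam * d <= 1] keeps the arcs of angle [lam * eta]
    shorter than a full turn, a condition of [arc_count]. *)
Lemma local_column (F dF : C -> C) (p : C) (r eps : R) :
  0 < r -> 0 < eps -> (forall z, disk p r z -> cderiv F z (dF z)) ->
  dF p <> 0%C -> F p <> 0%C -> p <> 0%C ->
  exists d lam, 0 < d /\ 0 <= lam /\ lam * d <= 1 /\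
   (forall x y D h, disk p d x -> disk p d y -> 0 < D -> 0 < h ->
      Cmod y = exp D * Cmod x -> F y = (RtoC (exp h) * F x)%C -> (2 - lam - eps) * D <= h) /\
   (forall x mu eta, disk p d x -> eta < d -> 0 < mu < lam * eta ->
      disk p r (x * expi mu)%C /\
      exists rho theta, 0 < rho /\ 0 < theta < eta /\ F (x * expi mu)%C = (RtoC rho * expi theta * F x)%C).
Proof.
intros r0 e0 HF nd nF np.
destruct (tube_numeric (p * dF p / F p) eps) as [kap [lam [kk [l0 [HA HB]]]]]; [|exact e0|].
{ unfold Cdiv. repeat apply Cmult_neq_0; try assumption. intros E.
  apply (f_equal (fun z => F p * z)%C) in E. rewrite Cinv_r, Cmult_0_r in E by exact nF.
  apply RtoC_inj in E. lra. }
destruct (first_order_log F dF p r kap r0 ltac:(lra) HF nF np) as [d [d0 Hd]].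
set (B := Cmod p + d). assert (B0 : 0 < B) by (unfold B; generalize (Cmod_ge_0 p); lra).
destruct (pcont_expi 0 (d / 2 / B)) as [d' [d'0 Hd']]; [apply Rdiv_lt_0_compat; lra|].
set (dd := Rmin (d / 2) (Rmin 1 (Rmin d' kap) / (lam + 1))).
assert (M0 : 0 < Rmin 1 (Rmin d' kap)) by (repeat apply Rmin_pos; lra).
assert (dd0 : 0 < dd) by (apply Rmin_pos; [lra|apply Rdiv_lt_0_compat; lra]).
assert (D1 : dd <= d / 2) by apply Rmin_l.
assert (D2 : lam * dd <= Rmin 1 (Rmin d' kap)).
{ apply Rle_trans with ((lam + 1) * (Rmin 1 (Rmin d' kap) / (lam + 1))).
  - apply Rmult_le_compat; [lra|lra|lra|apply Rmin_r].
  - right; field; lra. }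
assert (M1 := Rmin_l 1 (Rmin d' kap)). assert (M2 := Rmin_r 1 (Rmin d' kap)).
assert (M3 := Rmin_l d' kap). assert (M4 := Rmin_r d' kap).
assert (Near : forall x mu eta, disk p dd x -> eta < dd -> 0 < mu < lam * eta ->
  mu <= kap /\ disk p d (x * expi mu)%C).
{ intros x mu eta Hx He Hmu.
  assert (mud : mu < lam * dd) by (apply Rlt_le_trans with (lam * eta); [lra|apply Rmult_le_compat_l; lra]).
  split; [lra|]. assert (Sm := Hd' mu). rewrite expi_0, Rminus_0_r, Rabs_pos_eq in Sm by lra. specialize (Sm ltac:(lra)).
  unfold disk in *. eapply Rle_lt_trans; [apply (Cmod_tri3 _ x p)|].
  replace (x * expi mu - x)%C with (x * (expi mu - 1))%C by ring. rewrite Cmod_mult.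
  assert (Q := Cmod_sub_le x p).
  assert (Cmod x * Cmod (expi mu - 1) <= B * (d / 2 / B)) by (apply Rmult_le_compat; [apply Cmod_ge_0|apply Cmod_ge_0|unfold B; lra|lra]).
  replace (B * (d / 2 / B)) with (d / 2) in H by (field; lra). lra. }
exists dd, lam. repeat split; [exact dd0|exact l0|lra| | | ].
- intros x y D h Hx Hy HD Hh Ey EF.
  destruct (Hd x y) as [nx [nx0 [H1 H2]]]; [unfold disk in *; lra..|].
  apply (HA (y / x)%C D h HD Hh).
  + rewrite Cmod_div, Ey by exact nx0. assert (P : 0 < Cmod x) by now apply Cmod_gt_0. field. lra.
  + exact H1.
  + rewrite EF in H2. replace (RtoC (exp h) * F x / F x)%C with (RtoC (exp h)) in H2 by (field; exact nx). exact H2.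
- apply Rlt_le_trans with d; [|apply d0]. apply (Near x mu eta); assumption.
- destruct (Near x mu eta) as [mk Hy]; try assumption.
  destruct (Hd x (x * expi mu)%C) as [nx [nx0 [H3 H4]]]; [unfold disk in *; lra|exact Hy|].
  replace (x * expi mu / x)%C with (expi mu) in H3, H4 by (field; exact nx0).
  destruct (HB (F (x * expi mu) / F x)%C mu eta) as [rho [theta [h1 [h2 h3]]]]; [lra|exact mk|exact H4|].
  exists rho, theta. repeat split; try tauto; try lra.
  rewrite <- h3. field. exact nx.
Qed.

(** * Lifting of rays *)

Definition icont (u : R -> C) (a b : R) : Prop :=
  forall t, a <= t <= b -> forall eps, 0 < eps -> exists d, 0 < d /\
    forall s, a <= s <= b -> Rabs (s - t) < d -> Cmod (u s - u t) < eps.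

(** Taking the first time matters in [tube_content]: first crossing times of increasing levels are
    increasing even if the path moves back and forth. *)
Lemma first_crossing (u : R -> R) (a b c : R) :
  (forall t, a <= t <= b -> forall eps, 0 < eps -> exists d, 0 < d /\
    forall s, a <= s <= b -> Rabs (s - t) < d -> Rabs (u s - u t) < eps) ->
  a <= b -> u a <= c <= u b ->
  exists x, a <= x <= b /\ u x = c /\ forall y, a <= y < x -> u y < c.
Proof.
intros Hc ab [ua ub].
set (S := fun z => a <= z <= b /\ forall y, a <= y < z -> u y < c).
destruct (completeness S) as [x [xub xlub]].
- exists b. intros z [Hz _]. lra.
- exists a. split; [lra|]. intros y Hy. lra.
- assert (ax : a <= x) by (apply xub; split; [lra|intros y Hy; lra]).
  assert (xb : x <= b) by (apply xlub; intros z [Hz _]; lra).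
  assert (lt : forall y, a <= y < x -> u y < c).
  { intros y Hy. apply Rnot_le_lt. intros L. assert (x <= y); [|lra]. apply xlub.
    intros z [Hz Hz2]. apply Rnot_lt_le. intros L2. specialize (Hz2 y ltac:(lra)). lra. }
  assert (le : u x <= c).
  { apply Rnot_lt_le. intros L. destruct (Hc x ltac:(lra) (u x - c)) as [d [d0 Hd]]; [lra|].
    destruct (Req_dec x a) as [->|ne]; [lra|].
    set (y := Rmax a (x - d / 2)).
    assert (Y1 := Rmax_l a (x - d / 2)). assert (Y2 := Rmax_r a (x - d / 2)).
    assert (yx : y < x) by (apply Rmax_lub_lt; lra). fold y in Y1, Y2.
    specialize (Hd y ltac:(lra)). rewrite Rabs_left in Hd by lra. specialize (Hd ltac:(lra)).
    apply Rabs_def2 in Hd. specialize (lt y ltac:(lra)). lra. }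
  exists x. repeat split; [exact ax|exact xb| |exact lt].
  apply Rle_antisym; [exact le|]. apply Rnot_lt_le. intros L.
  destruct (Hc x ltac:(lra) (c - u x)) as [d [d0 Hd]]; [lra|].
  assert (xb' : x < b) by (destruct (Req_dec x b) as [->|]; lra).
  set (y := Rmin b (x + d / 2)).
  assert (Y1 := Rmin_l b (x + d / 2)). assert (Y2 := Rmin_r b (x + d / 2)).
  assert (yx : x < y) by (apply Rmin_glb_lt; lra). fold y in Y1, Y2.
  assert (y <= x); [|lra]. apply xub. split; [lra|]. intros z Hz.
  destruct (Rlt_le_dec z x) as [zx|zx]; [apply lt; lra|].
  specialize (Hd z ltac:(lra)). rewrite Rabs_pos_eq in Hd by lra. specialize (Hd ltac:(lra)).
  apply Rabs_def2 in Hd. lra.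
Qed.

Lemma icont_Cmod (u : R -> C) (a b : R) : icont u a b ->
  forall t, a <= t <= b -> forall eps, 0 < eps -> exists d, 0 < d /\
    forall s, a <= s <= b -> Rabs (s - t) < d -> Rabs (Cmod (u s) - Cmod (u t)) < eps.
Proof.
intros H t Ht eps e0. destruct (H t Ht eps e0) as [d [d0 Hd]]. exists d; split; [exact d0|].
intros s Hs Hst. specialize (Hd s Hs Hst).
assert (A1 := Cmod_sub_le (u s) (u t)). assert (A2 := Cmod_sub_le (u t) (u s)).
rewrite (Cmod_sub_sym (u t)) in A2. apply Rabs_def1; lra.
Qed.

(** Nothing is demanded of [F] at points of the disk outside [V]; [good_angle] deals with them one
    ray at a time. *)
Record regular (F dF : C -> C) (V : C -> Prop) : Prop := {
  reg_open : copen V;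
  reg_disk : forall z, V z -> Cmod z < 1;
  reg_deriv : forall z, V z -> cderiv F z (dF z);
  reg_origin : V 0%C;
  reg_zero : F 0%C = 0%C;
  reg_simple : dF 0%C <> 0%C
}.

(* [good_angle] excludes the rays through a critical value and those along which
   a lift may run into a point of the disk outside [V]. *)
Record good_angle (F dF : C -> C) (V : C -> Prop) (theta : R) : Prop := {
  good_escape : forall p, Cmod p < 1 -> ~ V p -> forall T, 0 < T -> exists d, 0 < d /\
    forall z, V z -> Cmod (z - p) < d -> d <= Cmod (F z - RtoC T * expi theta);
  good_critical : forall p T, V p -> 0 < T -> F p = (RtoC T * expi theta)%C -> dF p = 0%C ->
    exists d, 0 < d /\ forall y, Cmod (y - p) < d -> F y = F p
}.

Definition ray_lift (F : C -> C) (V : C -> Prop) (theta : R) (xi : R -> C) (a b : R) : Prop :=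
  icont xi a b /\ forall t, a <= t <= b -> V (xi t) /\ F (xi t) = (RtoC t * expi theta)%C.

Lemma ray_dist (s t theta : R) : Cmod (RtoC s * expi theta - RtoC t * expi theta) = Rabs (s - t).
Proof.
replace (RtoC s * expi theta - RtoC t * expi theta)%C with (RtoC (s - t) * expi theta)%C
  by (rewrite RtoC_minus; ring).
now rewrite Cmod_mult, Cmod_R, Cmod_expi, Rmult_1_r.
Qed.

Lemma ray_lift_glue (F : C -> C) (V : C -> Prop) (theta : R) (x1 x2 : R -> C) (a t b : R) :
  a <= t <= b -> ray_lift F V theta x1 a t -> ray_lift F V theta x2 t b -> x1 t = x2 t ->
  ray_lift F V theta (fun s => if Rle_dec s t then x1 s else x2 s) a b.
Proof.
intros Ht [C1 H1] [C2 H2] E. split.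
- intros s Hs eps e0. destruct (Rtotal_order s t) as [L|[L|L]].
  + destruct (C1 s ltac:(lra) eps e0) as [d [d0 Hd]].
    exists (Rmin d (t - s)). split; [apply Rmin_pos; lra|]. intros y Hy Hys.
    assert (y1 := lt_min_l _ _ _ Hys). assert (y2 := lt_min_r _ _ _ Hys).
    apply Rabs_def2 in y2. destruct (Rle_dec y t); [|lra]. destruct (Rle_dec s t); [|lra].
    apply Hd; lra.
  + subst s. destruct (C1 t ltac:(lra) eps e0) as [d1 [d10 Hd1]]. destruct (C2 t ltac:(lra) eps e0) as [d2 [d20 Hd2]].
    exists (Rmin d1 d2). split; [now apply Rmin_pos|]. intros y Hy Hys.
    assert (y1 := lt_min_l _ _ _ Hys). assert (y2 := lt_min_r _ _ _ Hys).
    destruct (Rle_dec t t); [|lra]. destruct (Rle_dec y t).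
    * apply Hd1; lra.
    * rewrite E. apply Hd2; lra.
  + destruct (C2 s ltac:(lra) eps e0) as [d [d0 Hd]].
    exists (Rmin d (s - t)). split; [apply Rmin_pos; lra|]. intros y Hy Hys.
    assert (y1 := lt_min_l _ _ _ Hys). assert (y2 := lt_min_r _ _ _ Hys).
    apply Rabs_def2 in y2. destruct (Rle_dec y t); [lra|]. destruct (Rle_dec s t); [lra|].
    apply Hd; lra.
- intros s Hs. destruct (Rle_dec s t); [apply H1|apply H2]; lra.
Qed.

Lemma ray_lift_sub (F : C -> C) (V : C -> Prop) (theta : R) (xi : R -> C) (a b a' b' : R) :
  a <= a' -> b' <= b -> ray_lift F V theta xi a b -> ray_lift F V theta xi a' b'.
Proof.
intros Ha Hb [Hc H]. split; [|intros t Ht; apply H; lra].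
intros t Ht eps e0. destruct (Hc t ltac:(lra) eps e0) as [d [d0 Hd]]. exists d; split; [exact d0|].
intros s Hs. apply Hd. lra.
Qed.

Section Lift.

Variables (F dF : C -> C) (V : C -> Prop) (theta : R).
Hypothesis HF : regular F dF V.
Hypothesis Hgood : good_angle F dF V theta.

Let e := expi theta.

(** The lift is the local inverse applied to the ray. The inverse Lipschitz estimate shows both that
    it passes through the given [z] and that it is continuous. *)
Lemma local_lift (p : C) (T : R) :
  V p -> F p = (RtoC T * e)%C -> dF p <> 0%C ->
  exists d, 0 < d /\ forall z t, Cmod (z - p) < d -> Rabs (t - T) < d -> F z = (RtoC t * e)%C ->
    exists xi, xi t = z /\ ray_lift F V theta xi (T - d / 2) (T + d / 2).
Proof.
intros Vp Ep nc. destruct (reg_open _ _ _ HF p Vp) as [r [r0 Hr]].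
destruct (local_inverse F dF p r r0) as [rho [sig [K [inv [Hrho [s0 [K0 [Hinv HK]]]]]]]].
{ intros z Hz. apply (reg_deriv _ _ _ HF). now apply Hr. }
{ exact nc. }
set (d := Rmin rho sig). assert (d1 : d <= rho) by apply Rmin_l. assert (d2 : d <= sig) by apply Rmin_r.
assert (d0 : 0 < d) by (apply Rmin_pos; lra).
exists d. split; [exact d0|]. intros z t Hz Ht Ez.
assert (In : forall s, Rabs (s - T) < d -> disk p rho (inv (RtoC s * e)%C) /\ F (inv (RtoC s * e)%C) = (RtoC s * e)%C).
{ intros s Hs. apply Hinv. rewrite Ep. unfold e. rewrite ray_dist. lra. }
exists (fun s => inv (RtoC s * e)%C). split.
- destruct (In t Ht) as [I1 I2]. apply Cmod_sub_eq_0.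
  eapply Rle_trans; [apply HK; [exact I1|unfold disk; lra]|].
  rewrite I2, Ez. rewrite Cmod_sub_diag. lra.
- assert (In' : forall s, T - d / 2 <= s <= T + d / 2 -> Rabs (s - T) < d) by (intros s Hs; apply Rabs_def1; lra).
  split.
  + intros s Hs eps e0. exists (eps / K). split; [now apply Rdiv_lt_0_compat|].
    intros y Hy Hys. destruct (In s (In' s Hs)) as [I1 I2]. destruct (In y (In' y Hy)) as [I3 I4].
    eapply Rle_lt_trans; [apply HK; assumption|]. rewrite I2, I4. unfold e. rewrite ray_dist.
    apply Rlt_le_trans with (K * (eps / K)); [now apply Rmult_lt_compat_l|right; field; lra].
  + intros s Hs. destruct (In s (In' s Hs)) as [I1 I2]. split; [|exact I2].
    apply Hr. unfold disk in I1. lra.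
Qed.

Lemma short_lift : exists T xi, 0 < T /\ ray_lift F V theta xi 0 T /\ xi 0 = 0%C.
Proof.
destruct (local_lift 0 0) as [d [d0 Hd]].
- apply (reg_origin _ _ _ HF).
- rewrite (reg_zero _ _ _ HF). ring.
- apply (reg_simple _ _ _ HF).
- destruct (Hd 0%C 0) as [xi [E1 E2]].
  + now rewrite Cmod_sub_diag.
  + now rewrite Rminus_diag, Rabs_R0.
  + rewrite (reg_zero _ _ _ HF). ring.
  + exists (d / 2), xi. split; [lra|]. split; [|exact E1]. apply ray_lift_sub with (3 := E2); lra.
Qed.

(** [p] is only a possible limit point of a lift as the time tends to [T]. Whatever kind of point it
    is, a lift point near [p] at a time slightly before [T] either cannot occur or can be continued
    past [T], so convergence of the lift is never at issue. *)
Lemma lift_extension (p : C) (T : R) :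
  Cmod p < 1 -> 0 < T ->
  exists d, 0 < d /\ forall z t, Cmod (z - p) < d -> T - d < t < T -> V z -> F z = (RtoC t * e)%C ->
    exists xi b, T < b /\ xi t = z /\ ray_lift F V theta xi t b.
Proof.
intros p1 T0. destruct (classic (V p)) as [Vp|nVp].
- destruct (classic (F p = (RtoC T * e)%C)) as [Ep|nEp].
  + destruct (classic (dF p = 0%C)) as [cr|nc].
    (* Here [F] is constant near [p], so no point close to [p] can have the different value
       [t e]. *)
    * destruct (good_critical _ _ _ _ Hgood p T Vp T0 Ep cr) as [d [d0 Hd]].
      exists d; split; [exact d0|]. intros z t Hz Ht _ Ez. exfalso.
      rewrite (Hd z Hz), Ep in Ez.
      assert (D := ray_dist T t theta). fold e in D. rewrite Ez in D. rewrite Cmod_sub_diag in D.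
      rewrite Rabs_pos_eq in D by lra. lra.
    * destruct (local_lift p T Vp Ep nc) as [d [d0 Hd]].
      exists (d / 2); split; [lra|]. intros z t Hz Ht _ Ez.
      destruct (Hd z t ltac:(lra) ltac:(apply Rabs_def1; lra) Ez) as [xi [E1 E2]].
      exists xi, (T + d / 2). split; [lra|]. split; [exact E1|].
      apply ray_lift_sub with (3 := E2); lra.
  + assert (cF := cderiv_ccont _ _ _ (reg_deriv _ _ _ HF p Vp)).
    set (m := Cmod (F p - RtoC T * e)). assert (m0 : 0 < m).
    { apply Cmod_gt_0. intros Z. apply nEp. apply Cmod_sub_eq_0. rewrite Z, Cmod_0. lra. }
    destruct (cF (m / 2)) as [d [d0 Hd]]; [lra|].
    exists (Rmin d (m / 2)). split; [apply Rmin_pos; lra|]. intros z t Hz Ht _ Ez. exfalso.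
    assert (z1 := Hd z (lt_min_l _ _ _ Hz)). assert (M := Rmin_r d (m / 2)).
    rewrite Ez in z1. assert (Q := Cmod_tri3 (F p) (RtoC t * e) (RtoC T * e)). fold m in Q.
    unfold e in Q at 2 3. rewrite ray_dist, Rabs_left, (Cmod_sub_sym (F p)) in Q by lra. lra.
- destruct (good_escape _ _ _ _ Hgood p p1 nVp T T0) as [d [d0 Hd]].
  exists d; split; [exact d0|]. intros z t Hz Ht Vz Ez. exfalso.
  specialize (Hd z Vz Hz). rewrite Ez in Hd. unfold e in Hd. rewrite ray_dist, Rabs_left in Hd by lra. lra.
Qed.

(** If no lift met the circle of radius [r], all would stay inside it. A Lebesgue number for
    [lift_extension] on the closed disk then continues a lift whose time is close to the supremum
    [M] beyond [M]. The bound [B] makes [M] finite. *)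
Theorem lift_reaches (B r : R) :
  0 < r < 1 -> (forall T xi, 0 <= T -> ray_lift F V theta xi 0 T -> T <= B) ->
  exists T xi, 0 < T /\ ray_lift F V theta xi 0 T /\ xi 0 = 0%C /\ Cmod (xi T) = r.
Proof.
intros Hr HB. apply NNPP; intros nE.
assert (Small : forall T xi, 0 <= T -> ray_lift F V theta xi 0 T -> xi 0 = 0%C -> Cmod (xi T) < r).
{ intros T xi T0 HL H0. apply Rnot_le_lt. intros L.
  destruct (first_crossing (fun t => Cmod (xi t)) 0 T r) as [x [Hx [Ex _]]].
  - apply icont_Cmod. apply HL.
  - exact T0.
  - rewrite H0, Cmod_0. lra.
  - apply nE. exists x, xi. split; [|split; [|split]].
    + destruct (Req_dec x 0) as [->|]; [|lra]. rewrite H0, Cmod_0 in Ex. lra.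
    + apply (ray_lift_sub F V theta xi 0 T 0 x); [lra|lra|exact HL].
    + exact H0.
    + exact Ex. }
set (S := fun T => 0 <= T /\ exists xi, ray_lift F V theta xi 0 T /\ xi 0 = 0%C).
destruct (completeness S) as [M [Mub Mlub]].
- exists B. intros T [T0 [xi [HL _]]]. now apply (HB T xi).
- exists 0. split; [lra|]. exists (fun _ => 0%C). split; [|reflexivity]. split.
  + intros t _ eps e0. exists 1; split; [lra|]. intros. now rewrite Cmod_sub_diag.
  + intros t Ht. replace t with 0 by lra. split; [apply (reg_origin _ _ _ HF)|].
    rewrite (reg_zero _ _ _ HF). ring.
- assert (M0 : 0 < M).
  { destruct short_lift as [T [xi [T0 [HL E]]]]. apply Rlt_le_trans with T; [exact T0|].
    apply Mub. split; [lra|]. now exists xi. }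
  destruct (lebesgue_disk (fun p d => forall z t, Cmod (z - p) < d -> M - d < t < M -> V z -> F z = (RtoC t * e)%C ->
    exists xi b, M < b /\ xi t = z /\ ray_lift F V theta xi t b) r) as [d [d0 Hd]].
  { intros p Hp. apply lift_extension; lra. }
  assert (Ex : exists T, S T /\ M - d < T).
  { apply NNPP; intros nX. assert (M <= M - d); [|lra]. apply Mlub. intros T HT.
    apply Rnot_lt_le. intros L. apply nX. now exists T. }
  destruct Ex as [T [[T0 [xi [HL H0]]] HT]].
  assert (TM : T <= M) by (apply Mub; split; [exact T0|now exists xi]).
  assert (Et : exists t, M - d < t < M /\ 0 <= t <= T).
  { destruct (Req_dec T M) as [->|]; [|exists T; lra]. exists (Rmax (M / 2) (M - d / 2)).
    unfold Rmax. destruct (Rle_dec _ _); lra. }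
  destruct Et as [t Ht].
  assert (HLt := ray_lift_sub F V theta xi 0 T 0 t ltac:(lra) ltac:(lra) HL).
  destruct (Hd (xi t)) as [p [d' [Hp [dd' [Q Hz]]]]]; [apply Rlt_le, Small; [lra|exact HLt|exact H0]|].
  destruct (HLt) as [_ HL2]. destruct (HL2 t ltac:(lra)) as [V1 E1].
  destruct (Q (xi t) t Hz ltac:(lra) V1 E1) as [xi2 [b [Mb [Eg HL']]]].
  assert (b <= M); [|lra]. apply Mub. split; [lra|].
  eexists. split; [apply (ray_lift_glue F V theta xi xi2 0 t b); [lra|exact HLt|exact HL'|now symmetry]|].
  simpl. destruct (Rle_dec 0 t); [exact H0|lra].
Qed.

End Lift.

(** * Length and area of a tube around a lift *)

Fixpoint rsum (f : nat -> R) (n : nat) : R :=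
  match n with O => 0 | S n => rsum f n + f n end.

Lemma rsum_le (f g : nat -> R) (n : nat) :
  (forall k, (k < n)%nat -> f k <= g k) -> rsum f n <= rsum g n.
Proof.
induction n as [|n IH]; intros H; simpl; [lra|].
apply Rplus_le_compat; [apply IH; intros; apply H; lia|apply H; lia].
Qed.

Lemma rsum_ext (f g : nat -> R) (n : nat) : (forall k, f k = g k) -> rsum f n = rsum g n.
Proof. intros H. induction n as [|n IH]; simpl; [reflexivity|now rewrite IH, H]. Qed.

Lemma rsum_plus (f g : nat -> R) (n : nat) : rsum (fun k => f k + g k) n = rsum f n + rsum g n.
Proof. induction n as [|n IH]; simpl; [ring|rewrite IH; ring]. Qed.

Lemma rsum_scal (c : R) (f : nat -> R) (n : nat) : rsum (fun k => c * f k) n = c * rsum f n.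
Proof. induction n as [|n IH]; simpl; [ring|rewrite IH; ring]. Qed.

Lemma rsum_const (c : R) (n : nat) : rsum (fun _ => c) n = INR n * c.
Proof. induction n as [|n IH]; [simpl; ring|]. rewrite S_INR. simpl. rewrite IH. ring. Qed.

Lemma rsum_telescope (f : nat -> R) (n : nat) : rsum (fun k => f (S k) - f k) n = f n - f O.
Proof. induction n as [|n IH]; simpl; [ring|rewrite IH; ring]. Qed.

Lemma rsum_periodic (f : nat -> R) (n K : nat) :
  (forall k, f (k + n)%nat = f k) -> rsum (fun k => f (K + k)%nat) n = rsum f n.
Proof.
intros H. induction K as [|K IH]; [reflexivity|].
rewrite <- IH. assert (E := rsum_telescope (fun m => f (K + m)%nat) n).
assert (E2 : rsum (fun k => f (S K + k)%nat) n - rsum (fun k => f (K + k)%nat) n = f (K + n)%nat - f (K + 0)%nat).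
{ rewrite <- E. clear. induction n as [|n IH]; simpl; [ring|].
  replace (K + S n)%nat with (S (K + n)) by lia. simpl in IH. lra. }
rewrite H, Nat.add_0_r in E2. lra.
Qed.

(** * Lattice counts and logarithmic area *)

Definition indic (P : Prop) : R := if excluded_middle_informative P then 1 else 0.

Lemma indic_le (P Q : Prop) : (P -> Q) -> indic P <= indic Q.
Proof. intros H. unfold indic. destruct excluded_middle_informative, excluded_middle_informative; try lra. tauto. Qed.

Lemma indic_bounds (P : Prop) : 0 <= indic P <= 1.
Proof. unfold indic. destruct excluded_middle_informative; lra. Qed.

Lemma indic_true (P : Prop) : P -> indic P = 1.
Proof. intros H. unfold indic. destruct excluded_middle_informative; [reflexivity|tauto]. Qed.

Lemma indic_iff (P Q : Prop) : (P <-> Q) -> indic P = indic Q.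
Proof. intros H. apply Rle_antisym; apply indic_le; apply H. Qed.

Lemma indic_disjoint (P Q S : Prop) : (P -> Q -> False) -> (P -> S) -> (Q -> S) -> indic P + indic Q <= indic S.
Proof.
intros H1 H2 H3. unfold indic. repeat destruct excluded_middle_informative; try lra; exfalso; tauto.
Qed.

Lemma rsum_count (f : nat -> R) (n : nat) (x : R) :
  x <= INR n -> (forall k, 0 <= f k) -> (forall k, INR k < x -> f k = 1) -> x <= rsum f n.
Proof.
intros Hx Hf H1.
assert (Q : forall m, Rmin x (INR m) <= rsum f m).
{ induction m as [|m IH].
  - simpl. apply Rmin_r.
  - rewrite S_INR. simpl. destruct (Rlt_le_dec (INR m) x) as [L|L].
    + rewrite (H1 m L). rewrite Rmin_right in IH by lra. generalize (Rmin_r x (INR m + 1)). lra.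
    + rewrite Rmin_left in IH by lra. generalize (Rmin_l x (INR m + 1)) (Hf m). lra. }
specialize (Q n). rewrite Rmin_left in Q; lra.
Qed.

(** The start [b] is moved by full turns to a nonnegative angle, and periodicity lets the summation
    begin at the first lattice angle beyond it. The [- 1] pays for the ends of the open arc. *)
Lemma arc_count (Q : R -> Prop) (n : nat) (b l : R) :
  (0 < n)%nat -> (forall s, Q (s + 2 * PI) <-> Q s) -> 0 <= l <= 2 * PI ->
  (forall mu, 0 < mu < l -> Q (b + mu)) ->
  INR n * l / (2 * PI) - 1 <= rsum (fun k => indic (Q (2 * PI * INR k / INR n))) n.
Proof.
intros n0 Hper Hl HQ. assert (P := PI_RGT_0). assert (n1 : 0 < INR n) by now apply lt_0_INR.
assert (Hper' : forall m s, Q (s + 2 * PI * INR m) <-> Q s).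
{ induction m as [|m IH]; intros s; [simpl; now rewrite Rmult_0_r, Rplus_0_r|].
  rewrite S_INR. replace (s + 2 * PI * (INR m + 1)) with (s + 2 * PI * INR m + 2 * PI) by ring.
  now rewrite Hper. }
destruct (nfloor_ex (Rabs b / (2 * PI))) as [m Hm].
{ apply Rdiv_le_0_compat; [apply Rabs_pos|lra]. }
set (b' := b + 2 * PI * INR (S m)).
assert (b'0 : 0 <= b').
{ unfold b'. rewrite S_INR. assert (H1 : Rabs b <= 2 * PI * (INR m + 1)).
  { apply Rmult_le_reg_r with (/ (2 * PI)); [apply Rinv_0_lt_compat; lra|].
    replace (2 * PI * (INR m + 1) * / (2 * PI)) with (INR m + 1) by (field; lra). unfold Rdiv in Hm. lra. }
  assert (H2 := Rle_abs (- b)). rewrite Rabs_Ropp in H2. lra. }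
assert (HQ' : forall mu, 0 < mu < l -> Q (b' + mu)).
{ intros mu Hmu. unfold b'. replace (b + 2 * PI * INR (S m) + mu) with (b + mu + 2 * PI * INR (S m)) by ring.
  apply Hper'. now apply HQ. }
destruct (nfloor_ex (b' * INR n / (2 * PI))) as [K HK].
{ apply Rdiv_le_0_compat; [|lra]. apply Rmult_le_pos; lra. }
rewrite <- (rsum_periodic (fun k => indic (Q (2 * PI * INR k / INR n))) n (S K)).
2:{ intros k. apply indic_iff. rewrite plus_INR.
    replace (2 * PI * (INR k + INR n) / INR n) with (2 * PI * INR k / INR n + 2 * PI) by (field; lra). apply Hper. }
apply rsum_count.
- assert (INR n * l / (2 * PI) <= INR n).
  { apply Rle_div_l; [lra|]. nra. }
  lra.
- intros k. apply indic_bounds.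
- intros k Hk. apply indic_true. rewrite plus_INR, S_INR.
  replace (2 * PI * (INR K + 1 + INR k) / INR n) with (b' + (2 * PI * (INR K + 1 + INR k) / INR n - b')) by ring.
  apply HQ'.
  assert (E1 : b' = 2 * PI / INR n * (b' * INR n / (2 * PI))) by (field; lra).
  assert (E2 : l = 2 * PI / INR n * (INR n * l / (2 * PI))) by (field; lra).
  assert (q0 : 0 < 2 * PI / INR n) by (apply Rdiv_lt_0_compat; lra).
  replace (2 * PI * (INR K + 1 + INR k) / INR n) with (2 * PI / INR n * (INR K + 1 + INR k)) by (field; lra).
  assert (k0 := pos_INR k).
  set (X := b' * INR n / (2 * PI)) in *. set (Y := INR n * l / (2 * PI)) in *. set (q := 2 * PI / INR n) in *.
  clearbody X Y q. rewrite E1, E2. split; nra.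
Qed.

(** Equally spaced in [ln |z|] and in the argument. The points of one index [j] form a circle, and
    these circles are the levels at which [tube_content] cuts the lift. *)
Definition lattice (c0 c1 : R) (n j k : nat) : C :=
  (RtoC (exp (c0 + INR j * ((c1 - c0) / INR n))) * expi (2 * PI * INR k / INR n))%C.

(* The area of [P] in the logarithmic coordinate, measured by lattice points in [c0 <= ln |z| < c1]. *)
Definition content (c0 c1 : R) (P : C -> Prop) (n : nat) : R :=
  2 * PI / INR n * ((c1 - c0) / INR n) * rsum (fun j => rsum (fun k => indic (P (lattice c0 c1 n j k))) n) n.

(** The angles are those of the image point [F z]. Both ends are open, which makes adjacent sectors
    disjoint. *)
Definition sector (F : C -> C) (V : C -> Prop) (al be : R) (z : C) : Prop :=
  V z /\ exists rho theta, 0 < rho /\ al < theta < be /\ F z = (RtoC rho * expi theta)%C.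

Lemma content_nonneg_factor (c0 c1 : R) (n : nat) : c0 < c1 -> (0 < n)%nat -> 0 < 2 * PI / INR n * ((c1 - c0) / INR n).
Proof.
intros H n0. assert (P := PI_RGT_0). apply lt_0_INR in n0.
apply Rmult_lt_0_compat; apply Rdiv_lt_0_compat; lra.
Qed.

Lemma content_le (c0 c1 : R) (P : C -> Prop) (n : nat) :
  c0 < c1 -> (0 < n)%nat -> content c0 c1 P n <= 2 * PI * (c1 - c0).
Proof.
intros H n0. unfold content. assert (Q := content_nonneg_factor c0 c1 n H n0). assert (n1 := lt_0_INR n n0).
apply Rle_trans with (2 * PI / INR n * ((c1 - c0) / INR n) * (INR n * (INR n * 1))).
- apply Rmult_le_compat_l; [lra|]. rewrite <- rsum_const. apply rsum_le. intros j _.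
  rewrite <- rsum_const. apply rsum_le. intros k _. apply indic_bounds.
- right. field. lra.
Qed.

Lemma content_nonneg (c0 c1 : R) (P : C -> Prop) (n : nat) :
  c0 < c1 -> (0 < n)%nat -> 0 <= content c0 c1 P n.
Proof.
intros H n0. unfold content. assert (Q := content_nonneg_factor c0 c1 n H n0).
apply Rmult_le_pos; [lra|]. rewrite <- (Rmult_0_r (INR n)), <- rsum_const. apply rsum_le. intros j _.
rewrite <- (Rmult_0_r (INR n)), <- rsum_const. apply rsum_le. intros k _. apply indic_bounds.
Qed.

Lemma content_disjoint (c0 c1 : R) (P Q S : C -> Prop) (n : nat) :
  c0 < c1 -> (0 < n)%nat -> (forall z, P z -> Q z -> False) -> (forall z, P z -> S z) -> (forall z, Q z -> S z) ->
  content c0 c1 P n + content c0 c1 Q n <= content c0 c1 S n.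
Proof.
intros H n0 H1 H2 H3. unfold content. assert (W := content_nonneg_factor c0 c1 n H n0).
rewrite <- Rmult_plus_distr_l. apply Rmult_le_compat_l; [lra|].
rewrite <- rsum_plus. apply rsum_le. intros j _. rewrite <- rsum_plus. apply rsum_le. intros k _.
apply indic_disjoint; [apply H1|apply H2|apply H3].
Qed.

Lemma polar_exists (z : C) : exists b, z = (RtoC (Cmod z) * expi b)%C.
Proof.
destruct (Rlt_le_dec 0 (fst z)) as [H|H]; [eexists; now apply polar_right_half|].
destruct (Rlt_le_dec 0 (fst (- z)%C)) as [H'|H'].
- exists (atan (snd (- z)%C / fst (- z)%C) + PI). rewrite expi_plus.
  assert (E := polar_right_half (- z)%C H'). 
  replace (expi PI) with (- (1))%C by (unfold expi; rewrite cos_PI, sin_PI; unfold RtoC, Copp; simpl; f_equal; ring).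
  transitivity (- (RtoC (Cmod (- z)) * expi (atan (snd (- z)%C / fst (- z)%C))))%C; [rewrite <- E; ring|].
  rewrite Cmod_opp. ring.
- simpl in H'. assert (Z : fst z = 0) by lra. destruct z as [x y]; simpl in Z; subst x.
  assert (Em : Cmod (0, y) = Rabs y).
  { unfold Cmod; simpl. rewrite <- sqrt_Rsqr_abs. f_equal. unfold Rsqr. ring. }
  destruct (Rle_lt_dec 0 y) as [Hy|Hy].
  + exists (PI / 2). rewrite Em, Rabs_pos_eq by lra. unfold expi. rewrite cos_PI2, sin_PI2.
    unfold RtoC, Cmult; simpl. f_equal; ring.
  + exists (- (PI / 2)). rewrite Em, Rabs_left by lra. unfold expi. rewrite cos_neg, sin_neg, cos_PI2, sin_PI2.
    unfold RtoC, Cmult; simpl. f_equal; ring.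
Qed.

Lemma ln_diff_ge (s t : R) : 0 < s -> s <= t -> (t - s) / t <= ln t - ln s.
Proof.
intros s0 st. assert (H := exp_ge_1_plus (ln s - ln t)).
unfold Rminus in H. rewrite exp_plus, exp_Ropp, !exp_ln in H by lra.
replace ((t - s) / t) with (1 - s * / t) by (field; lra). lra.
Qed.

(** * The tube around a single lift *)

Section Tube.

Variables (F dF : C -> C) (V : C -> Prop) (theta t0 T : R) (xi : R -> C) (c0 c1 : R).
Hypothesis HF : regular F dF V.
Hypothesis Hgood : good_angle F dF V theta.
Hypothesis Ht : 0 < t0 < T.
Hypothesis HL : ray_lift F V theta xi t0 T.
Hypothesis Hc : c0 < c1.
Hypothesis H0 : Cmod (xi t0) = exp c0.
Hypothesis H1 : Cmod (xi T) = exp c1.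

(** [F] takes different values at different times of the lift, so it is not constant near any of its
    points; by [good_critical] a critical point would force that. *)
Lemma lift_noncritical (t : R) : t0 <= t <= T -> dF (xi t) <> 0%C.
Proof.
intros Htt cr. destruct HL as [Lc Lv]. destruct (Lv t Htt) as [Vt Et].
destruct (good_critical _ _ _ _ Hgood (xi t) t Vt ltac:(lra) Et cr) as [d [d0 Hd]].
destruct (Lc t Htt d d0) as [d' [d'0 Hd']].
assert (Ex : exists s, t0 <= s <= T /\ Rabs (s - t) < d' /\ s <> t).
{ destruct (Rlt_le_dec t T) as [L|L].
  - exists (Rmin T (t + d' / 2)). assert (A1 := Rmin_l T (t + d' / 2)). assert (A2 := Rmin_r T (t + d' / 2)).
    assert (t < Rmin T (t + d' / 2)) by (apply Rmin_glb_lt; lra).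
    repeat split; [lra|lra|rewrite Rabs_pos_eq; lra|lra].
  - exists (Rmax t0 (t - d' / 2)). assert (A1 := Rmax_l t0 (t - d' / 2)). assert (A2 := Rmax_r t0 (t - d' / 2)).
    assert (Rmax t0 (t - d' / 2) < t) by (apply Rmax_lub_lt; lra).
    repeat split; [lra|lra|rewrite Rabs_left; lra|lra]. }
destruct Ex as [s [Hs [Hst ne]]].
specialize (Hd (xi s) (Hd' s Hs Hst)). destruct (Lv s Hs) as [_ Es]. rewrite Es, Et in Hd.
apply ne. assert (D := ray_dist s t theta). rewrite Hd in D. rewrite Cmod_sub_diag in D.
symmetry in D. destruct (Req_dec s t) as [|n]; [assumption|]. exfalso. revert D. apply Rabs_no_R0. lra.
Qed.

Lemma lift_neq_0 (t : R) : t0 <= t <= T -> F (xi t) <> 0%C /\ xi t <> 0%C.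
Proof.
intros Htt. destruct HL as [_ Lv]. destruct (Lv t Htt) as [_ Et].
assert (N : F (xi t) <> 0%C).
{ apply Cmod_gt_0. rewrite Et, Cmod_mult, Cmod_R, Cmod_expi, Rabs_pos_eq; lra. }
split; [exact N|]. intros E. apply N. rewrite E. apply (reg_zero _ _ _ HF).
Qed.

(** [local_column] made uniform along the lift. The later time [s'] is tied to [s] only through the
    radial gain [D], because the lift may wander for long before it reaches the next circle. *)
Lemma curve_columns (eps : R) : 0 < eps -> exists d, 0 < d /\ forall s, t0 <= s <= T ->
  exists lam, 0 <= lam /\ lam * d <= 1 /\
  (forall s' D, s < s' <= T -> D <= d -> 0 < D -> Cmod (xi s') = exp D * Cmod (xi s) ->
     (2 - lam - eps) * D <= ln s' - ln s) /\
  (forall mu eta, eta < d -> 0 < mu < lam * eta ->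
     sector F V theta (theta + eta) (xi s * expi mu)%C).
Proof.
intros e0.
destruct (lebesgue_1d (fun u d => exists lam, 0 <= lam /\ lam * d <= 1 /\
  (forall s s' D, t0 <= s <= T -> t0 <= s' <= T -> Rabs (s - u) < 2 * d -> Rabs (s' - u) < 2 * d -> s < s' -> 0 < D ->
     Cmod (xi s') = exp D * Cmod (xi s) -> (2 - lam - eps) * D <= ln s' - ln s) /\
  (forall s mu eta, t0 <= s <= T -> Rabs (s - u) < 2 * d -> eta < d -> 0 < mu < lam * eta ->
     sector F V theta (theta + eta) (xi s * expi mu)%C)) t0 T) as [d [d0 Hd]].
{ intros u Hu. destruct HL as [Lc Lv]. destruct (Lv u Hu) as [Vu Eu].
  destruct (lift_neq_0 u Hu) as [nF np].
  destruct (reg_open _ _ _ HF (xi u) Vu) as [r [r0 Hr]].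
  destruct (local_column F dF (xi u) r eps r0 e0) as [d [lam [d0 [l0 [ld [HA HB]]]]]];
    [intros z Hz; apply (reg_deriv _ _ _ HF); now apply Hr|now apply lift_noncritical|exact nF|exact np|].
  destruct (Lc u Hu d d0) as [d' [d'0 Hd']].
  set (dd := Rmin d (d' / 2)). assert (D1 : dd <= d) by apply Rmin_l. assert (D2 : dd <= d' / 2) by apply Rmin_r.
  assert (dd0 : 0 < dd) by (apply Rmin_pos; lra). clearbody dd.
  exists dd. split; [exact dd0|]. exists lam. repeat split; [exact l0|nra| | |].
  - intros s s' D Hs Hs' Ds Ds' ss D0 Em.
    apply (HA (xi s) (xi s') D (ln s' - ln s)); [apply Hd'; lra|apply Hd'; lra|exact D0| |exact Em|].
    + assert (ln s < ln s') by (apply ln_increasing; lra). lra.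
    + destruct (Lv s Hs) as [_ Es]. destruct (Lv s' Hs') as [_ Es']. rewrite Es, Es'.
      unfold Rminus. rewrite exp_plus, exp_Ropp, !exp_ln by lra. rewrite Cmult_assoc, <- RtoC_mult.
      f_equal. f_equal. field. lra.
  - destruct (HB (xi s) mu eta) as [HV _]; [apply Hd'; lra|lra|lra|]. now apply Hr.
  - destruct (HB (xi s) mu eta) as [_ [rho [ph [r1 [r2 r3]]]]]; [apply Hd'; lra|lra|lra|].
    exists (rho * s), (theta + ph). split; [|split; [lra|]].
    + apply Rmult_lt_0_compat; lra.
    + destruct (Lv s ltac:(lra)) as [_ Es]. rewrite r3, Es, expi_plus, RtoC_mult. ring. }
set (dd := Rmin d (d / (2 * T))).
assert (D1 : dd <= d) by apply Rmin_l. assert (D2 : dd <= d / (2 * T)) by apply Rmin_r.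
assert (dd0 : 0 < dd) by (apply Rmin_pos; [lra|apply Rdiv_lt_0_compat; lra]).
exists dd. split; [exact dd0|]. intros s Hs.
destruct (Hd s Hs) as [u [e [Hu [de [[lam [l0 [le [HA HB]]]] Hsu]]]]].
exists lam. repeat split; [exact l0|nra| | |].
- intros s' D Hs' Dd D0 Em. destruct (Rlt_le_dec (s' - s) e) as [L|L].
  + apply HA; try assumption; try lra.
    replace (s' - u) with ((s' - s) + (s - u)) by ring. eapply Rle_lt_trans; [apply Rabs_triang|].
    rewrite (Rabs_pos_eq (s' - s)); lra.
  (* A late crossing is harmless: [s' - s >= d] gives [ln s' - ln s >= d / T], and this is at least
     [2 D] by the choice of [dd]. *)
  + apply Rle_trans with (2 * D); [nra|].
    eapply Rle_trans; [|apply ln_diff_ge; lra].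
    apply Rle_trans with (2 * (d / (2 * T))); [lra|].
    replace (2 * (d / (2 * T))) with (d / T) by (field; lra).
    apply Rle_trans with (d / s').
    * apply Rmult_le_compat_l; [lra|]. apply Rinv_le_contravar; lra.
    * apply Rmult_le_compat_r; [|lra]. apply Rlt_le, Rinv_0_lt_compat. lra.
- apply (HB s mu eta); try assumption; lra.
- apply (HB s mu eta); try assumption; lra.
Qed.

(* Length-area: the tube around the lift has at least the area that the Cauchy-Schwarz inequality
   predicts, linearized as [1 / x >= 2 - x]. *)
Theorem tube_content (eps : R) : 0 < eps -> exists d N, 0 < d /\ forall eta n, 0 < eta < d -> (N <= n)%nat ->
  eta * ((2 - eps) * (c1 - c0) - (ln T - ln t0)) - 2 * PI * (c1 - c0) / INR n
  <= content c0 c1 (sector F V theta (theta + eta)) n.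
Proof.
intros e0. assert (P := PI_RGT_0).
destruct (curve_columns eps e0) as [d [d0 Hd]].
destruct (nfloor_ex ((c1 - c0) / d)) as [N HN]; [apply Rdiv_le_0_compat; lra|].
exists d, (S N). split; [exact d0|]. intros eta n Heta Hn.
assert (n0 : (0 < n)%nat) by lia. assert (n1 := lt_0_INR n n0).
set (D := (c1 - c0) / INR n). assert (D0 : 0 < D) by (apply Rdiv_lt_0_compat; lra).
assert (Dd : D <= d).
{ apply le_INR in Hn. rewrite S_INR in Hn. unfold D.
  apply Rmult_le_reg_r with (INR n); [exact n1|]. unfold Rdiv. rewrite Rmult_assoc, Rinv_l, Rmult_1_r by lra.
  apply Rle_trans with (d * ((c1 - c0) / d)); [right; field; lra|]. apply Rmult_le_compat_l; lra. }
assert (ED : INR n * D = c1 - c0) by (unfold D; field; lra).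
set (c := fun j => c0 + INR j * D).
assert (Lev : forall j, (j <= n)%nat -> c0 <= c j <= c1).
{ intros j Hj. unfold c. apply le_INR in Hj. assert (p := pos_INR j).
  split; [nra|]. replace c1 with (c0 + INR n * D) by lra. nra. }
assert (Cr : forall j, exists t, (j <= n)%nat -> t0 <= t <= T /\ Cmod (xi t) = exp (c j) /\
   forall y, t0 <= y < t -> Cmod (xi y) < exp (c j)).
{ intros j. destruct (Compare_dec.le_dec j n) as [Hj|Hj]; [|exists 0; lia].
  destruct (first_crossing (fun t => Cmod (xi t)) t0 T (exp (c j))) as [t Htt].
  - apply icont_Cmod. apply HL.
  - lra.
  - rewrite H0, H1. destruct (Lev j Hj) as [L1 L2].
    assert (Em : forall x y, x <= y -> exp x <= exp y).
    { intros x y [L| ->]; [apply Rlt_le, exp_increasing, L|lra]. }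
    split; now apply Em.
  - exists t. intros _. exact Htt. }
destruct (functional_choice _ Cr) as [tt Htt]. clear Cr.
assert (Inc : forall j, (j < n)%nat -> tt j < tt (S j)).
{ intros j Hj. destruct (Htt j ltac:(lia)) as [A1 [A2 A3]]. destruct (Htt (S j) ltac:(lia)) as [B1 [B2 B3]].
  assert (Lt : exp (c j) < exp (c (S j))) by (apply exp_increasing; unfold c; rewrite S_INR; nra).
  destruct (Rtotal_order (tt j) (tt (S j))) as [L|[L|L]]; [exact L| |].
  - rewrite L, B2 in A2. lra.
  - specialize (A3 (tt (S j)) ltac:(lra)). lra. }
(* On circle [j] the tube contains an arc of angle [lam * eta], and [lam] is bounded below through
   the logarithmic time that the lift needs from circle [j] to circle [S j]. *)
assert (Col : forall j, (j < n)%nat ->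
  INR n * eta / (2 * PI) * (2 - eps - (ln (tt (S j)) - ln (tt j)) / D) - 1 <=
  rsum (fun k => indic (sector F V theta (theta + eta) (lattice c0 c1 n j k))) n).
{ intros j Hj. destruct (Htt j ltac:(lia)) as [A1 [A2 A3]]. destruct (Htt (S j) ltac:(lia)) as [B1 [B2 B3]].
  specialize (Inc j Hj).
  destruct (Hd (tt j) A1) as [lam [l0 [ld [HA HB]]]].
  assert (Q := HA (tt (S j)) D ltac:(lra) Dd D0).
  rewrite A2, B2, <- exp_plus in Q. specialize (Q ltac:(unfold c; rewrite S_INR; f_equal; ring)).
  destruct (polar_exists (xi (tt j))) as [b Eb]. rewrite A2 in Eb.
  assert (lp : lam * eta <= 2 * PI).
  { assert (1 < PI) by (generalize PI2_1; lra). nra. }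
  assert (AC := arc_count (fun s => sector F V theta (theta + eta) (RtoC (exp (c j)) * expi s)%C) n b (lam * eta) n0).
  eapply Rle_trans; [|apply AC].
  - apply Rplus_le_compat_r.
    replace (INR n * (lam * eta) / (2 * PI)) with (INR n * eta / (2 * PI) * lam) by (field; lra).
    apply Rmult_le_compat_l.
    + apply Rdiv_le_0_compat; [|lra]. apply Rmult_le_pos; lra.
    + assert (2 - lam - eps <= (ln (tt (S j)) - ln (tt j)) / D); [|lra].
      apply Rle_div_r; [exact D0|]. lra.
  - intros s. now rewrite expi_plus, expi_2PI, Cmult_1_r.
  - split; [|exact lp]. apply Rmult_le_pos; lra.
  - intros mu Hmu. rewrite expi_plus, Cmult_assoc, <- Eb. apply HB; lra. }
unfold content. fold D.
assert (fac : 0 < 2 * PI / INR n * D) by (apply Rmult_lt_0_compat; [apply Rdiv_lt_0_compat; lra|exact D0]).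
apply Rle_trans with (2 * PI / INR n * D * rsum (fun j => INR n * eta / (2 * PI) * (2 - eps - (ln (tt (S j)) - ln (tt j)) / D) - 1) n).
2:{ apply Rmult_le_compat_l; [lra|]. apply rsum_le. exact Col. }
(* The logarithmic times telescope. The [- 1] lost on each of the [n] circles adds up to the error
   [2 pi D]. *)
rewrite (rsum_ext _ (fun j => (INR n * eta / (2 * PI) * (2 - eps) - 1) + (- (INR n * eta / (2 * PI) / D)) * (ln (tt (S j)) - ln (tt j)))).
2:{ intros j. field. lra. }
rewrite rsum_plus, rsum_const, rsum_scal, (rsum_telescope (fun j => ln (tt j))).
destruct (Htt n ltac:(lia)) as [A1 _]. destruct (Htt 0%nat ltac:(lia)) as [B1 _].
assert (M : forall x y, 0 < x -> x <= y -> ln x <= ln y).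
{ intros x y x0 [L| ->]; [apply Rlt_le; now apply ln_increasing|lra]. }
assert (M1 := M (tt n) T ltac:(lra) ltac:(lra)). assert (M2 := M t0 (tt 0%nat) ltac:(lra) ltac:(lra)).
replace (2 * PI / INR n * D * (INR n * (INR n * eta / (2 * PI) * (2 - eps) - 1) + - (INR n * eta / (2 * PI) / D) * (ln (tt n) - ln (tt 0%nat))))
  with (eta * ((2 - eps) * (INR n * D) - (ln (tt n) - ln (tt 0%nat))) - 2 * PI * D).
2:{ field. lra. }
rewrite ED. replace (2 * PI * (c1 - c0) / INR n) with (2 * PI * D) by (unfold D; field; lra).
apply Rplus_le_compat_r. apply Rmult_le_compat_l; lra.
Qed.

End Tube.

(** * Integration over the angle *)

Lemma rsum_nonneg (f : nat -> R) (n : nat) : (forall k, 0 <= f k) -> 0 <= rsum f n.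
Proof. intros H. induction n as [|n IH]; simpl; [lra|]. generalize (H n). lra. Qed.

Lemma rsum_ge_term (f : nat -> R) (n m : nat) : (forall k, 0 <= f k) -> (m < n)%nat -> f m <= rsum f n.
Proof.
intros H. induction n as [|n IH]; intros L; [lia|]. simpl.
destruct (Nat.eq_dec m n) as [->|ne].
- generalize (rsum_nonneg f n H). lra.
- specialize (IH ltac:(lia)). generalize (H n). lra.
Qed.

Lemma rsum_mono_length (f : nat -> R) (n m : nat) : (forall k, 0 <= f k) -> (n <= m)%nat -> rsum f n <= rsum f m.
Proof.
intros H L. induction L as [|m L IH]; [lra|]. simpl. generalize (H m). lra.
Qed.

(** Since [e m < x] is strict, the jump is still unspent at [e m] and becomes available immediately
    to its right. *)
Definition jump (e : nat -> R) (x : R) (m : nat) : R := indic (e m < x) * (/ 2) ^ m.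

Lemma jump_nonneg (e : nat -> R) (x : R) (m : nat) : 0 <= jump e x m.
Proof. apply Rmult_le_pos; [apply indic_bounds|apply Rlt_le, half_pow_pos]. Qed.

Lemma jump_mono (e : nat -> R) (x y : R) (m : nat) : x <= y -> jump e x m <= jump e y m.
Proof.
intros L. apply Rmult_le_compat_r; [apply Rlt_le, half_pow_pos|]. apply indic_le. lra.
Qed.

Lemma jump_sum_le (e : nat -> R) (x : R) (n : nat) : rsum (jump e x) n <= 2.
Proof.
assert (Q : rsum (jump e x) n <= 2 * (1 - (/ 2) ^ n)).
{ induction n as [|n IH]; [simpl; lra|]. simpl. unfold jump at 2.
  assert (B := indic_bounds (e n < x)). assert (P := half_pow_pos n). nra. }
generalize (half_pow_pos n). lra.
Qed.

(* The countably many exceptional points are absorbed by jumps of arbitrarily small total size. *)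
Lemma countable_dini (A : nat -> R -> R -> R) (k K M b : R) (e : nat -> R) :
  0 <= b -> 0 < k ->
  (forall n x y, (0 < n)%nat -> 0 <= x <= y -> y <= b -> 0 <= A n x y) ->
  (forall n x y z, (0 < n)%nat -> 0 <= x <= y -> y <= z -> z <= b -> A n x y + A n y z <= A n x z) ->
  (forall n, (0 < n)%nat -> A n 0 b <= M) ->
  (forall x, 0 <= x < b -> (forall m, e m <> x) -> exists d N, 0 < d /\
     forall h n, 0 < h < d -> (N <= n)%nat -> (0 < n)%nat -> x + h <= b -> h * k - K / INR n <= A n x (x + h)) ->
  b * k <= M.
Proof.
intros b0 k0 Apos Aadd AM Ad. apply le_epsilon. intros eps e0.
set (e1 := eps / 4). assert (e10 : 0 < e1) by (unfold e1; lra).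
(* [del] is quantified inside the induction predicate: each step may ask half the error of the
   previous point, so errors do not accumulate. [N] and [m] may depend on the point. *)
assert (Main : forall x, 0 <= x <= b -> forall del, 0 < del -> exists N m, forall n, (N <= n)%nat -> (0 < n)%nat ->
   x * k - e1 * rsum (jump e x) m - del <= A n 0 x).
{ apply (real_induction (fun x => forall del, 0 < del -> exists N m, forall n, (N <= n)%nat -> (0 < n)%nat ->
   x * k - e1 * rsum (jump e x) m - del <= A n 0 x)).
  - intros del d0. exists O, O. intros n _ n0. simpl. specialize (Apos n 0 0 n0 ltac:(lra) b0). lra.
  - intros x Hx Px. destruct (classic (exists m, e m = x)) as [[m Em]|nE].
    (* No derivative is known at the exceptional point. A stretch of length [e1 (/ 2)^m / k] to its
       right is crossed at the expense of the jump, of size [e1 (/ 2)^m]. *)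
    + assert (P := half_pow_pos m). exists (e1 * (/ 2) ^ m / k). split; [apply Rdiv_lt_0_compat; nra|].
      intros y Hy yb del d0. destruct (Px del d0) as [N [m' HN]].
      exists N, (max m' (S m)). intros n Nn n0. specialize (HN n Nn n0).
      specialize (Aadd n 0 x y n0 ltac:(lra) ltac:(lra) yb). specialize (Apos n x y n0 ltac:(lra) yb).
      assert (J : rsum (jump e x) m' + (/ 2) ^ m <= rsum (jump e y) (max m' (S m))).
      { assert (J1 := rsum_mono_length (jump e x) m' (max m' (S m)) (jump_nonneg e x) ltac:(lia)).
        assert (J2 := rsum_ge_term (fun i => jump e y i - jump e x i) (max m' (S m)) m).
        specialize (J2 ltac:(intros i; generalize (jump_mono e x y i ltac:(lra)); lra) ltac:(lia)). simpl in J2.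
        assert (J3 : rsum (fun i => jump e y i - jump e x i) (max m' (S m)) = rsum (jump e y) (max m' (S m)) - rsum (jump e x) (max m' (S m))).
        { rewrite (rsum_ext _ (fun i => jump e y i + (-1) * jump e x i)) by (intros; ring). rewrite rsum_plus, rsum_scal. ring. }
        assert (J4 : jump e y m = (/ 2) ^ m) by (unfold jump; rewrite indic_true; [ring|lra]).
        assert (J5 : jump e x m = 0).
        { unfold jump, indic. destruct excluded_middle_informative; [lra|ring]. }
        lra. }
      assert ((y - x) * k <= e1 * (/ 2) ^ m).
      { apply Rle_trans with (e1 * (/ 2) ^ m / k * k); [apply Rmult_le_compat_r; lra|right; field; lra]. }
      assert (e1 * (rsum (jump e x) m' + (/ 2) ^ m) <= e1 * rsum (jump e y) (max m' (S m))) by (apply Rmult_le_compat_l; lra).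
      lra.
    + destruct (Ad x Hx) as [d [N1 [d0 Hd]]]; [intros m Em; apply nE; now exists m|].
      exists d. split; [exact d0|]. intros y Hy yb del del0.
      destruct (Px (del / 2) ltac:(lra)) as [N [m HN]].
      destruct (nfloor_ex (Rabs K / (del / 2))) as [N2 HN2]; [apply Rdiv_le_0_compat; [apply Rabs_pos|lra]|].
      exists (max (max N N1) (S N2)), m. intros n Nn n0. specialize (HN n ltac:(lia) n0).
      specialize (Aadd n 0 x y n0 ltac:(lra) ltac:(lra) yb).
      specialize (Hd (y - x) n ltac:(lra) ltac:(lia) n0). replace (x + (y - x)) with y in Hd by ring. specialize (Hd yb).
      assert (n1 := lt_0_INR n n0).
      assert (KN : K / INR n <= del / 2).
      { apply Rmult_le_reg_r with (INR n); [exact n1|]. unfold Rdiv at 1. rewrite Rmult_assoc, Rinv_l, Rmult_1_r by lra.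
        assert (Nn' : INR N2 + 1 <= INR n) by (rewrite <- S_INR; apply le_INR; lia).
        apply Rle_trans with (1 := Rle_abs K).
        apply Rle_trans with (del / 2 * (Rabs K / (del / 2))); [right; field; lra|]. apply Rmult_le_compat_l; lra. }
      assert (J : rsum (jump e x) m <= rsum (jump e y) m) by (apply rsum_le; intros; apply jump_mono; lra).
      assert (e1 * rsum (jump e x) m <= e1 * rsum (jump e y) m) by (apply Rmult_le_compat_l; lra). lra.
  - intros x Hx Px del del0.
    set (y := Rmax 0 (x - del / (2 * k))).
    assert (dk : 0 < del / (2 * k)) by (apply Rdiv_lt_0_compat; lra).
    assert (Y1 := Rmax_l 0 (x - del / (2 * k))). assert (Y2 := Rmax_r 0 (x - del / (2 * k))).
    assert (yx : y < x) by (apply Rmax_lub_lt; lra). fold y in Y1, Y2.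
    destruct (Px y ltac:(lra) (del / 2) ltac:(lra)) as [N [m HN]].
    exists N, m. intros n Nn n0. specialize (HN n Nn n0).
    specialize (Aadd n 0 y x n0 ltac:(lra) ltac:(lra) ltac:(lra)). specialize (Apos n y x n0 ltac:(lra) ltac:(lra)).
    assert ((x - y) * k <= del / 2).
    { apply Rle_trans with (del / (2 * k) * k); [apply Rmult_le_compat_r; lra|right; field; lra]. }
    assert (J : rsum (jump e y) m <= rsum (jump e x) m) by (apply rsum_le; intros; apply jump_mono; lra).
    assert (e1 * rsum (jump e y) m <= e1 * rsum (jump e x) m) by (apply Rmult_le_compat_l; lra). lra. }
destruct (Main b ltac:(lra) (eps / 4) ltac:(lra)) as [N [m HN]].
specialize (HN (S N) ltac:(lia) ltac:(lia)). specialize (AM (S N) ltac:(lia)).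
assert (J := jump_sum_le e b m).
assert (e1 * rsum (jump e b) m <= e1 * 2) by (apply Rmult_le_compat_l; lra). unfold e1 in *. lra.
Qed.

Lemma expi_inj (s t : R) : 0 <= s < 2 * PI -> 0 <= t < 2 * PI -> expi s = expi t -> s = t.
Proof.
intros Hs Ht E. unfold expi in E. injection E as Ec Es.
assert (H : cos (s - t) = 1).
{ rewrite cos_minus, Ec, Es. generalize (sin2_cos2 t). unfold Rsqr. lra. }
assert (P := PI_RGT_0).
assert (S0 : sin ((s - t) / 2) = 0).
{ assert (Q := cos_2a_sin ((s - t) / 2)). replace (2 * ((s - t) / 2)) with (s - t) in Q by field. rewrite H in Q.
  apply Rsqr_0_uniq. unfold Rsqr. lra. }
destruct (Rtotal_order s t) as [L|[L|L]]; [|exact L|].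
- assert (Q : 0 < sin ((t - s) / 2)) by (apply sin_gt_0; lra).
  replace ((t - s) / 2) with (- ((s - t) / 2)) in Q by field. rewrite sin_neg in Q. lra.
- assert (Q : 0 < sin ((s - t) / 2)) by (apply sin_gt_0; lra). lra.
Qed.

Lemma polar_unique (r1 r2 s t : R) :
  0 < r1 -> 0 < r2 -> 0 <= s < 2 * PI -> 0 <= t < 2 * PI ->
  (RtoC r1 * expi s = RtoC r2 * expi t)%C -> r1 = r2 /\ s = t.
Proof.
intros p1 p2 Hs Ht E.
assert (Er : r1 = r2).
{ apply (f_equal Cmod) in E. rewrite !Cmod_mult, !Cmod_expi, !Cmod_R, !Rabs_pos_eq in E by lra. lra. }
subst r2. split; [reflexivity|]. apply expi_inj; [assumption..|].
apply (f_equal (fun z => / RtoC r1 * z)%C) in E.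
assert (n : RtoC r1 <> 0%C) by (intros Z; apply RtoC_inj in Z; lra).
rewrite !Cmult_assoc, Cinv_l, !Cmult_1_l in E by exact n. exact E.
Qed.

(** Angles stay in [[0, 2 pi)], where they are determined by the value of [F], so the two parts are
    disjoint. The points over the common boundary ray are simply lost. *)
Lemma sector_superadditive (F : C -> C) (V : C -> Prop) (c0 c1 x y z : R) (n : nat) :
  c0 < c1 -> (0 < n)%nat -> 0 <= x <= y -> y <= z -> z <= 2 * PI ->
  content c0 c1 (sector F V x y) n + content c0 c1 (sector F V y z) n <= content c0 c1 (sector F V x z) n.
Proof.
intros Hc n0 Hxy Hyz Hz. apply content_disjoint; [exact Hc|exact n0| | |].
- intros w [_ [r1 [s [H1 [H2 E1]]]]] [_ [r2 [t [H3 [H4 E2]]]]]. rewrite E1 in E2.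
  destruct (polar_unique r1 r2 s t) as [_ E]; try lra. exact E2.
- intros w [Vw [r1 [s [H1 [H2 E1]]]]]. split; [exact Vw|]. exists r1, s. repeat split; try assumption; lra.
- intros w [Vw [r1 [s [H1 [H2 E1]]]]]. split; [exact Vw|]. exists r1, s. repeat split; try assumption; lra.
Qed.

(** * Comparison of the areas of two families of tubes *)

Lemma modulus_near_0 (F dF : C -> C) (V : C -> Prop) (kap : R) :
  regular F dF V -> 0 < kap -> exists d, 0 < d /\ forall z, Cmod z < d ->
    exp (- kap) * Cmod (dF 0) * Cmod z <= Cmod (F z).
Proof.
intros HF k0. assert (m0 : 0 < Cmod (dF 0)) by (apply Cmod_gt_0, (reg_simple _ _ _ HF)).
assert (E1 : exp (- kap) < 1) by (rewrite <- exp_0; apply exp_increasing; lra).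
destruct (reg_deriv _ _ _ HF 0%C (reg_origin _ _ _ HF) ((1 - exp (- kap)) * Cmod (dF 0))) as [d [d0 Hd]].
{ apply Rmult_lt_0_compat; lra. }
exists d; split; [exact d0|]. intros z Hz. specialize (Hd z). replace (z - 0)%C with z in Hd by ring.
specialize (Hd Hz). rewrite (reg_zero _ _ _ HF) in Hd.
assert (Q := Cmod_sub_le (dF 0 * z) (F z)). rewrite Cmod_mult in Q.
replace (dF 0 * z - F z)%C with (- (F z - 0 - dF 0 * z))%C in Q by ring. rewrite Cmod_opp in Q. lra.
Qed.

Lemma lift_tube (F dF : C -> C) (V : C -> Prop) (theta B c0 c1 : R) :
  regular F dF V -> good_angle F dF V theta -> c0 < c1 < 0 ->
  (forall T xi, 0 <= T -> ray_lift F V theta xi 0 T -> T <= B) ->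
  exists T xi t0, 0 < t0 < T /\ ray_lift F V theta xi 0 T /\ Cmod (xi t0) = exp c0 /\ Cmod (xi T) = exp c1.
Proof.
intros HF Hg Hc HB.
assert (E1 : exp c1 < 1) by (rewrite <- exp_0; apply exp_increasing; lra).
assert (E2 : exp c0 < exp c1) by (apply exp_increasing; lra). assert (P0 := exp_pos c0).
destruct (lift_reaches F dF V theta HF Hg B (exp c1) ltac:(lra) HB) as [T [xi [T0 [HL [H0 HT]]]]].
destruct (first_crossing (fun t => Cmod (xi t)) 0 T (exp c0)) as [t0 [Ht [Et _]]].
- apply icont_Cmod. apply HL.
- lra.
- rewrite H0, Cmod_0. lra.
- exists T, xi, t0. repeat split; try assumption; try apply HL; try lra.
  + destruct (Req_dec t0 0) as [->|]; [|lra]. rewrite H0, Cmod_0 in Et. lra.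
  + destruct (Req_dec t0 T) as [->|]; lra.
Qed.

(** The two maps have separate disks, so the contents add up to at most [4 pi (c1 - c0)]. If the
    product of derivatives exceeded [1], the content would grow with the angle at a rate
    [k > 2 (c1 - c0)], contrary to [countable_dini] on [[0, 2 pi]]. *)
Theorem competing_lifts (F1 dF1 F2 dF2 : C -> C) (V1 V2 : C -> Prop) (e : nat -> R) :
  regular F1 dF1 V1 -> regular F2 dF2 V2 ->
  (forall theta, 0 <= theta < 2 * PI -> (forall m, e m <> theta) ->
     good_angle F1 dF1 V1 theta /\ good_angle F2 dF2 V2 theta /\
     forall T1 T2 xi1 xi2, 0 < T1 -> 0 < T2 -> ray_lift F1 V1 theta xi1 0 T1 -> ray_lift F2 V2 theta xi2 0 T2 ->
       T1 * T2 <= 1) ->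
  Cmod (dF1 0) * Cmod (dF2 0) <= 1.
Proof.
intros R1 R2 He. assert (P := PI_RGT_0).
set (m1 := Cmod (dF1 0)). set (m2 := Cmod (dF2 0)).
assert (m10 : 0 < m1) by (apply Cmod_gt_0, (reg_simple _ _ _ R1)).
assert (m20 : 0 < m2) by (apply Cmod_gt_0, (reg_simple _ _ _ R2)).
apply Rnot_lt_le. intros Hm.
set (c := ln m1 + ln m2).
assert (c_pos : 0 < c).
{ unfold c. rewrite <- ln_mult by assumption. rewrite <- ln_1. apply ln_increasing; lra. }
set (kap := c / 16). assert (kap0 : 0 < kap) by (unfold kap; lra).
destruct (modulus_near_0 F1 dF1 V1 kap R1 kap0) as [d1 [d10 Hd1]].
destruct (modulus_near_0 F2 dF2 V2 kap R2 kap0) as [d2 [d20 Hd2]].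
(* The outer circle is close to the unit circle, and the inner one lies where the linear lower bound
   for [|F1|] and [|F2|] holds. *)
set (c1 := - kap). set (c0 := Rmin (ln (Rmin d1 d2) - 1) (c1 - 1)).
assert (c01 : c0 < c1) by (unfold c0; generalize (Rmin_r (ln (Rmin d1 d2) - 1) (c1 - 1)); lra).
assert (Ec0 : exp c0 < Rmin d1 d2).
{ assert (0 < Rmin d1 d2) by now apply Rmin_pos. rewrite <- (exp_ln (Rmin d1 d2)) by assumption.
  apply exp_increasing. unfold c0. generalize (Rmin_l (ln (Rmin d1 d2) - 1) (c1 - 1)). lra. }
assert (M1 := Rmin_l d1 d2). assert (M2 := Rmin_r d1 d2).
set (eps := c / (16 * (c1 - c0))). assert (e0 : 0 < eps) by (apply Rdiv_lt_0_compat; lra).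
assert (Ee : eps * (c1 - c0) = c / 16) by (unfold eps; field; lra).
(* The sum of two bounds of [tube_content] per unit angle, with [ln T1 + ln T2 <= 0] and each [ln t]
   at least [ln m - kap + c0]. As [c1 = - kap], the term [2 * c0] is [- 2 (c1 - c0) - 2 kap], so [k]
   exceeds [2 (c1 - c0)] by [c] minus errors of total size [3 c / 8]. *)
set (k := 2 * (2 - eps) * (c1 - c0) + c - 2 * kap + 2 * c0).
assert (Ek : k = 2 * (c1 - c0) + (c - 2 * (c / 16) - 4 * kap)) by (unfold k, c1; unfold c1 in Ee; lra).
assert (Hk : 2 * (c1 - c0) < k) by (rewrite Ek; unfold kap; lra).
assert (D := countable_dini (fun n x y => content c0 c1 (sector F1 V1 x y) n + content c0 c1 (sector F2 V2 x y) n)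
  k (4 * PI * (c1 - c0)) (4 * PI * (c1 - c0)) (2 * PI) e).
assert (Q : 2 * PI * k <= 4 * PI * (c1 - c0)); [apply D; clear D|nra].
- lra.
- lra.
- intros n x y n0 _ _. generalize (content_nonneg c0 c1 (sector F1 V1 x y) n c01 n0) (content_nonneg c0 c1 (sector F2 V2 x y) n c01 n0). lra.
- intros n x y z n0 H1 H2 H3.
  generalize (sector_superadditive F1 V1 c0 c1 x y z n c01 n0 H1 H2 H3) (sector_superadditive F2 V2 c0 c1 x y z n c01 n0 H1 H2 H3). lra.
- intros n n0. generalize (content_le c0 c1 (sector F1 V1 0 (2 * PI)) n c01 n0) (content_le c0 c1 (sector F2 V2 0 (2 * PI)) n c01 n0). lra.
- intros theta Ht Hbad. destruct (He theta Ht Hbad) as [G1 [G2 Hprod]].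
  (* A short lift of either map gives, through [Hprod], the a priori bound on the times of the other
     that [lift_reaches] requires. *)
  destruct (short_lift F1 dF1 V1 theta R1) as [S1 [x1 [S10 [L1 _]]]].
  destruct (short_lift F2 dF2 V2 theta R2) as [S2 [x2 [S20 [L2 _]]]].
  assert (Inv : forall S T, 0 < S -> T * S <= 1 -> T <= / S).
  { intros S T HS HT. apply Rmult_le_reg_r with S; [exact HS|]. rewrite Rinv_l by lra. exact HT. }
  destruct (lift_tube F1 dF1 V1 theta (/ S2) c0 c1 R1 G1) as [T1 [xi1 [t1 [Ht1 [HL1 [A1 B1]]]]]].
  { unfold c1 in *; lra. }
  { intros T xi T0 HL. apply Inv; [exact S20|].
    destruct (Req_dec T 0) as [->|]; [lra|]. apply (Hprod T S2 xi x2); try assumption; lra. }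
  destruct (lift_tube F2 dF2 V2 theta (/ S1) c0 c1 R2 G2) as [T2 [xi2 [t2 [Ht2 [HL2 [A2 B2]]]]]].
  { unfold c1 in *; lra. }
  { intros T xi T0 HL. apply Inv; [exact S10|]. rewrite Rmult_comm.
    destruct (Req_dec T 0) as [->|]; [lra|]. apply (Hprod S1 T x1 xi); try assumption; lra. }
  assert (HT : ln T1 + ln T2 <= 0).
  { rewrite <- ln_mult by lra. rewrite <- ln_1.
    assert (Hp := Hprod T1 T2 xi1 xi2 ltac:(lra) ltac:(lra) HL1 HL2).
    destruct Hp as [Hp|Hp]; [|rewrite Hp; lra]. apply Rlt_le, ln_increasing; [|exact Hp].
    apply Rmult_lt_0_compat; lra. }
  assert (Lt : forall (F dF : C -> C) (V : C -> Prop) (xi : R -> C) (t T d : R), 0 < Cmod (dF 0%C) ->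
    (forall z, Cmod z < d -> exp (- kap) * Cmod (dF 0) * Cmod z <= Cmod (F z)) -> exp c0 < d -> 0 < t < T ->
    ray_lift F V theta xi 0 T -> Cmod (xi t) = exp c0 -> ln (Cmod (dF 0)) - kap + c0 <= ln t).
  { intros F dF V xi t T d m0 Hd Hcd Htt [_ HL] Hxt. specialize (Hd (xi t) ltac:(lra)).
    destruct (HL t ltac:(lra)) as [_ E]. rewrite E, Cmod_mult, Cmod_R, Cmod_expi, Rabs_pos_eq, Hxt, Rmult_1_r in Hd by lra.
    assert (p1 := exp_pos (- kap)). assert (p2 := exp_pos c0).
    apply Rle_trans with (ln (exp (- kap) * Cmod (dF 0) * exp c0)).
    - rewrite !ln_mult, !ln_exp by (try assumption; now apply Rmult_lt_0_compat). lra.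
    - destruct Hd as [Hd|Hd]; [|rewrite Hd; lra]. apply Rlt_le, ln_increasing; [|exact Hd].
      repeat apply Rmult_lt_0_compat; assumption. }
  assert (Q1 := Lt F1 dF1 V1 xi1 t1 T1 d1 m10 Hd1 ltac:(lra) Ht1 HL1 A1).
  assert (Q2 := Lt F2 dF2 V2 xi2 t2 T2 d2 m20 Hd2 ltac:(lra) Ht2 HL2 A2).
  fold m1 in Q1. fold m2 in Q2.
  destruct (tube_content F1 dF1 V1 theta t1 T1 xi1 c0 c1 R1 G1 Ht1
    (ray_lift_sub F1 V1 theta xi1 0 T1 t1 T1 ltac:(lra) ltac:(lra) HL1) c01 A1 B1 eps e0) as [u1 [N1 [u10 U1]]].
  destruct (tube_content F2 dF2 V2 theta t2 T2 xi2 c0 c1 R2 G2 Ht2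
    (ray_lift_sub F2 V2 theta xi2 0 T2 t2 T2 ltac:(lra) ltac:(lra) HL2) c01 A2 B2 eps e0) as [u2 [N2 [u20 U2]]].
  exists (Rmin u1 u2), (max N1 N2). split; [now apply Rmin_pos|].
  intros h n Hh Hn n0 _.
  assert (h1 : h < u1) by (generalize (Rmin_l u1 u2); lra). assert (h2 : h < u2) by (generalize (Rmin_r u1 u2); lra).
  specialize (U1 h n ltac:(lra) ltac:(lia)). specialize (U2 h n ltac:(lra) ltac:(lia)).
  apply Rle_trans with (h * ((2 - eps) * (c1 - c0) - (ln T1 - ln t1)) + h * ((2 - eps) * (c1 - c0) - (ln T2 - ln t2)) - 4 * PI * (c1 - c0) / INR n).
  + apply Rplus_le_compat_r. rewrite <- Rmult_plus_distr_l. apply Rmult_le_compat_l; [lra|]. unfold k, c. lra.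
  + assert (4 * PI * (c1 - c0) / INR n = 2 * PI * (c1 - c0) / INR n + 2 * PI * (c1 - c0) / INR n).
    { assert (n1 := lt_0_INR n n0). field. lra. }
    lra.
Qed.

(** * The conformal map of a half of the disk *)

Lemma Csqrt_exists (d : C) : exists w, (w * w)%C = d.
Proof.
destruct (polar_exists d) as [b Hb]. exists (RtoC (sqrt (Cmod d)) * expi (b / 2))%C.
rewrite Hb at 3. replace b with (b / 2 + b / 2) at 3 by field. rewrite expi_plus.
rewrite <- (sqrt_sqrt (Cmod d)) at 3 by apply Cmod_ge_0. rewrite RtoC_mult. ring.
Qed.

Lemma Cmod_sqr_pair (x y : R) : Cmod (x, y) * Cmod (x, y) = x * x + y * y.
Proof. assert (H := Cmod2_alt (x, y)). simpl in H. rewrite !Rmult_1_r in H. exact H. Qed.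

Lemma Cmod_lt_sqr (a b : C) : Cmod a * Cmod a < Cmod b * Cmod b -> Cmod a < Cmod b.
Proof. intros H. generalize (Cmod_ge_0 a) (Cmod_ge_0 b). nra. Qed.

Lemma mobius_lt (a b : C) : Cmod a < 1 -> Cmod b < 1 -> Cmod (a + b) < Cmod (1 + Cconj b * a).
Proof.
intros Ha Hb. apply Cmod_lt_sqr.
assert (Ha' : Cmod a * Cmod a < 1) by (generalize (Cmod_ge_0 a); nra).
assert (Hb' : Cmod b * Cmod b < 1) by (generalize (Cmod_ge_0 b); nra).
destruct a as [x y], b as [u v]. rewrite Cmod_sqr_pair in Ha', Hb'.
unfold Cplus, Cmult, Cconj, RtoC; simpl. rewrite !Cmod_sqr_pair. nra.
Qed.

Section Blaschke.

Variable rho : R.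
Hypothesis Hrho : 0 < rho < 1.

(** The equation [s = u (1 - rho u) / (u - rho)] cleared of denominators: [s] is the quotient of the
    Blaschke factors at [0] and at [rho]. *)
Let root (s u : C) : Prop := (RtoC rho * (u * u) - (1 - s) * u - RtoC rho * s)%C = 0%C.

Let rho_neq_0 : RtoC rho <> 0%C.
Proof. intros E. apply RtoC_inj in E. lra. Qed.

(** The two roots of the quadratic have product [- s], so one of them has modulus below [1]. *)
Lemma blaschke_root (s : C) : Cmod s < 1 -> exists u, Cmod u < 1 /\ root s u.
Proof.
intros Hs. destruct (Csqrt_exists ((1 - s) * (1 - s) + 4 * (RtoC rho * RtoC rho) * s)) as [w Hw].
set (u1 := ((1 - s + w) / (2 * RtoC rho))%C). set (u2 := ((1 - s - w) / (2 * RtoC rho))%C).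
assert (E : (u1 * u2)%C = (- s)%C).
{ transitivity (((1 - s) * (1 - s) - w * w) / (4 * (RtoC rho * RtoC rho)))%C; [unfold u1, u2; field; exact rho_neq_0|].
  rewrite Hw. field. exact rho_neq_0. }
assert (Rt : forall v, (v * v = (1 - s) * (1 - s) + 4 * (RtoC rho * RtoC rho) * s)%C -> root s ((1 - s + v) / (2 * RtoC rho))%C).
{ intros v Hv. unfold root. transitivity ((v * v - ((1 - s) * (1 - s) + 4 * (RtoC rho * RtoC rho) * s)) / (4 * RtoC rho))%C.
  - field. exact rho_neq_0.
  - rewrite Hv. field. exact rho_neq_0. }
assert (P : Cmod u1 * Cmod u2 < 1) by (rewrite <- Cmod_mult, E, Cmod_opp; exact Hs).
destruct (Rlt_le_dec (Cmod u1) 1) as [L1|L1].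
- exists u1. split; [exact L1|]. now apply Rt.
- exists u2. split.
  + generalize (Cmod_ge_0 u2). nra.
  + replace u2 with ((1 - s + - w) / (2 * RtoC rho))%C by (unfold u2; field; exact rho_neq_0).
    apply Rt. rewrite <- Hw. ring.
Qed.

Lemma root_neq (s u : C) : root s u -> (RtoC rho - u)%C <> 0%C.
Proof.
intros H E. assert (Eu : u = RtoC rho) by (replace u with (RtoC rho - (RtoC rho - u))%C by ring; rewrite E; ring).
unfold root in H. rewrite Eu in H.
assert (Z : (RtoC rho * (RtoC (rho * rho) - 1))%C = 0%C) by (rewrite <- H, RtoC_mult; ring).
revert Z. apply Cmult_neq_0; [exact rho_neq_0|]. rewrite <- RtoC_minus. intros Z. apply RtoC_inj in Z. nra.
Qed.

Lemma root_value (s u : C) : root s u -> (s * (u - RtoC rho))%C = (u * (1 - RtoC rho * u))%C.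
Proof.
intros H. unfold root in H. transitivity (s * (u - RtoC rho) - (RtoC rho * (u * u) - (1 - s) * u - RtoC rho * s) + 0)%C.
- rewrite H. ring.
- ring.
Qed.

(* The second root, outside the closed unit disk. *)
Let other (u : C) : C := ((1 - RtoC rho * u) / (RtoC rho - u))%C.

Lemma other_gt_1 (s u : C) : Cmod u < 1 -> root s u -> 1 < Cmod (other u).
Proof.
intros Hu H. assert (N := root_neq s u H). unfold other. rewrite Cmod_div by exact N.
assert (N' : 0 < Cmod (RtoC rho - u)) by now apply Cmod_gt_0.
apply Rmult_lt_reg_r with (Cmod (RtoC rho - u)); [exact N'|].
unfold Rdiv. rewrite Rmult_assoc, Rinv_l, Rmult_1_r, Rmult_1_l by lra.
replace (RtoC rho - u)%C with (- u + RtoC rho)%C by ring.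
replace (1 - RtoC rho * u)%C with (1 + Cconj (RtoC rho) * - u)%C
  by (replace (Cconj (RtoC rho)) with (RtoC rho) by (unfold Cconj, RtoC; simpl; f_equal; ring); ring).
apply mobius_lt; [now rewrite Cmod_opp|]. rewrite Cmod_R, Rabs_pos_eq; lra.
Qed.

Lemma root_difference (s s0 u u0 : C) : root s u -> root s0 u0 ->
  (RtoC rho * (u - u0) * (u - other u0))%C = ((s - s0) * (RtoC rho - u))%C.
Proof.
intros H H0. assert (N := root_neq s0 u0 H0). assert (V := root_value s0 u0 H0). unfold root in H.
assert (Es : s0 = (- (u0 * (1 - RtoC rho * u0)) / (RtoC rho - u0))%C).
{ transitivity (- (s0 * (u0 - RtoC rho)) / (RtoC rho - u0))%C; [field; exact N|]. now rewrite V. }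
transitivity (RtoC rho * (u - u0) * (u - other u0) - (RtoC rho * (u * u) - (1 - s) * u - RtoC rho * s))%C.
- rewrite H. ring.
- rewrite Es. unfold other. field. exact N.
Qed.

(** The branch is chosen pointwise. By [root_difference], [U s - U s0] is [s - s0] times [G (U s)],
    and [G] is bounded on the disk because its pole, the second root, lies outside; this yields
    continuity and then the derivative. *)
Lemma root_branch : exists U dU : C -> C, U 0%C = 0%C /\ dU 0%C = (- RtoC rho)%C /\
  forall s, Cmod s < 1 -> Cmod (U s) < 1 /\ root s (U s) /\ cderiv U s (dU s).
Proof.
destruct (functional_choice (fun s u => Cmod s < 1 -> Cmod u < 1 /\ root s u)) as [U HU].
{ intros s. destruct (Rlt_le_dec (Cmod s) 1) as [L|L].
  - destruct (blaschke_root s L) as [u Hu]. now exists u.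
  - exists 0%C. lra. }
assert (U0 : U 0%C = 0%C).
{ destruct (HU 0%C) as [H1 H2]; [rewrite Cmod_0; lra|]. unfold root in H2.
  assert (Z : (U 0 * (RtoC rho * U 0 - 1))%C = 0%C) by (etransitivity; [|exact H2]; ring).
  apply NNPP. intros n. revert Z. apply Cmult_neq_0; [exact n|].
  intros Z. assert (E : (RtoC rho * U 0)%C = 1%C) by (replace (RtoC rho * U 0)%C with (RtoC rho * U 0 - 1 + 1)%C by ring; rewrite Z; ring).
  apply (f_equal Cmod) in E. rewrite Cmod_mult, Cmod_R, Cmod_1, Rabs_pos_eq in E by lra. nra. }
exists U, (fun s => (RtoC rho - U s) / (RtoC rho * (U s - other (U s))))%C.
split; [exact U0|]. split.
{ rewrite U0. unfold other. field. exact rho_neq_0. }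
intros s0 Hs0. destruct (HU s0 Hs0) as [Hu0 Hr0]. split; [exact Hu0|]. split; [exact Hr0|].
set (u0 := U s0) in *. assert (O1 := other_gt_1 s0 u0 Hu0 Hr0). set (v := other u0) in *.
set (g := Cmod v - 1). assert (g0 : 0 < g) by (unfold g; lra).
assert (Nv : forall u, Cmod u < 1 -> (u - v)%C <> 0%C).
{ intros u Hu. apply Cmod_gt_0. rewrite Cmod_sub_sym. generalize (Cmod_sub_le v u). lra. }
set (G := fun u => ((RtoC rho - u) / (RtoC rho * (u - v)))%C).
assert (cG : ccont G u0).
{ eapply cderiv_ccont. apply (cderiv_div (fun u => RtoC rho - u)%C (fun u => RtoC rho * (u - v))%C).
  - apply Cmult_neq_0; [exact rho_neq_0|now apply Nv].
  - apply cderiv_ext_loc with (f := fun u => (RtoC rho + - (1) * u)%C) (d := 1); [lra|intros; ring|apply cderiv_affine].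
  - apply cderiv_scal. apply cderiv_ext_loc with (f := fun u => (- v + 1 * u)%C) (d := 1); [lra|intros; ring|apply cderiv_affine]. }
assert (Df : forall s, Cmod s < 1 -> (U s - u0)%C = ((s - s0) * G (U s))%C).
{ intros s Hs. destruct (HU s Hs) as [Hu Hr]. assert (E := root_difference s s0 (U s) u0 Hr Hr0). fold v in E.
  unfold G. transitivity (RtoC rho * (U s - u0) * (U s - v) / (RtoC rho * (U s - v)))%C.
  - field. split; [exact (Nv _ Hu)|exact rho_neq_0].
  - rewrite E. field. split; [exact (Nv _ Hu)|exact rho_neq_0]. }
set (K := 2 / (rho * g)). assert (K0 : 0 < K) by (apply Rdiv_lt_0_compat; nra).
assert (Gb : forall u, Cmod u < 1 -> Cmod (G u) <= K).
{ intros u Hu. unfold G. rewrite Cmod_div by (apply Cmult_neq_0; [exact rho_neq_0|now apply Nv]).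
  rewrite Cmod_mult, Cmod_R, Rabs_pos_eq by lra. unfold K.
  assert (B1 : Cmod (RtoC rho - u) <= 2).
  { eapply Rle_trans; [apply Cmod_le_sub|]. rewrite Cmod_R, Rabs_pos_eq; lra. }
  assert (B2 : g <= Cmod (u - v)) by (rewrite Cmod_sub_sym; unfold g; generalize (Cmod_sub_le v u); lra).
  apply Rmult_le_compat; [apply Cmod_ge_0| |exact B1|].
  - apply Rlt_le, Rinv_0_lt_compat. nra.
  - apply Rinv_le_contravar; nra. }
intros eps e0. destruct (cG eps e0) as [d [d0 Hd]].
exists (Rmin (d / K) (1 - Cmod s0)). split; [apply Rmin_pos; [now apply Rdiv_lt_0_compat|lra]|].
intros s Hs. assert (s1 := lt_min_l _ _ _ Hs). assert (s2 := lt_min_r _ _ _ Hs).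
assert (Hs1 : Cmod s < 1) by (generalize (Cmod_sub_le s s0); lra).
destruct (HU s Hs1) as [Hu Hr].
assert (E : (U s - u0 - G u0 * (s - s0))%C = ((G (U s) - G u0) * (s - s0))%C) by (rewrite (Df s Hs1); ring).
change (Cmod (U s - u0 - G u0 * (s - s0)) <= eps * Cmod (s - s0)). rewrite E.
rewrite Cmod_mult. apply Rmult_le_compat_r; [apply Cmod_ge_0|]. apply Rlt_le, Hd.
rewrite (Df s Hs1), Cmod_mult. apply Rle_lt_trans with (Cmod (s - s0) * K).
- apply Rmult_le_compat_l; [apply Cmod_ge_0|now apply Gb].
- apply Rlt_le_trans with (d / K * K); [now apply Rmult_lt_compat_r|right; field; lra].
Qed.

End Blaschke.

Lemma one_minus_neq_0 (x : C) : Cmod x < 1 -> (1 - x)%C <> 0%C.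
Proof. intros H. apply Cmod_gt_0. generalize (Cmod_sub_le 1 x). rewrite Cmod_1. lra. Qed.

(* [Z] inverts the quotient of the Blaschke factors at [p] and [q] on the half of the disk where it is
   less than 1 in modulus, the points hyperbolically closer to [p] than to [q]. *)
Theorem half_disk_map (p q : C) : Cmod p < 1 -> Cmod q < 1 -> p <> q ->
  exists Z dZ : C -> C, Z 0%C = p /\ Cmod (dZ 0%C) = (1 - Cmod p ^ 2) * Cmod ((p - q) / (1 - Cconj p * q)) /\
  forall s, Cmod s < 1 -> Cmod (Z s) < 1 /\ cderiv Z s (dZ s) /\
    Cmod ((Z s - p) * (1 - Cconj q * Z s)) < Cmod ((Z s - q) * (1 - Cconj p * Z s)).
Proof.
intros Hp Hq npq.
assert (Hpq : Cmod (Cconj p * q) < 1).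
{ rewrite Cmod_mult, Cmod_conj. generalize (Cmod_ge_0 p) (Cmod_ge_0 q). nra. }
assert (Nd := one_minus_neq_0 _ Hpq).
set (b := ((q - p) / (1 - Cconj p * q))%C). set (rho := Cmod b).
assert (Eb : Cmod ((p - q) / (1 - Cconj p * q)) = rho).
{ unfold rho, b. rewrite !Cmod_div by exact Nd. now rewrite Cmod_sub_sym. }
assert (Hrho : 0 < rho < 1).
{ split.
  - apply Cmod_gt_0. unfold b, Cdiv. apply Cmult_neq_0.
    + intros E. apply npq. replace q with (q - p + p)%C by ring. rewrite E. ring.
    + intros E. apply (f_equal (fun z => (1 - Cconj p * q) * z)%C) in E. rewrite Cinv_r, Cmult_0_r in E by exact Nd.
      apply RtoC_inj in E. lra.
  - rewrite <- Eb. exact (pseudo_hyp_dist_lt1 p q Hp Hq). }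
assert (rho_neq_0 : RtoC rho <> 0%C) by (intros E; apply RtoC_inj in E; lra).
set (om := (b / RtoC rho)%C).
assert (Em : Cmod om = 1).
{ unfold om. rewrite Cmod_div by exact rho_neq_0. rewrite Cmod_R, Rabs_pos_eq by lra. fold rho. field. lra. }
assert (Ec : (Cconj om * om)%C = 1%C).
{ rewrite Cmult_comm, <- Cmod2_conj, Em. f_equal. ring. }
assert (E1 : (q - p)%C = (om * RtoC rho * (1 - Cconj p * q))%C).
{ unfold om, b. field. split; [exact Nd|exact rho_neq_0]. }
assert (E2 : (Cconj q - Cconj p)%C = (Cconj om * RtoC rho * (1 - p * Cconj q))%C).
{ rewrite <- Cminus_conj, E1, !Cmult_conj, Cminus_conj, Cmult_conj, Cconj_conj.
  replace (Cconj (RtoC rho)) with (RtoC rho) by (unfold Cconj, RtoC; simpl; f_equal; ring).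
  replace (Cconj 1) with (RtoC 1) by (unfold Cconj, RtoC; simpl; f_equal; ring). reflexivity. }
destruct (root_branch rho Hrho) as [U [dU [U0 [dU0 HU]]]].
set (den := fun u => (1 + Cconj p * om * u)%C).
assert (Nden : forall u, Cmod u < 1 -> den u <> 0%C).
{ intros u Hu. unfold den. replace (1 + Cconj p * om * u)%C with (1 - - (Cconj p * om * u))%C by ring.
  apply one_minus_neq_0. rewrite Cmod_opp, !Cmod_mult, Cmod_conj, Em. generalize (Cmod_ge_0 p) (Cmod_ge_0 u). nra. }
assert (P2 : RtoC (1 - Cmod p ^ 2) = (1 - p * Cconj p)%C) by (now rewrite RtoC_minus, Cmod2_conj).
(* The root branch is followed by the automorphism of the disk that takes [0] to [p] and [rho] to
   [q]; [om] is the rotation that turns [rho] into [b]. *)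
exists (fun s => (p + om * U s) / den (U s))%C.
exists (fun s => (om * dU s * den (U s) - (p + om * U s) * (Cconj p * om * dU s)) / (den (U s) * den (U s)))%C.
split; [rewrite U0; unfold den; field; rewrite Cmult_0_r, Cplus_0_r; intros Z; apply RtoC_inj in Z; lra|].
split.
{ rewrite U0, dU0. unfold den. rewrite !Cmult_0_r, !Cplus_0_r.
  replace ((om * - RtoC rho * 1 - p * (Cconj p * om * - RtoC rho)) / (1 * 1))%C
    with (- (om * RtoC rho * (1 - p * Cconj p)))%C by (field; intros Z; apply RtoC_inj in Z; lra).
  rewrite Cmod_opp, !Cmod_mult, Em, <- P2, !Cmod_R, Eb, !Rabs_pos_eq; [ring| |lra].
  generalize (Cmod_ge_0 p). simpl. nra. }
intros s Hs. destruct (HU s Hs) as [Hu [Hr Hd]]. set (u := U s) in *. assert (N := Nden u Hu).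
assert (Hom : Cmod (om * u) < 1) by (rewrite Cmod_mult, Em; lra).
split; [|split].
- rewrite Cmod_div by exact N. assert (M := mobius_lt (om * u) p Hom Hp).
  replace (om * u + p)%C with (p + om * u)%C in M by ring.
  replace (1 + Cconj p * (om * u))%C with (den u) in M by (unfold den; ring).
  assert (D0 : 0 < Cmod (den u)) by now apply Cmod_gt_0.
  apply Rmult_lt_reg_r with (Cmod (den u)); [exact D0|]. unfold Rdiv. rewrite Rmult_assoc, Rinv_l by lra. lra.
- apply (cderiv_div (fun s => p + om * U s)%C (fun s => den (U s))); [exact N| |].
  + generalize (cderiv_comp (fun x => p + om * x)%C U s om (dU s) Hd (cderiv_affine p om _)). exact (fun H => H).
  + exact (cderiv_comp den U s (Cconj p * om) (dU s) Hd (cderiv_affine 1 (Cconj p * om) _)).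
- assert (F1 : ((p + om * u) / den u - p)%C = ((1 - p * Cconj p) * om * u / den u)%C) by (unfold den; field; exact N).
  assert (F2 : (1 - Cconj q * ((p + om * u) / den u))%C = ((1 - p * Cconj q) * (1 - RtoC rho * u) / den u)%C).
  { transitivity (((1 - p * Cconj q) - (Cconj q - Cconj p) * om * u) / den u)%C; [unfold den; field; exact N|].
    rewrite E2. f_equal. transitivity ((1 - p * Cconj q) * (1 - RtoC rho * (Cconj om * om) * u))%C; [ring|]. rewrite Ec. ring. }
  assert (F3 : ((p + om * u) / den u - q)%C = (om * (1 - Cconj p * q) * (u - RtoC rho) / den u)%C).
  { transitivity ((om * u * (1 - Cconj p * q) - (q - p)) / den u)%C; [unfold den; field; exact N|].
    rewrite E1 at 1. field. exact N. }
  assert (F4 : (1 - Cconj p * ((p + om * u) / den u))%C = ((1 - p * Cconj p) / den u)%C) by (unfold den; field; exact N).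
  rewrite F1, F2, F3, F4, !Cmod_mult, !Cmod_div, !Cmod_mult, <- P2, Em by exact N.
  assert (Sym : Cmod (1 - p * Cconj q) = Cmod (1 - Cconj p * q)).
  { rewrite <- Cmod_conj, Cminus_conj, Cmult_conj, Cconj_conj. f_equal. f_equal.
    unfold Cconj, RtoC; simpl; f_equal; ring. }
  rewrite Sym. assert (Val := f_equal Cmod (root_value rho s u Hr)). rewrite !Cmod_mult in Val.
  assert (Nu : 0 < Cmod (u - RtoC rho)).
  { rewrite Cmod_sub_sym. apply Cmod_gt_0. exact (root_neq rho Hrho s u Hr). }
  assert (K1 : 0 < Cmod (1 - Cconj p * q)) by now apply Cmod_gt_0.
  assert (K2 : 0 < Cmod (RtoC (1 - Cmod p ^ 2))).
  { rewrite Cmod_R, Rabs_pos_eq; generalize (Cmod_ge_0 p); simpl; nra. }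
  assert (K3 : 0 < / Cmod (den u)) by (apply Rinv_0_lt_compat; now apply Cmod_gt_0).
  (* After all common factors are removed, the half-disk inequality is
     [|u (1 - rho u)| < |u - rho|], which says [|s| < 1]. *)
  assert (Lt : Cmod u * Cmod (1 - RtoC rho * u) < Cmod (u - RtoC rho)) by (rewrite <- Val; nra).
  set (k := Cmod (RtoC (1 - Cmod p ^ 2)) * Cmod (1 - Cconj p * q) * (/ Cmod (den u) * / Cmod (den u))).
  assert (k0 : 0 < k) by (unfold k; repeat apply Rmult_lt_0_compat; assumption).
  apply (Rmult_lt_compat_l k) in Lt; [|exact k0]. unfold k in Lt. unfold Rdiv.
  eapply Rle_lt_trans; [|eapply Rlt_le_trans; [exact Lt|]]; right; ring.
Qed.

(** * Circular arcs as rays *)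

Lemma expi_minus (a b : R) :
  (expi a - expi b)%C = (2 * Ci * RtoC (sin ((a - b) / 2)) * expi ((a + b) / 2))%C.
Proof.
set (x := expi ((a + b) / 2)).
transitivity (x * (expi ((a - b) / 2) - expi (- ((a - b) / 2))))%C.
{ replace (x * (expi ((a - b) / 2) - expi (- ((a - b) / 2))))%C
    with (x * expi ((a - b) / 2) - x * expi (- ((a - b) / 2)))%C by ring.
  unfold x. rewrite <- !expi_plus. f_equal; [|f_equal]; f_equal; field. }
replace (expi ((a - b) / 2) - expi (- ((a - b) / 2)))%C with (2 * Ci * RtoC (sin ((a - b) / 2)))%C; [ring|].
unfold expi. rewrite cos_neg, sin_neg.
unfold Cminus, Copp, Cplus, Cmult, Ci, RtoC; simpl. f_equal; ring.
Qed.

Lemma expi_PI : expi PI = (- (1))%C.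
Proof. unfold expi. rewrite cos_PI, sin_PI. unfold RtoC, Copp; simpl. f_equal; ring. Qed.

(** [1] is the value of [(w - w1) / (w - w2)] at infinity. A ray that avoids it keeps away from the
    poles and corresponds to a bounded arc. *)
Lemma expi_real (t : R) : 0 <= t < 2 * PI -> t <> 0 -> t <> PI -> forall x, (RtoC x * expi t)%C <> 1%C.
Proof.
intros Ht n0 nPI x E. assert (P := PI_RGT_0).
assert (Es : x * sin t = 0).
{ apply (f_equal snd) in E. unfold expi, Cmult, RtoC in E; simpl in E. lra. }
assert (nx : x <> 0).
{ intros ->. apply (f_equal fst) in E. unfold expi, Cmult, RtoC in E; simpl in E. lra. }
assert (S : sin t = 0) by (destruct (Rmult_integral _ _ Es); [contradiction|assumption]).
destruct (Rlt_le_dec t PI) as [L|L].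
- assert (0 < sin t) by (apply sin_gt_0; lra). lra.
- assert (sin t < 0) by (apply sin_lt_0; lra). lra.
Qed.

(** The inscribed angle theorem: the arc subtends [2 pi - 2 theta] at the centre. By [expi_minus]
    both differences factor, and at parameter [t] the quotient is [expi theta] times
    [sin (t de / 2) / sin ((1 - t) de / 2)], which takes every positive value. *)
Lemma arc_of_ray (w1 w2 : C) (theta : R) :
  w1 <> w2 -> 0 < theta < 2 * PI -> theta <> PI ->
  circular_arc_joining w1 w2 (fun w => w = w1 \/ w = w2 \/
    exists T, 0 < T /\ (w - w1)%C = (RtoC T * expi theta * (w - w2))%C).
Proof.
intros nw Ht nPI. assert (P := PI_RGT_0).
set (de := 2 * PI - 2 * theta).
assert (dn : de <> 0) by (unfold de; lra).
assert (db : - (2 * PI) < de < 2 * PI) by (unfold de; lra).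
assert (Sd : sin (de / 2) <> 0).
{ destruct (Rtotal_order de 0) as [L|[L|L]]; [|contradiction|].
  - assert (0 < sin (- (de / 2))) by (apply sin_gt_0; lra). rewrite sin_neg in H. lra.
  - assert (0 < sin (de / 2)) by (apply sin_gt_0; lra). lra. }
assert (Nd : (expi de - 1)%C <> 0%C).
{ rewrite <- expi_0, expi_minus. rewrite Rminus_0_r. repeat apply Cmult_neq_0.
  - intros Z; apply RtoC_inj in Z; lra.
  - apply Ci_neq_0.
  - intros Z; apply RtoC_inj in Z; lra.
  - apply expi_neq_0. }
(* The vector from the centre to [w1], determined by the demand that rotation by [de] about the
   centre takes [w1] to [w2]. *)
set (v := ((w2 - w1) / (expi de - 1))%C).
assert (nv : v <> 0%C).
{ unfold v, Cdiv. apply Cmult_neq_0.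
  - intros Z. apply nw. replace w2 with (w2 - w1 + w1)%C by ring. rewrite Z. ring.
  - intros Z. apply (f_equal (fun z => (expi de - 1) * z)%C) in Z. rewrite Cinv_r, Cmult_0_r in Z by exact Nd.
    apply RtoC_inj in Z; lra. }
destruct (polar_exists v) as [al Hal]. set (r := Cmod v) in *.
assert (r0 : 0 < r) by now apply Cmod_gt_0.
assert (Arc : forall t, arc_point (w1 - v) r al de t = (w1 - v + v * expi (t * de))%C).
{ intros t. unfold arc_point. rewrite Hal at 3. rewrite <- Cmult_assoc, <- expi_plus.
  f_equal. unfold expi, RtoC, Cmult; simpl. f_equal; ring. }
assert (D1 : forall t, (w1 - v + v * expi (t * de) - w1)%C = (2 * Ci * v * expi (t * de / 2) * RtoC (sin (t * de / 2)))%C).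
{ intros t. transitivity (v * (expi (t * de) - expi 0))%C; [rewrite expi_0; ring|].
  rewrite expi_minus, Rminus_0_r, Rplus_0_r. ring. }
assert (Ev : (v * (expi de - 1))%C = (w2 - w1)%C) by (unfold v; field; exact Nd).
assert (Et : expi theta = (- expi (- (de / 2)))%C).
{ replace theta with (PI + - (de / 2)) by (unfold de; field). rewrite expi_plus, expi_PI. ring. }
assert (D2 : forall t, (expi theta * (w1 - v + v * expi (t * de) - w2))%C
   = (2 * Ci * v * expi (t * de / 2) * RtoC (sin ((1 - t) * de / 2)))%C).
{ intros t. replace w2 with (w1 + v * (expi de - 1))%C by (rewrite Ev; ring).
  transitivity (expi theta * (v * (expi (t * de) - expi de)))%C; [ring|].
  rewrite expi_minus, Et.
  replace ((t * de - de) / 2) with (- ((1 - t) * de / 2)) by field. rewrite sin_neg, RtoC_opp.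
  replace (expi (t * de / 2)) with (expi (- (de / 2)) * expi ((t * de + de) / 2))%C
    by (rewrite <- expi_plus; f_equal; field). ring. }
assert (Pos : forall t, 0 < t < 1 -> 0 < sin (t * de / 2) / sin ((1 - t) * de / 2) /\ sin ((1 - t) * de / 2) <> 0).
{ intros t Htt. destruct (Rtotal_order de 0) as [L|[L|L]]; [|contradiction|].
  - assert (A1 : 0 < sin (- (t * de / 2))) by (apply sin_gt_0; nra).
    assert (A2 : 0 < sin (- ((1 - t) * de / 2))) by (apply sin_gt_0; nra).
    rewrite sin_neg in A1, A2. split; [|lra].
    replace (sin (t * de / 2) / sin ((1 - t) * de / 2)) with ((- sin (t * de / 2)) / (- sin ((1 - t) * de / 2))) by (field; lra).
    now apply Rdiv_lt_0_compat.
  - assert (A1 : 0 < sin (t * de / 2)) by (apply sin_gt_0; nra).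
    assert (A2 : 0 < sin ((1 - t) * de / 2)) by (apply sin_gt_0; nra).
    split; [now apply Rdiv_lt_0_compat|lra]. }
exists (w1 - v)%C, r, al, de. split; [exact r0|]. split.
{ split; [now apply Rabs_pos_lt|]. apply Rabs_def1; lra. }
assert (A0 : arc_point (w1 - v) r al de 0 = w1) by (rewrite Arc, Rmult_0_l, expi_0; ring).
assert (A1 : arc_point (w1 - v) r al de 1 = w2).
{ rewrite Arc, Rmult_1_l. transitivity (w1 + v * (expi de - 1))%C; [ring|]. rewrite Ev. ring. }
split; [exact A0|]. split; [exact A1|].
intros w. split.
- intros [->|[->|[T [T0 HT]]]].
  + exists 0. split; [lra|now symmetry].
  + exists 1. split; [lra|now symmetry].
  + assert (Ex : exists t, 0 < t < 1 /\ sin (t * de / 2) = T * sin ((1 - t) * de / 2)).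
    (* The factor [sin (de / 2)] makes [h] negative at [0] and positive at [1] for either sign of
       [de]. *)
    { set (h := fun t => sin (de / 2) * (sin (t * de / 2) - T * sin ((1 - t) * de / 2))).
      assert (S2 : 0 < sin (de / 2) * sin (de / 2)).
      { generalize (Rlt_0_sqr (sin (de / 2)) Sd). unfold Rsqr. lra. }
      destruct (IVT h 0 1) as [t [Htt Zt]].
      - unfold h. reg.
      - lra.
      - unfold h. replace (0 * de / 2) with 0 by field. replace ((1 - 0) * de / 2) with (de / 2) by field. rewrite sin_0. nra.
      - unfold h. replace (1 * de / 2) with (de / 2) by field. replace ((1 - 1) * de / 2) with 0 by field. rewrite sin_0. nra.
      - exists t. assert (Z : sin (t * de / 2) - T * sin ((1 - t) * de / 2) = 0).
        { unfold h in Zt. destruct (Rmult_integral _ _ Zt); [contradiction|assumption]. }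
        split; [|lra]. split.
        + destruct (Req_dec t 0) as [->|]; [|lra]. exfalso.
          replace (0 * de / 2) with 0 in Z by field. replace ((1 - 0) * de / 2) with (de / 2) in Z by field. rewrite sin_0 in Z.
          assert (T * sin (de / 2) = 0) by lra. destruct (Rmult_integral _ _ H); lra.
        + destruct (Req_dec t 1) as [->|]; [|lra]. exfalso.
          replace (1 * de / 2) with (de / 2) in Z by field. replace ((1 - 1) * de / 2) with 0 in Z by field. rewrite sin_0 in Z. lra. }
    destruct Ex as [t [Htt Es]]. exists t. split; [lra|]. rewrite Arc.
    set (y := (w1 - v + v * expi (t * de))%C).
    assert (Hy : (y - w1)%C = (RtoC T * expi theta * (y - w2))%C).
    { unfold y. rewrite D1, <- (Cmult_assoc (RtoC T)), D2, Es, RtoC_mult. ring. }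
    assert (N1 : (1 - RtoC T * expi theta)%C <> 0%C).
    { intros Z. apply (expi_real theta ltac:(lra) ltac:(lra) nPI T).
      replace (RtoC T * expi theta)%C with (1 - (1 - RtoC T * expi theta))%C by ring. rewrite Z. ring. }
    assert (Hd : ((w - y) * (1 - RtoC T * expi theta))%C = 0%C).
    { transitivity ((w - w1) - (y - w1) - RtoC T * expi theta * (w - w2) + RtoC T * expi theta * (y - w2))%C; [ring|].
      rewrite HT, Hy. ring. }
    apply NNPP. intros n. revert Hd. apply Cmult_neq_0; [|exact N1].
    intros Z. apply n. replace w with (w - y + y)%C by ring. rewrite Z. ring.
- intros [t [Htt ->]].
  destruct (Req_dec t 0) as [->|n0]; [left; exact A0|].
  destruct (Req_dec t 1) as [->|n1]; [right; left; exact A1|].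
  right; right. destruct (Pos t ltac:(lra)) as [T0 nS].
  exists (sin (t * de / 2) / sin ((1 - t) * de / 2)). split; [exact T0|].
  rewrite Arc, D1, <- (Cmult_assoc (RtoC (_ / _))), D2, RtoC_div by exact nS. field.
  intros Z. apply RtoC_inj in Z. contradiction.
Qed.

(** * Meromorphic functions of the disk *)

(** Every point of [S] is the only one of [S] in some cell of a fine enough square grid, and the
    Cantor pairing enumerates the meshes together with their cells. Adding [1] to the coordinates
    makes the cell indices nonnegative. *)
Lemma isolated_countable (S : C -> Prop) :
  (forall p, S p -> Cmod p < 1) ->
  (forall p, S p -> exists rho, 0 < rho /\ forall z, S z -> Cmod (z - p) < rho -> z = p) ->
  exists e : nat -> C, forall p, S p -> exists n, e n = p.
Proof.
intros S1 Siso.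
set (cell := fun (n : nat) (z : C) => let (m, ij) := Cantor.of_nat n in let (i, j) := Cantor.of_nat ij in
  INR i <= INR (m + 1) * (fst z + 1) < INR i + 1 /\ INR j <= INR (m + 1) * (snd z + 1) < INR j + 1).
destruct (functional_choice (fun n c => forall z, S z -> cell n z -> (forall z', S z' -> cell n z' -> z' = z) -> c = z)) as [e He].
{ intros n. destruct (classic (exists z, S z /\ cell n z)) as [[z [Sz Cz]]|nE].
  - exists z. intros z2 Sz2 Cz2 U. now apply U.
  - exists 0%C. intros z Sz Cz. exfalso. apply nE. now exists z. }
exists e. intros p Sp. destruct (Siso p Sp) as [rho [rho0 Hrho]].
destruct (nfloor_ex (2 / rho)) as [m Hm]; [apply Rdiv_le_0_compat; lra|].
set (M := INR (m + 1)). assert (HM : M = INR m + 1) by (unfold M; rewrite plus_INR; reflexivity).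
assert (M0 : 0 < M) by (rewrite HM; generalize (pos_INR m); lra).
assert (Mr : 2 < rho * M).
{ apply Rle_lt_trans with (rho * (2 / rho)); [right; field; lra|]. apply Rmult_lt_compat_l; lra. }
assert (Hp := S1 p Sp).
assert (Hx := re_le_Cmod p). assert (Hy := Rle_trans _ _ _ (Rmax_r _ _) (Rmax_Cmod p)).
apply Rabs_le_between in Hx. apply Rabs_le_between in Hy. unfold Re in Hx.
destruct (nfloor_ex (M * (fst p + 1))) as [i Hi]; [apply Rmult_le_pos; lra|].
destruct (nfloor_ex (M * (snd p + 1))) as [j Hj]; [apply Rmult_le_pos; lra|].
exists (Cantor.to_nat (m, Cantor.to_nat (i, j))). apply He; [exact Sp| |].
- unfold cell. rewrite !Cantor.cancel_of_to. fold M. split; assumption.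
- intros z Sz Cz. unfold cell in Cz. rewrite !Cantor.cancel_of_to in Cz. fold M in Cz. destruct Cz as [Cx Cy].
  apply Hrho; [exact Sz|]. eapply Rle_lt_trans; [apply Cmod_le_re_im|].
  apply Rmult_lt_reg_l with M; [exact M0|].
  assert (B : forall a b k, k <= M * (a + 1) < k + 1 -> k <= M * (b + 1) < k + 1 -> M * Rabs (a - b) < 1).
  { intros a b k Ha Hb. rewrite <- (Rabs_pos_eq M), <- Rabs_mult by lra. apply Rabs_def1; lra. }
  assert (B1 := B _ _ _ Cx Hi). assert (B2 := B _ _ _ Cy Hj). unfold Cminus, Cplus, Copp; simpl. unfold Rminus in B1, B2. lra.
Qed.

(** By [critical_point_dichotomy] a critical point is isolated, and then it spoils a single angle,
    or [F] is constant near it, which is what the conclusion asks. *)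
Lemma critical_angles_countable (F dF : C -> C) (V : C -> Prop) :
  regular F dF V -> exists e : nat -> R, forall theta, 0 <= theta < 2 * PI -> (forall m, e m <> theta) ->
    forall p T, V p -> 0 < T -> F p = (RtoC T * expi theta)%C -> dF p = 0%C ->
    exists d, 0 < d /\ forall y, Cmod (y - p) < d -> F y = F p.
Proof.
intros HF.
set (S := fun p => V p /\ dF p = 0%C /\ exists d, 0 < d /\ forall y, Cmod (y - p) < d -> y <> p -> dF y <> 0%C).
destruct (isolated_countable S) as [c Hc].
{ intros p [Vp _]. now apply (reg_disk _ _ _ HF). }
{ intros p [_ [_ [d [d0 Hd]]]]. exists d. split; [exact d0|]. intros z [_ [Z _]] Hz.
  apply NNPP. intros n. now apply (Hd z Hz n). }
destruct (functional_choice (fun n s => forall t T, 0 <= t < 2 * PI -> 0 < T -> F (c n) = (RtoC T * expi t)%C -> s = t)) as [e He].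
{ intros n. destruct (classic (exists t T, 0 <= t < 2 * PI /\ 0 < T /\ F (c n) = (RtoC T * expi t)%C)) as [[t [T [Ht [HT E]]]]|nE].
  - exists t. intros t' T' Ht' HT' E'. rewrite E in E'. now apply (polar_unique T T' t t').
  - exists 0. intros t T Ht HT E. exfalso. apply nE. now exists t, T. }
exists e. intros theta Ht Hbad p T Vp T0 Ep cr.
destruct (reg_open _ _ _ HF p Vp) as [r [r0 Hr]].
destruct (critical_point_dichotomy F dF p r r0) as [D|D]; [|exact D|].
- intros z Hz. apply (reg_deriv _ _ _ HF). now apply Hr.
- exfalso. destruct (Hc p) as [n En]; [repeat split; assumption|].
  apply (Hbad n). apply (He n theta T Ht T0). now rewrite En.
Qed.

Lemma countable_union (a b : nat -> R) : exists e : nat -> R, forall x, (forall m, e m <> x) ->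
  (forall m, a m <> x) /\ (forall m, b m <> x).
Proof.
exists (fun n => if Nat.even n then a (Nat.div2 n) else b (Nat.div2 n)). intros x H. split; intros m E.
- apply (H (2 * m)%nat). now rewrite Nat.even_even, Nat.div2_double.
- apply (H (S (2 * m))). now rewrite Nat.even_succ, Nat.odd_even, Nat.div2_succ_double.
Qed.

(* The values of [q] and [dq] on [pole] are junk. *)
Record mero (q dq : C -> C) (pole : C -> Prop) : Prop := {
  mero_open : forall z, Cmod z < 1 -> ~ pole z -> exists d, 0 < d /\ forall y, Cmod (y - z) < d -> ~ pole y;
  mero_deriv : forall z, Cmod z < 1 -> ~ pole z -> cderiv q z (dq z);
  mero_blowup : forall z, Cmod z < 1 -> pole z -> forall M, exists d, 0 < d /\
    forall y, Cmod (y - z) < d -> ~ pole y -> M < Cmod (q y)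
}.

Lemma cderiv_conj (f : C -> C) (z l : C) :
  cderiv f (Cconj z) l -> cderiv (fun x => Cconj (f (Cconj x))) z (Cconj l).
Proof.
intros H eps e0. destruct (H eps e0) as [d [d0 Hd]]. exists d; split; [exact d0|]. intros y Hy.
assert (E : Cmod (Cconj y - Cconj z) = Cmod (y - z)) by (now rewrite <- Cminus_conj, Cmod_conj).
specialize (Hd (Cconj y)). rewrite E in Hd. specialize (Hd Hy).
rewrite <- Cmod_conj, !Cminus_conj, Cmult_conj, Cminus_conj, !Cconj_conj in Hd. exact Hd.
Qed.

(** Needed for the second half of the disk: reflecting argument and value turns the reciprocal ray,
    of angle [- theta], into one of angle [theta]. *)
Lemma mero_conj (q dq : C -> C) (pole : C -> Prop) : mero q dq pole ->
  mero (fun z => Cconj (q (Cconj z))) (fun z => Cconj (dq (Cconj z))) (fun z => pole (Cconj z)).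
Proof.
intros [H1 H2 H3]. split.
- intros z Hz nP. destruct (H1 (Cconj z)) as [d [d0 Hd]]; [now rewrite Cmod_conj|exact nP|].
  exists d; split; [exact d0|]. intros y Hy. apply Hd. now rewrite <- Cminus_conj, Cmod_conj.
- intros z Hz nP. apply cderiv_conj. apply H2; [now rewrite Cmod_conj|exact nP].
- intros z Hz P M. destruct (H3 (Cconj z) ltac:(now rewrite Cmod_conj) P M) as [d [d0 Hd]].
  exists d; split; [exact d0|]. intros y Hy nP. rewrite Cmod_conj. apply Hd; [|exact nP].
  now rewrite <- Cminus_conj, Cmod_conj.
Qed.

Lemma locally_Cmod (z : C) (P : C -> Prop) :
  locally z P <-> exists d, 0 < d /\ forall y, Cmod (y - z) < d -> P y.
Proof.
split.
- intros [d Hd]. exists d. split; [apply cond_pos|]. intros y Hy. apply Hd.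
  now apply C_NormedModule_mixin_compat1.
- intros [d [d0 Hd]]. assert (s0 : 0 < sqrt 2) by (apply sqrt_lt_R0; lra).
  assert (e0 : 0 < d / sqrt 2) by now apply Rdiv_lt_0_compat.
  exists (mkposreal _ e0). intros y Hy. apply Hd.
  assert (Q := C_NormedModule_mixin_compat2 z y (mkposreal _ e0) Hy). simpl in Q.
  replace (sqrt 2 * (d / sqrt 2)) with d in Q by (field; lra). exact Q.
Qed.

Lemma mderive_cderiv (f : C -> Cbar) (z : C) :
  ex_derive (K := C_AbsRing) (V := C_NormedModule) (fin_part f) z -> cderiv (fin_part f) z (mderive f z).
Proof. intros H. apply cderiv_is_derive. apply C_derive_correct; [exact z|exact H]. Qed.

Lemma meromorphic_mero (f : C -> Cbar) :
  meromorphic_on unit_disk f -> mero (fin_part f) (mderive f) (fun z => f z = Cinfty).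
Proof.
intros H. split.
- intros z Hz nP. specialize (H z Hz). destruct (f z); [|tauto]. destruct H as [H _].
  now apply locally_Cmod in H.
- intros z Hz nP. specialize (H z Hz). destruct (f z); [|tauto]. destruct H as [_ H]. now apply mderive_cderiv.
- intros z Hz P M. specialize (H z Hz). rewrite P in H. destruct H as [_ H].
  assert (L : locally' z (fun x => M < Cmod (fin_part f x))).
  { apply (H (fun x => M < x)). now exists M. }
  apply locally_Cmod in L. destruct L as [d [d0 Hd]]. exists d; split; [exact d0|].
  intros y Hy nP. apply Hd; [exact Hy|]. intros ->. now apply nP.
Qed.

(** * The quotient of the differences to [w1] and [w2], composed with a half-disk map *)

Section Pullback.

Variables (q dq : C -> C) (pole : C -> Prop) (Z dZ : C -> C) (w1 w2 : C).
Hypothesis Hm : mero q dq pole.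
Hypothesis HZ : forall s, Cmod s < 1 -> Cmod (Z s) < 1 /\ cderiv Z s (dZ s).
Hypothesis nw : w1 <> w2.

Definition pullback (s : C) : C := ((q (Z s) - w1) / (q (Z s) - w2))%C.
Definition dpullback (s : C) : C :=
  (((dq (Z s) * dZ s) * (q (Z s) - w2) - (q (Z s) - w1) * (dq (Z s) * dZ s)) / ((q (Z s) - w2) * (q (Z s) - w2)))%C.
(** Poles are left out although the quotient has the limit [1] there, since [q] carries a junk value
    at a pole. *)
Definition pulldom (s : C) : Prop := Cmod s < 1 /\ ~ pole (Z s) /\ q (Z s) <> w2.

Lemma sub_neq_0 (x y : C) : x <> y -> (x - y)%C <> 0%C.
Proof. intros n E. apply n. replace x with (x - y + y)%C by ring. rewrite E. ring. Qed.

Lemma pull_deriv (s : C) : Cmod s < 1 -> ~ pole (Z s) -> cderiv (fun s => q (Z s)) s (dq (Z s) * dZ s)%C.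
Proof.
intros Hs nP. destruct (HZ s Hs) as [Hz Hd]. apply cderiv_comp; [exact Hd|]. now apply (mero_deriv _ _ _ Hm).
Qed.

Lemma cderiv_sub_const (f : C -> C) (c z l : C) : cderiv f z l -> cderiv (fun x => f x - c)%C z l.
Proof.
intros H. generalize (cderiv_plus _ _ z _ _ H (cderiv_const (- c) z)). now rewrite Cplus_0_r.
Qed.

Lemma pullback_regular :
  ~ pole (Z 0) -> q (Z 0) = w1 -> dq (Z 0) <> 0%C -> dZ 0 <> 0%C -> regular pullback dpullback pulldom.
Proof.
intros nP E nd nZ. split.
- intros s [Hs [nPs nws]].
  assert (cZ := cderiv_ccont _ _ _ (proj2 (HZ s Hs))).
  destruct (mero_open _ _ _ Hm (Z s) (proj1 (HZ s Hs)) nPs) as [d1 [d10 Hd1]].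
  destruct (cZ d1 d10) as [d2 [d20 Hd2]].
  destruct (ccont_neq_0 (fun s => q (Z s) - w2)%C s) as [d3 [d30 Hd3]].
  { eapply cderiv_ccont, cderiv_sub_const. now apply pull_deriv. }
  { now apply sub_neq_0. }
  exists (Rmin (Rmin d2 d3) (1 - Cmod s)). split; [repeat apply Rmin_pos; lra|].
  intros y Hy. assert (y1 := lt_min_l _ _ _ Hy). assert (y2 := lt_min_r _ _ _ Hy).
  split; [|split].
  + generalize (Cmod_sub_le y s). lra.
  + apply Hd1, Hd2. exact (lt_min_l _ _ _ y1).
  + intros Ey. apply (Hd3 y (lt_min_r _ _ _ y1)). rewrite Ey. ring.
- intros s [Hs _]. exact Hs.
- intros s [Hs [nPs nws]]. apply (cderiv_div (fun s => q (Z s) - w1)%C (fun s => q (Z s) - w2)%C).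
  + now apply sub_neq_0.
  + apply cderiv_sub_const. now apply pull_deriv.
  + apply cderiv_sub_const. now apply pull_deriv.
- split; [rewrite Cmod_0; lra|]. split; [exact nP|]. now rewrite E.
- unfold pullback. rewrite E. field. now apply sub_neq_0.
- unfold dpullback. rewrite E.
  replace (dq (Z 0) * dZ 0 * (w1 - w2) - (w1 - w1) * (dq (Z 0) * dZ 0))%C with (dq (Z 0) * dZ 0 * (w1 - w2))%C by ring.
  assert (n := sub_neq_0 w1 w2 nw).
  replace (dq (Z 0) * dZ 0 * (w1 - w2) / ((w1 - w2) * (w1 - w2)))%C with (dq (Z 0) * dZ 0 * / (w1 - w2))%C by (field; exact n).
  repeat apply Cmult_neq_0; try assumption. intros E2. apply (f_equal (fun z => (w1 - w2) * z)%C) in E2.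
  rewrite Cinv_r, Cmult_0_r in E2 by exact n. apply RtoC_inj in E2. lra.
Qed.

Lemma dpullback_0 : q (Z 0) = w1 -> Cmod (dpullback 0) = Cmod (dq (Z 0)) * Cmod (dZ 0) / Cmod (w1 - w2).
Proof.
intros E. unfold dpullback. rewrite E. assert (n := sub_neq_0 w1 w2 nw).
replace ((dq (Z 0) * dZ 0 * (w1 - w2) - (w1 - w1) * (dq (Z 0) * dZ 0)) / ((w1 - w2) * (w1 - w2)))%C
  with (dq (Z 0) * dZ 0 / (w1 - w2))%C by (field; exact n).
now rewrite Cmod_div, Cmod_mult.
Qed.

(* At a pole of [q] the value of [pullback] tends to [1], and at a [w2]-point to infinity. *)
Lemma pullback_escape (theta : R) : (forall x, (RtoC x * expi theta)%C <> 1%C) ->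
  forall p, Cmod p < 1 -> ~ pulldom p -> forall T, 0 < T -> exists d, 0 < d /\
    forall z, pulldom z -> Cmod (z - p) < d -> d <= Cmod (pullback z - RtoC T * expi theta).
Proof.
intros Hth p Hp nV T T0. destruct (HZ p Hp) as [Hz Hd]. assert (cZ := cderiv_ccont _ _ _ Hd).
assert (n := sub_neq_0 w1 w2 nw). assert (W : 0 < Cmod (w1 - w2)) by now apply Cmod_gt_0.
assert (Key : forall z, pulldom z -> (pullback z - 1)%C = (- (w1 - w2) / (q (Z z) - w2))%C).
{ intros z [_ [_ nz]]. unfold pullback. field. now apply sub_neq_0. }
destruct (classic (pole (Z p))) as [P|nP].
- set (m := Cmod (RtoC T * expi theta - 1)).
  assert (m0 : 0 < m) by (apply Cmod_gt_0, sub_neq_0, Hth).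
  destruct (mero_blowup _ _ _ Hm (Z p) Hz P (2 * Cmod (w1 - w2) / m + Cmod w2)) as [d1 [d10 Hd1]].
  destruct (cZ d1 d10) as [d2 [d20 Hd2]].
  exists (Rmin d2 (m / 2)). split; [apply Rmin_pos; lra|]. intros z Hzd Hzp.
  assert (B := Hd1 (Z z) (Hd2 z (lt_min_l _ _ _ Hzp)) (proj1 (proj2 Hzd))).
  assert (Q := Cmod_sub_le (q (Z z)) w2).
  assert (m2 : 0 < 2 * Cmod (w1 - w2) / m) by (apply Rdiv_lt_0_compat; lra).
  assert (Sm : Cmod (pullback z - 1) <= m / 2).
  { rewrite (Key z Hzd), Cmod_div, Cmod_opp by (apply sub_neq_0, (proj2 (proj2 Hzd))).
    apply Rle_div_l; [lra|].
    assert (2 * Cmod (w1 - w2) / m * m <= Cmod (q (Z z) - w2) * m) by (apply Rmult_le_compat_r; lra).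
    replace (2 * Cmod (w1 - w2) / m * m) with (2 * Cmod (w1 - w2)) in H by (field; lra). lra. }
  assert (Q2 := Cmod_tri3 (RtoC T * expi theta) (pullback z) 1). fold m in Q2.
  rewrite (Cmod_sub_sym (RtoC T * expi theta)) in Q2. generalize (Rmin_r d2 (m / 2)). lra.
- assert (Ew : q (Z p) = w2) by (apply NNPP; intros nE; apply nV; repeat split; assumption).
  assert (cq := cderiv_ccont _ _ _ (pull_deriv p Hp nP)).
  set (K := 2 + T). destruct (cq (Cmod (w1 - w2) / K)) as [d [d0 Hdd]]; [apply Rdiv_lt_0_compat; unfold K; lra|].
  exists (Rmin d 1). split; [apply Rmin_pos; lra|]. intros z Hzd Hzp.
  specialize (Hdd z (lt_min_l _ _ _ Hzp)). rewrite Ew in Hdd.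
  assert (nz : (q (Z z) - w2)%C <> 0%C) by (apply sub_neq_0, (proj2 (proj2 Hzd))).
  assert (N0 : 0 < Cmod (q (Z z) - w2)) by now apply Cmod_gt_0.
  assert (Bg : K <= Cmod (pullback z - 1)).
  { rewrite (Key z Hzd), Cmod_div, Cmod_opp by exact nz.
    apply Rle_div_r; [exact N0|].
    apply Rle_trans with (K * (Cmod (w1 - w2) / K)); [apply Rmult_le_compat_l; unfold K in *; lra|right; field; unfold K; lra]. }
  assert (Q := Cmod_tri3 (pullback z) (RtoC T * expi theta) 1).
  assert (Q2 := Cmod_le_sub (RtoC T * expi theta) 1). rewrite Cmod_mult, Cmod_R, Cmod_expi, Cmod_1, Rabs_pos_eq in Q2 by lra.
  generalize (Rmin_r d 1). unfold K in Bg. lra.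
Qed.

Lemma pullback_good : regular pullback dpullback pulldom ->
  exists e : nat -> R, forall theta, 0 <= theta < 2 * PI -> theta <> 0 -> theta <> PI -> (forall m, e m <> theta) ->
    good_angle pullback dpullback pulldom theta.
Proof.
intros HF. destruct (critical_angles_countable _ _ _ HF) as [e He]. exists e.
intros theta Ht n0 nPI Hb. split.
- apply pullback_escape. now apply expi_real.
- now apply He.
Qed.

End Pullback.

(** * The inequality *)

Lemma meromorphic_inequality (f : C -> Cbar) (z1 z2 w1 w2 : C) :
  admissible f z1 z2 w1 w2 ->
  Cmod ((RtoC (1 - Cmod z1 ^ 2) * mderive f z1)
        * (RtoC (1 - Cmod z2 ^ 2) * mderive f z2))%C
    * tanh (hyp_dist z1 z2) ^ 2
  <= Cmod (w1 - w2)%C ^ 2.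
Proof.
intros [Hmer [Hz1 [Hz2 [E1 [E2 [nw Harc]]]]]].
rewrite tanh_hyp_dist by assumption.
unfold unit_disk in Hz1, Hz2.
set (a1 := mderive f z1). set (a2 := mderive f z2). set (rho := Cmod ((z1 - z2) / (1 - Cconj z1 * z2))).
(* A vanishing derivative makes the left side [0]. In the remaining case both pullbacks have a
   simple zero at the origin, as [regular] demands. *)
destruct (classic (a1 = 0%C)) as [A1|A1].
{ rewrite A1, Cmult_0_r, Cmult_0_l, Cmod_0, Rmult_0_l. apply pow_le, Cmod_ge_0. }
destruct (classic (a2 = 0%C)) as [A2|A2].
{ rewrite A2, !Cmult_0_r, Cmod_0, Rmult_0_l. apply pow_le, Cmod_ge_0. }
set (q := fin_part f). set (pole := fun z => f z = Cinfty).
assert (Hm : mero q (mderive f) pole) by now apply meromorphic_mero.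
assert (nz : z1 <> z2) by (intros Ez; subst z2; rewrite E1 in E2; injection E2; exact nw).
assert (nz' : Cconj z2 <> Cconj z1).
{ intros Ez. apply nz. rewrite <- (Cconj_conj z1), <- Ez. apply Cconj_conj. }
assert (q1 : q z1 = w1) by (unfold q, fin_part; now rewrite E1).
assert (q2 : q z2 = w2) by (unfold q, fin_part; now rewrite E2).
assert (np1 : ~ pole z1) by (unfold pole; rewrite E1; discriminate).
assert (np2 : ~ pole z2) by (unfold pole; rewrite E2; discriminate).
destruct (half_disk_map z1 z2 Hz1 Hz2 nz) as [Z [dZ [Z0 [dZ0 HZ]]]].
(* The second map is built from conjugated points and values with the roles of [z1] and [z2]
   exchanged; its lift at parameter [/ T] lies over the same point of the arc as a first lift at
   [T]. *)
destruct (half_disk_map (Cconj z2) (Cconj z1)) as [Y [dY [Y0 [dY0 HY]]]]; [now rewrite Cmod_conj|now rewrite Cmod_conj|exact nz'|].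
fold rho in dZ0. rewrite Cconj_conj, Cmod_conj in dY0.
assert (Erho : Cmod ((Cconj z2 - Cconj z1) / (1 - z2 * Cconj z1)) = rho).
{ unfold rho. assert (N : (1 - Cconj z1 * z2)%C <> 0%C).
  { apply one_minus_neq_0. rewrite Cmod_mult, Cmod_conj. generalize (Cmod_ge_0 z1) (Cmod_ge_0 z2). nra. }
  rewrite (Cmult_comm z2), !Cmod_div by exact N. now rewrite <- Cminus_conj, Cmod_conj, Cmod_sub_sym. }
rewrite Erho in dY0.
assert (rho0 : 0 < rho).
{ apply Cmod_gt_0. unfold Cdiv. apply Cmult_neq_0; [now apply sub_neq_0|].
  intros Ez. assert (N : (1 - Cconj z1 * z2)%C <> 0%C).
  { apply one_minus_neq_0. rewrite Cmod_mult, Cmod_conj. generalize (Cmod_ge_0 z1) (Cmod_ge_0 z2). nra. }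
  apply (f_equal (fun z => (1 - Cconj z1 * z2) * z)%C) in Ez. rewrite Cinv_r, Cmult_0_r in Ez by exact N.
  apply RtoC_inj in Ez. lra. }
assert (p1 : 0 < 1 - Cmod z1 ^ 2) by (generalize (Cmod_ge_0 z1); simpl; nra).
assert (p2 : 0 < 1 - Cmod z2 ^ 2) by (generalize (Cmod_ge_0 z2); simpl; nra).
assert (HZ' : forall s, Cmod s < 1 -> Cmod (Z s) < 1 /\ cderiv Z s (dZ s)) by (intros s Hs; destruct (HZ s Hs) as [? [? _]]; now split).
assert (HY' : forall s, Cmod s < 1 -> Cmod (Y s) < 1 /\ cderiv Y s (dY s)) by (intros s Hs; destruct (HY s Hs) as [? [? _]]; now split).
set (qc := fun z => Cconj (q (Cconj z))). set (dqc := fun z => Cconj (mderive f (Cconj z))). set (polec := fun z => pole (Cconj z)).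
assert (Hmc : mero qc dqc polec) by exact (mero_conj _ _ _ Hm).
assert (nwc : Cconj w2 <> Cconj w1).
{ intros Ez. apply nw. rewrite <- (Cconj_conj w1), <- Ez. apply Cconj_conj. }
assert (qY : qc (Y 0%C) = Cconj w2) by (unfold qc; now rewrite Y0, Cconj_conj, q2).
assert (R1 : regular (pullback q Z w1 w2) (dpullback q (mderive f) Z dZ w1 w2) (pulldom q pole Z w2)).
{ apply pullback_regular; [exact Hm|exact HZ'|exact nw|now rewrite Z0|now rewrite Z0|now rewrite Z0|].
  apply Cmod_gt_0. rewrite dZ0. now apply Rmult_lt_0_compat. }
assert (R2 : regular (pullback qc Y (Cconj w2) (Cconj w1)) (dpullback qc dqc Y dY (Cconj w2) (Cconj w1)) (pulldom qc polec Y (Cconj w1))).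
{ apply pullback_regular; [exact Hmc|exact HY'|exact nwc|unfold polec; now rewrite Y0, Cconj_conj|exact qY| |].
  - unfold dqc. rewrite Y0, Cconj_conj. apply Cmod_gt_0. rewrite Cmod_conj. now apply Cmod_gt_0.
  - apply Cmod_gt_0. rewrite dY0. now apply Rmult_lt_0_compat. }
destruct (pullback_good q (mderive f) pole Z dZ w1 w2 Hm HZ' nw R1) as [e1 He1].
destruct (pullback_good qc dqc polec Y dY (Cconj w2) (Cconj w1) Hmc HY' nwc R2) as [e2 He2].
destruct (countable_union e1 e2) as [e3 He3].
(* The angles [0] and [PI] join the exceptional ones: over them lie pieces of the line through [w1]
   and [w2]. *)
destruct (countable_union e3 (fun m => match m with O => 0 | _ => PI end)) as [e He].
assert (Main := competing_lifts _ _ _ _ _ _ e R1 R2).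
assert (M : Cmod (dpullback q (mderive f) Z dZ w1 w2 0) * Cmod (dpullback qc dqc Y dY (Cconj w2) (Cconj w1) 0) <= 1).
{ apply Main. clear Main. intros theta Ht Hbad.
  destruct (He theta Hbad) as [Hb3 Hb4]. destruct (He3 theta Hb3) as [Hb1 Hb2].
  assert (t0 : theta <> 0) by (intros Et; apply (Hb4 O); now symmetry).
  assert (tPI : theta <> PI) by (intros Et; apply (Hb4 1%nat); now symmetry).
  split; [now apply He1|]. split; [now apply He2|].
  intros T1 T2 x1 x2 T10 T20 [_ L1] [_ L2]. apply Rnot_lt_le. intros HT.
  assert (nE := expi_real theta Ht t0 tPI).
  (* The first lift supplies preimages for parameters up to [T1], the second for those from [/ T2]
     on. If [T1 * T2 > 1], these ranges overlap and together cover the whole arc. *)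
  set (U := fun T z => unit_disk z /\ exists w, f z = Cfinite w /\ (w - w1)%C = (RtoC T * expi theta * (w - w2))%C).
  assert (V1 : forall T, 0 < T <= T1 -> U T (Z (x1 T))).
  { intros T HTT. destruct (L1 T ltac:(lra)) as [[Hs [nP nq]] EF]. split; [apply HZ', Hs|].
    unfold pole in nP. unfold pullback, q, fin_part in EF. unfold q, fin_part in nq.
    destruct (f (Z (x1 T))) as [w|]; [|tauto]. simpl in *. exists w. split; [reflexivity|].
    rewrite <- EF. field. now apply sub_neq_0. }
  assert (V2 : forall T, / T2 <= T -> U T (Cconj (Y (x2 (/ T))))).
  { intros T HTT. assert (i2 : 0 < / T2) by now apply Rinv_0_lt_compat.
    assert (iT : 0 < / T) by (apply Rinv_0_lt_compat; lra).
    assert (iT2 : / T <= T2) by (rewrite <- (Rinv_inv T2); apply Rinv_le_contravar; lra).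
    destruct (L2 (/ T) ltac:(lra)) as [[Hs [nP nq]] EF].
    split; [unfold unit_disk; rewrite Cmod_conj; apply HY', Hs|].
    unfold polec, pole in nP. unfold pullback, qc, q, fin_part in EF. unfold qc, q, fin_part in nq.
    destruct (f (Cconj (Y (x2 (/ T))))) as [w|]; [|tauto]. simpl in *. exists w. split; [reflexivity|].
    assert (nq' : (Cconj w - Cconj w1)%C <> 0%C) by now apply sub_neq_0.
    assert (EG : (Cconj w - Cconj w2)%C = (RtoC (/ T) * expi theta * (Cconj w - Cconj w1))%C) by (rewrite <- EF; field; exact nq').
    apply (f_equal Cconj) in EG. rewrite !Cmult_conj, !Cminus_conj, !Cconj_conj in EG.
    assert (Ee : (expi theta * Cconj (expi theta))%C = 1%C) by (rewrite <- Cmod2_conj, Cmod_expi; f_equal; ring).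
    assert (Er : Cconj (RtoC (/ T)) = RtoC (/ T)) by (unfold Cconj, RtoC; simpl; f_equal; ring).
    rewrite EG, Er, RtoC_inv by lra.
    transitivity ((RtoC T * / RtoC T) * (expi theta * Cconj (expi theta)) * (w - w1))%C; [|ring].
    rewrite Ee, Cinv_r; [ring|]. intros Zr. apply RtoC_inj in Zr. lra. }
  assert (Cut : / T2 < T1).
  { apply Rmult_lt_reg_r with T2; [exact T20|]. rewrite Rinv_l by lra. exact HT. }
  assert (i2 : 0 < / T2) by now apply Rinv_0_lt_compat.
  assert (Uniq : forall T w w', (w - w1)%C = (RtoC T * expi theta * (w - w2))%C ->
     (w' - w1)%C = (RtoC T * expi theta * (w' - w2))%C -> w = w').
  { intros T w w' Hw Hw'. assert (Hd : ((w - w') * (1 - RtoC T * expi theta))%C = 0%C).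
    { transitivity ((w - w1) - (w' - w1) - RtoC T * expi theta * (w - w2) + RtoC T * expi theta * (w' - w2))%C; [ring|].
      rewrite Hw, Hw'. ring. }
    apply NNPP. intros n. revert Hd. apply Cmult_neq_0; apply sub_neq_0; [exact n|]. intros Z1. apply (nE T). now symmetry. }
  assert (Arc := arc_of_ray w1 w2 theta nw ltac:(lra) tPI).
  assert (Im : arc_in_image f (fun w => w = w1 \/ w = w2 \/
    exists T, 0 < T /\ (w - w1)%C = (RtoC T * expi theta * (w - w2))%C)).
  { intros w [->|[->|[T [T0 HTw]]]].
    - now exists z1.
    - now exists z2.
    - assert (HU : exists z, U T z).
      { destruct (Rle_lt_dec T T1) as [L|L]; [eexists; apply V1; lra|eexists; apply V2; lra]. }
      destruct HU as [z [Hz [w' [Ew' Hw']]]]. exists z. split; [exact Hz|]. now rewrite (Uniq T w w' HTw Hw'). }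
  assert (Un := Harc _ Arc Im).
  destruct (V1 T1 ltac:(lra)) as [Du [w [Ew Hw]]]. destruct (V2 T1 ltac:(lra)) as [Du' [w' [Ew' Hw']]].
  rewrite <- (Uniq T1 w w' Hw Hw') in Ew'.
  destruct (Un w) as [z0 [_ Hz0]]; [right; right; exists T1; now split|].
  (* Univalent covering identifies the two preimages over the parameter [T1], yet [HZ] and [HY] put
     them on opposite sides of the bisector of [z1] and [z2]. *)
  assert (Eq : Z (x1 T1) = Cconj (Y (x2 (/ T1)))).
  { rewrite <- (Hz0 _ (conj Du Ew)). exact (Hz0 _ (conj Du' Ew')). }
  destruct (L1 T1 ltac:(lra)) as [[Hs1 _] _].
  assert (iT : 0 < / T1) by (apply Rinv_0_lt_compat; lra).
  assert (iT2 : / T1 <= T2) by (rewrite <- (Rinv_inv T2); apply Rinv_le_contravar; lra).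
  destruct (L2 (/ T1) ltac:(lra)) as [[Hs2 _] _].
  destruct (HZ _ Hs1) as [_ [_ Q1]]. destruct (HY _ Hs2) as [_ [_ Q2]].
  rewrite <- (Cmod_conj ((Y _ - _) * _)), <- (Cmod_conj ((Y _ - Cconj z1) * _)) in Q2.
  rewrite !Cmult_conj, !Cminus_conj, !Cmult_conj, !Cconj_conj, <- Eq in Q2.
  replace (Cconj 1) with (RtoC 1) in Q2 by (unfold Cconj, RtoC; simpl; f_equal; ring). lra. }
rewrite (dpullback_0 q (mderive f) Z dZ w1 w2 nw ltac:(now rewrite Z0)) in M.
rewrite (dpullback_0 qc dqc Y dY (Cconj w2) (Cconj w1) nwc qY) in M.
rewrite dZ0, dY0, Z0 in M. unfold dqc in M. rewrite Y0, Cconj_conj, Cmod_conj in M. fold a1 a2 in M.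
rewrite <- Cminus_conj, Cmod_conj, (Cmod_sub_sym w2 w1) in M.
assert (W : 0 < Cmod (w1 - w2)) by now apply Cmod_gt_0, sub_neq_0.
rewrite !Cmod_mult, !Cmod_R, !Rabs_pos_eq by lra.
apply Rmult_le_reg_r with (/ Cmod (w1 - w2) * / Cmod (w1 - w2)).
{ apply Rmult_lt_0_compat; now apply Rinv_0_lt_compat. }
replace (Cmod (w1 - w2) ^ 2 * (/ Cmod (w1 - w2) * / Cmod (w1 - w2))) with 1 by (field; lra).
eapply Rle_trans; [|exact M]. right. unfold Rdiv. ring.
Qed.

(** * The extremal function *)

Lemma slit_map_deriv (z : C) : Cmod z < 1 ->
  cderiv (fun z => z / (1 - z * z))%C z ((1 + z * z) / ((1 - z * z) * (1 - z * z)))%C.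
Proof.
intros Hz. assert (N : (1 - z * z)%C <> 0%C).
{ apply one_minus_neq_0. rewrite Cmod_mult. generalize (Cmod_ge_0 z). nra. }
replace ((1 + z * z) / ((1 - z * z) * (1 - z * z)))%C
  with ((1 * (1 - z * z) - z * (0 + - (1) * (2 * z))) / ((1 - z * z) * (1 - z * z)))%C by (field; exact N).
apply (cderiv_div (fun z => z) (fun z => 1 - z * z)%C); [exact N|apply cderiv_id|].
apply cderiv_ext_loc with (f := fun z => (1 + - (1) * (z * z))%C) (d := 1); [lra|intros; ring|].
apply cderiv_plus; [apply cderiv_const|]. apply cderiv_scal, cderiv_sqr.
Qed.

(** [z / (1 - z^2)] is injective on the disk and maps each half cut off by the imaginary axis onto a
    half-plane. For points symmetric in that axis both pullbacks are therefore conformal self-maps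
    of the disk fixing [0], with derivatives of modulus [1]. At [1 / 2] the value is [2 / 3] and the
    derivative [20 / 9]; both sides equal [16 / 9]. *)
Lemma slit_map_equality : exists (f : C -> Cbar) (z1 z2 w1 w2 : C),
  admissible f z1 z2 w1 w2 /\
  Cmod ((RtoC (1 - Cmod z1 ^ 2) * mderive f z1)
        * (RtoC (1 - Cmod z2 ^ 2) * mderive f z2))%C
    * tanh (hyp_dist z1 z2) ^ 2
  = Cmod (w1 - w2)%C ^ 2.
Proof.
set (k := fun z : C => (z / (1 - z * z))%C).
set (f := fun z => Cfinite (k z)).
assert (H1 : unit_disk (RtoC (- / 2))) by (unfold unit_disk; rewrite Cmod_R, Rabs_left; lra).
assert (H2 : unit_disk (RtoC (/ 2))) by (unfold unit_disk; rewrite Cmod_R, Rabs_pos_eq; lra).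
assert (Kr : forall x, 1 - x * x <> 0 -> k (RtoC x) = RtoC (x / (1 - x * x))).
{ intros x n. unfold k. now rewrite RtoC_div, RtoC_minus, RtoC_mult. }
assert (Dr : forall x, Rabs x < 1 -> mderive f (RtoC x) = RtoC ((1 + x * x) / ((1 - x * x) * (1 - x * x)))).
{ intros x Hx. assert (n : 1 - x * x <> 0) by (apply Rabs_def2 in Hx; nra).
  unfold mderive. apply is_C_derive_unique. apply cderiv_is_derive.
  assert (Q := slit_map_deriv (RtoC x) ltac:(now rewrite Cmod_R)).
  replace (RtoC ((1 + x * x) / ((1 - x * x) * (1 - x * x))))
    with ((1 + RtoC x * RtoC x) / ((1 - RtoC x * RtoC x) * (1 - RtoC x * RtoC x)))%C; [exact Q|].
  rewrite RtoC_div by (now apply Rmult_integral_contrapositive_currified).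
  now rewrite RtoC_mult, RtoC_plus, RtoC_minus, RtoC_mult. }
exists f, (RtoC (- / 2)), (RtoC (/ 2)), (RtoC (- (2 / 3))), (RtoC (2 / 3)). split.
- split; [|split; [exact H1|split; [exact H2|split; [|split; [|split]]]]].
  + intros z Hz. simpl. split.
    * apply filter_forall. discriminate.
    * eexists. apply cderiv_is_derive. apply slit_map_deriv. exact Hz.
  + unfold f. rewrite Kr by lra. do 2 f_equal. field.
  + unfold f. rewrite Kr by lra. do 2 f_equal. field.
  + intros E. apply RtoC_inj in E. lra.
  + intros A _ Him w Aw. destruct (Him w Aw) as [z [Hz Ez]]. exists z. split; [now split|].
    intros y [Hy Ey]. rewrite <- Ez in Ey. assert (E : k y = k z) by exact (f_equal Cbar_fin Ey). unfold k in E. unfold unit_disk in Hz, Hy.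
    assert (B : forall a b : C, Cmod a < 1 -> Cmod b < 1 -> (1 - a * b)%C <> 0%C).
    { intros a b Ha Hb. apply one_minus_neq_0. rewrite Cmod_mult. generalize (Cmod_ge_0 a) (Cmod_ge_0 b). nra. }
    assert (Ny := B y y Hy Hy). assert (Nz := B z z Hz Hz).
    assert (Np : (1 + z * y)%C <> 0%C).
    { replace (1 + z * y)%C with (1 - (- z) * y)%C by ring. apply B; [now rewrite Cmod_opp|exact Hy]. }
    assert (Z : ((z - y) * (1 + z * y))%C = 0%C).
    { transitivity ((z / (1 - z * z) - y / (1 - y * y)) * ((1 - z * z) * (1 - y * y)))%C; [field; now split|].
      rewrite E. ring. }
    apply NNPP. intros n. revert Z. apply Cmult_neq_0; [now apply sub_neq_0|exact Np].
- rewrite tanh_hyp_dist by assumption.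
  rewrite !Dr by (try (rewrite Rabs_left; lra); rewrite Rabs_pos_eq; lra).
  rewrite !Cmod_R, Rabs_left, Rabs_pos_eq by lra.
  replace (Cconj (RtoC (- / 2))) with (RtoC (- / 2)) by (unfold Cconj, RtoC; simpl; f_equal; ring).
  rewrite <- !RtoC_mult, <- !RtoC_minus, <- RtoC_div by lra. rewrite !Cmod_R.
  match goal with |- Rabs ?a * Rabs ?b ^ 2 = Rabs ?c ^ 2 =>
    replace a with (25 / 9) by field; replace b with (- (4 / 5)) by field; replace c with (- (4 / 3)) by field end.
  rewrite !Rabs_Ropp, !Rabs_pos_eq by lra. field.
Qed.

Theorem corollary1 :
  (forall (f : C -> Cbar) (z1 z2 w1 w2 : C),
     admissible f z1 z2 w1 w2 ->
     Cmod ((RtoC (1 - Cmod z1 ^ 2) * mderive f z1)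
           * (RtoC (1 - Cmod z2 ^ 2) * mderive f z2))%C
       * tanh (hyp_dist z1 z2) ^ 2
     <= Cmod (w1 - w2)%C ^ 2)
  /\
  (exists (f : C -> Cbar) (z1 z2 w1 w2 : C),
     admissible f z1 z2 w1 w2 /\
     Cmod ((RtoC (1 - Cmod z1 ^ 2) * mderive f z1)
           * (RtoC (1 - Cmod z2 ^ 2) * mderive f z2))%C
       * tanh (hyp_dist z1 z2) ^ 2
     = Cmod (w1 - w2)%C ^ 2).
Proof. exact (conj meromorphic_inequality slit_map_equality). Qed.
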